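(* Let $G$ be a planar graph. (1) If $G$ contains no $3$-cycles and $\Delta(G)\geq 6$, then $\chi'_{gl}(G)\leq \Delta(G)+1$. (2) If $G$ contains no $3$-cycles and $\Delta(G)=5$, then $\chi'_{gl}(G)\leq 7$. (3) If $G$ contains no adjacent triangles, then $\chi'_{gl}(G)\leq \max\{7,\Delta(G)+2\}$. (4) If $G$ contains no $6$-cycles, then $\chi'_{gl}(G)\leq \max\{7,\Delta(G)+1\}$. (5) If $G$ contains no $7$-cycles, then $\chi'_{gl}(G)\leq \max\{8,\Delta(G)+2\}$.
   Context: All graphs are finite and simple; $\Delta(G)$ is the maximum degree of $G$. A $k$-cycle is a cycle of length $k$ (as a not necessarily induced subgraph). Two triangles are adjacent if they share an edge. $\ell(G)$ denotes the line graph of $G$ (its vertices are the edges of $G$, two being adjacent iff they share an endpoint in $G$). Let $H$ be a graph with a fixed orientation of its edges, $A$ an Abelian group, $L:V(H)\to 2^A$ a list assignment and $f:E(H)\to A$. An $(A,L,f)$-coloring of $H$ is a map $c:V(H)\to A$ with $c(v)\in L(v)$ for every vertex $v$ and $c(x)-c(y)\neq f(xy)$ for every edge $xy$ directed from $x$ to $y$. $H$ is $(A,L)$-colorable if it has an $(A,L,f)$-coloring for every $f:E(H)\to A$ (this does not depend on the orientation). $H$ is $k$-group choosable if it is $(A,L)$-colorable for every Abelian group $A$ of order at least $k$ and every $L$ with $|L(v)|=k$ for all $v\in V(H)$. $\chi_{gl}(H)$ is the smallest $k$ such that $H$ is $k$-group choosable. $\chi'_{gl}(G)=\chi_{gl}(\ell(G))$.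 *)

(* Defs.v *)
From HB Require Import structures.
From mathcomp Require Import all_boot all_order all_algebra finmap.
From mathcomp Require Import boolp classical_sets set_interval reals topology.
From mathcomp Require Import normedtype.

Set Implicit Arguments.
Unset Strict Implicit.
Unset Printing Implicit Defensive.

Import Order.TTheory GRing.Theory Num.Theory.
Import numFieldNormedType.Exports.

Record sgraph := SGraph {
  vertex :> finType;
  adj : rel vertex;
  adj_sym : symmetric adj;
  adj_irrefl : irreflexive adj }.

Definition edge_set (G : sgraph) : {set {set G}} :=
  [set e | [exists x : G, exists y : G, adj x y && (e == [set x; y])]].

Definition edge (G : sgraph) := {e : {set G} | e \in edge_set G}.

Definition degree (G : sgraph) (x : G) : nat := #|[set y | adj x y]|.

Definition max_degree (G : sgraph) : nat := \max_(x : G) degree x.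

(* Meaningful for k >= 3 only: [ucycle] also accepts the degenerate lists of
   length 0 and 2. *)
Definition has_cycle (G : sgraph) (k : nat) : Prop :=
  exists2 s : seq G, size s = k & ucycle (@adj G) s.

Definition triangle (G : sgraph) (T : {set G}) : Prop :=
  #|T| = 3 /\ {in T &, forall x y, x != y -> adj x y}.

Definition has_adjacent_triangles (G : sgraph) : Prop :=
  exists T1 T2 : {set G},
    [/\ triangle T1, triangle T2, T1 <> T2
      & exists2 e, e \in edge_set G & e \subset T1 :&: T2].

Section LineGraph.
Variable G : sgraph.

Definition line_adj : rel (edge G) :=
  fun e1 e2 => (e1 != e2) && (val e1 :&: val e2 != finset.set0).

Fact line_adj_sym : symmetric line_adj.
Proof. by move=> e1 e2; rewrite /line_adj eq_sym finset.setIC. Qed.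

Fact line_adj_irrefl : irreflexive line_adj.
Proof. by move=> e; rewrite /line_adj eqxx. Qed.

Definition line_graph : sgraph := SGraph line_adj_sym line_adj_irrefl.

End LineGraph.

(* A drawing of G in the plane R^2: distinct vertices are sent to distinct
   points, and the edge e to the simple arc [arc e] (a continuous injective
   image of [0, 1]) joining the two endpoints of e; an arc meets the vertices
   and the other arcs at most in its endpoints. *)
Record plane_drawing (R : realType) (G : sgraph)
    (pt : G -> R * R) (arc : edge G -> R -> R * R) : Prop := PlaneDrawing {
  pt_inj : injective pt;
  arc_continuous :
    forall e, {within [set` `[0, 1]%R], continuous (arc e)}%classic;
  arc_inj : forall e, {in `[0, 1]%R &, injective (arc e)};
  arc_ends : forall e, exists x y : G,
    [/\ val e = [set x; y], arc e 0%R = pt x & arc e 1%R = pt y];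
  arc_avoid_pt : forall e (t : R) (x : G), t \in `]0, 1[%R -> arc e t <> pt x;
  arc_disjoint : forall e1 e2 (s t : R), e1 <> e2 ->
    s \in `]0, 1[%R -> t \in `]0, 1[%R -> arc e1 s <> arc e2 t }.

Definition planar (R : realType) (G : sgraph) : Prop :=
  exists (pt : G -> R * R) (arc : edge G -> R -> R * R), plane_drawing pt arc.

(* An orientation is given by the tail of each edge. *)
Definition orientation (H : sgraph) (tail : edge H -> H) : Prop :=
  forall e, tail e \in val e.

Definition is_coloring (H : sgraph) (A : zmodType) (tail : edge H -> H)
    (L : H -> {fset A}) (f : edge H -> A) (c : H -> A) : Prop :=
  (forall v, c v \in L v) /\
  (forall (e : edge H) (x y : H), val e = [set x; y] -> tail e = x ->
     (c x - c y)%R <> f e).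

(* The property does not depend on the orientation, so quantifying over all
   of them amounts to fixing one. *)
Definition colorable (H : sgraph) (A : zmodType) (L : H -> {fset A}) : Prop :=
  forall tail : edge H -> H, orientation tail ->
  forall f : edge H -> A, exists c : H -> A, is_coloring tail L f c.

(* A may be infinite: its order is at least k iff it has a k-element subset. *)
Definition group_choosable (H : sgraph) (k : nat) : Prop :=
  forall A : zmodType, (exists S : {fset A}, #|` S| = k) ->
  forall L : H -> {fset A}, (forall v, #|` L v| = k) -> colorable L.

Lemma fset_avoid (A : choiceType) (S : {fset A}) (s : seq A) :
  size s < #|` S| -> exists2 a, a \in S & a \notin s.
Proof.
move=> lt_sS; case: (altP (@allP _ (mem s) (enum_fset S))) => [sS | ].
  by have := uniq_leq_size (fset_uniq S) sS; rewrite leqNgt lt_sS.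
by case/allPn => a aS nas; exists a.
Qed.

Lemma group_choosable_card (H : sgraph) : group_choosable H #|H|.
Proof.
move=> A _ L cardL tail tailP f.
suff [c cL cP] : exists2 c : H -> A, forall v, v \in enum H -> c v \in L v &
    forall e x y, x \in enum H -> y \in enum H -> val e = [set x; y] ->
      tail e = x -> (c x - c y)%R <> f e.
  exists c; split=> [v|e x y]; first by apply: cL; rewrite mem_enum.
  by apply: cP; rewrite mem_enum.
have : size (enum H) <= #|H| by rewrite -cardE.
elim: (enum H) (enum_uniq H) => [|v s IHs] /=; first by exists (fun _ => 0%R).
case/andP=> nvs us lt_s; have [c cL cP] := IHs us (ltnW lt_s).
pose g u := if [pick e : edge H | val e == [set u; v]] is Some e
            then (if tail e == v then f e + c u else c u - f e)%R else 0%R.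
have [|a aL /mapP nas] := @fset_avoid _ (L v) (map g s).
  by rewrite size_map cardL.
have gE (u : H) (e : edge H) : val e = [set u; v] ->
    g u = (if tail e == v then f e + c u else c u - f e)%R.
  move=> eE; rewrite /g; case: pickP => [e' /eqP e'E|/(_ e)]; last first.
    by rewrite eE eqxx.
  by have -> : e' = e by apply: val_inj; rewrite e'E.
have neq x y (e : edge H) : val e = [set x; y] -> x != y.
  move=> eE; apply/eqP => xy; move: (valP e).
  rewrite eE xy inE => /existsP[p /existsP[q /andP[pq /eqP E]]].
  have := cards2 p q; rewrite -E cards2 eqxx /=.
  by case: eqP pq => [-> | //]; rewrite adj_irrefl.
exists (fun x => if x == v then a else c x) => [x|e x y].
  by rewrite inE; case: eqP => [-> // | _ /=]; apply: cL.
rewrite !inE; have [-> _|xv /= xs] := eqVneq x v.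
  have [-> _ /neq/negP[]//|yv /= ys eE tE E] := eqVneq y v.
  apply: nas; exists y => //; rewrite (gE y e); last by rewrite finset.setUC.
  by rewrite tE eqxx -E subrK.
have [-> _ eE tE E|yv /= ys] := eqVneq y v; last exact: cP.
apply: nas; exists x => //; rewrite (gE x e) // tE (negPf xv) -E.
by rewrite opprB addrC subrK.
Qed.

Fact group_choosable_ex (H : sgraph) : exists k, `[< group_choosable H k >].
Proof. by exists #|H|; apply/asboolP; apply: group_choosable_card. Qed.

Definition chi_gl (H : sgraph) : nat := ex_minn (group_choosable_ex H).

Definition chi'_gl (G : sgraph) : nat := chi_gl (line_graph G).

(* Main.v *)
From HB Require Import structures.
From mathcomp Require Import boolp classical_sets set_interval reals topology.
From mathcomp Require Import normedtype finmap.
From mathcomp Require Import all_boot all_order all_algebra lra zify.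
Require Import Defs.

Set Implicit Arguments.
Unset Strict Implicit.
Unset Printing Implicit Defensive.
Import Order.TTheory GRing.Theory Num.Theory.
Import numFieldNormedType.Exports.

(** Why the theorem is true.

    A graph is k-group choosable as soon as every nonempty set S of its
    vertices contains a vertex with fewer than k neighbours in S: remove that
    vertex, colour the rest, and observe that a coloured neighbour forbids one
    value only ([greedy_choosable]). Applied to the line graph, this shows that
    if chi'_gl(G) > k, then some nonempty set of edges spans a subgraph in which
    the degrees of the ends of every edge add up to at least k + 2
    ([heavy_subgraph]). It remains to see that a planar graph with the excluded
    cycles has no such subgraph, and this is done by discharging.

    Planarity is only used through Euler's inequality, and in a combinatorial
    form. A drawing is first discretized ([planar_grid_model]): on a grid so
    fine that disjoint parts of the drawing stay apart, every vertex becomes a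
    connected blob of grid points, and the blobs of adjacent vertices touch.
    Walking around the blobs gives a cyclic order of the darts at each vertex
    ([plane_map_of_grid]), and the Jordan property of the grid carries over:
    every set of edges that is even at each vertex is the boundary of a set of
    faces. Counting the even sets gives V + F >= E + 2 ([euler_card]), that is,
    a total of at most -8 when vertices and faces receive their degrees minus 4
    ([euler_charge]).

    Discharging is local only if faces are bounded by cycles and triangles are
    faces. Rather than passing to blocks and cutting along separating triangles,
    a minimal fragment is taken: a vertex set U with a clique Q of at most three
    roots, such that the vertices of U outside Q keep all their neighbours. By
    minimality, neither a vertex nor a triangle separates U, except for the
    triangles around hubs, the 3-vertices with pairwise adjacent neighbours
    ([frag_map_exists]). The degrees of the roots are not under control, but it
    is enough that each root ends with more than -8 / |Q| and that every other
    vertex and every face end with a nonnegative charge ([discharge]).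

    In (1) and (2) no face is a triangle, and a 3-vertex takes 1/3 from each
    neighbour ([triangle_free_light]). In (3) triangles take 1/2 from their ends
    of degree at least 5, and two consecutive corners at a vertex are never
    triangles ([no_diamond_light]). In (5) the ends of degree at least
    6 give 1/2 to each triangle, and triangles whose ends have degree 5 are
    helped by those ends and by the faces of length at least 8 across their
    sides; without 7-cycles a 5-vertex can afford this ([five_pays]). In (4)
    both 3-vertices and triangles are poor, and long faces give 3/7 at each
    corner; the absence of 6-cycles restricts the cyclic words of face lengths
    around a vertex ([wheel]), and an analysis of runs of triangles in these
    words shows that each vertex can pay ([big_wheel], [wheel_six],
    [wheel_five]). *)

(** * Flows modulo 2 *)
Section BoolFlow.

Variables (D P : finType) (src : D -> P) (e : D -> D).
Hypothesis eK : involutive e.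

Definition bnd (C : D -> bool) (p : P) : bool :=
  \big[addb/false]_(d | src d == p) C d.

Definition circulation (C : D -> bool) : Prop :=
  (forall d, C (e d) = C d) /\ forall p, bnd C p = false.

Definition link (A : pred D) : rel P :=
  [rel p q | [exists d, [&& A d, src d == p & src (e d) == q]]].

Lemma bnd_add C1 C2 p :
  bnd (fun d => C1 d (+) C2 d) p = bnd C1 p (+) bnd C2 p.
Proof. exact: big_split. Qed.

Lemma bnd1 d0 p : bnd (pred1 d0) p = (src d0 == p).
Proof.
rewrite /bnd; case: eqP => [srcp|Nsrcp]; last first.
  by apply: big1 => d /eqP srcd /=; apply/eqP => E; apply: Nsrcp; rewrite -E.
rewrite (bigD1 d0) /=; last by apply/eqP.
by rewrite eqxx big1 // => d /andP[_ /negPf].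
Qed.

(** The flow of a path: its boundary is the two ends. *)
Lemma path_flow (A : pred D) p q :
    (forall d, A d -> e d != d) -> (forall d, A (e d) = A d) ->
    connect (link A) p q ->
  exists C : D -> bool, [/\ forall d, C (e d) = C d, forall d, C d -> A d
    & forall x, bnd C x = (p == x) (+) (q == x)].
Proof.
move=> Ae eA /connectP[s]; elim: s p => [|p' s IHs] p /=.
  move=> _ ->; exists (fun=> false); split=> // x.
  by rewrite addbb /bnd big1.
case/andP=> /existsP[d0 /and3P[Ad0 /eqP srcd0 /eqP srced0]] /IHs/[apply].
case=> C [Csym CA Cbnd].
exists (fun d => C d (+) ((pred1 d0 d) (+) (pred1 (e d0) d))); split=> [d|d|x].
- rewrite Csym /= (can2_eq eK eK) (inj_eq (inv_inj eK)).
  by congr (_ (+) _); rewrite addbC.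
- case CdE: (C d) => /=; first by move: (CA _ CdE).
  have [->//|_] := eqVneq d d0.
  by have [->|//] := eqVneq d (e d0); rewrite eA.
rewrite !bnd_add Cbnd !bnd1 srcd0 srced0.
by case: (_ == x); case: (_ == x); case: (_ == x).
Qed.

(** The points are grouped by [b] into blobs, each connected inside [A]. A set
    of points that is even in each blob is a boundary: send every odd point to
    the representative of its blob along a path; the representatives receive an
    even number of paths. *)
Lemma tjoin (V : eqType) (b : P -> option V) (A : pred D) (odd : P -> bool) :
    (forall d, A d -> e d != d) -> (forall d, A (e d) = A d) ->
    (forall p q, b p = b q -> b p != None -> connect (link A) p q) ->
    (forall p, odd p -> b p != None) ->
    (forall u, \big[addb/false]_(p | b p == Some u) odd p = false) ->
  exists C : D -> bool, [/\ forall d, C (e d) = C d, forall d, C d -> A d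
    & forall x, bnd C x = odd x].
Proof.
move=> Ae eA bA oddb odd0.
pose rho p := odflt p [pick q | b q == b p].
have brho p : b (rho p) = b p.
  by rewrite /rho; case: pickP => [q /eqP|].
have rhoE p q : b p = b q -> rho p = rho q.
  move=> E; rewrite /rho E; case: pickP => // /(_ q).
  by rewrite eqxx.
pose good p (C : D -> bool) := odd p -> [/\ forall d, C (e d) = C d,
  forall d, C d -> A d & forall x, bnd C x = (p == x) (+) (rho p == x)].
have /fin_all_exists[F Fgood] : forall p, exists C, good p C.
  move=> p; case oddp: (odd p); last by exists (fun=> false); rewrite /good oddp.
  have [|C ?] := @path_flow A p (rho p) Ae eA; last by exists C.
  by apply: bA; rewrite ?brho ?oddb.
exists (fun d => \big[addb/false]_(p | odd p) F p d); split=> [d|d|x].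
- by apply: eq_bigr => p /Fgood[-> _ _].
- apply: contraTT => nAd; rewrite big1 // => p /Fgood[_ FA _].
  by apply/negP => /FA; apply/negP.
rewrite /bnd exchange_big /=.
rewrite (eq_bigr (fun p => (p == x) (+) (rho p == x))); last first.
  by move=> p /Fgood[_ _ <-].
rewrite big_split /= -[RHS]addbF; congr (_ (+) _).
  case oddx: (odd x); last first.
    by apply: big1 => p oddp; apply/eqP => E; rewrite E oddx in oddp.
  by rewrite (bigD1 x) //= eqxx big1 // => p /andP[_ /negPf].
case bxE: (b x) => [u|]; last first.
  apply: big1 => p oddp; apply/eqP => E; move: (oddb p oddp).
  by rewrite -brho E bxE.
have [rx|nrx] := eqVneq (rho x) x; last first.
  apply: big1 => p oddp; apply/eqP => E.
  case/eqP: nrx; rewrite -[RHS]E; apply: rhoE.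
  by rewrite -E brho.
rewrite -[RHS](odd0 u) big_mkcond [RHS]big_mkcond /=; apply: eq_bigr => p _.
case: (boolP (odd p)) => oddp; last by case: ifP.
have [bp|nbp] := eqVneq (b p) (Some u).
  by rewrite (rhoE p x) ?rx ?eqxx // bp bxE.
by apply/eqP => E; case/eqP: nbp; rewrite -brho E bxE.
Qed.

End BoolFlow.

(** * The Jordan property of the grid *)
Section Torus.
Variable m : nat.
Notation I := 'I_m.+1.
Definition gpt := (I * I)%type.
(** A direction: the first boolean tells horizontal from vertical, the second
    forward from backward. Working on a torus avoids boundary cases; the
    wrap-around edges form the seam, and the grid minus the seam is planar. *)
Definition gdart := (gpt * (bool * bool))%type.
Implicit Types (d : gdart) (p : gpt).

Definition gstep (b : bool) : I -> I := if b then @ordS m.+1 else @ord_pred m.+1.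
Definition gmove p (k : bool * bool) : gpt :=
  if k.1 then (gstep k.2 p.1, p.2) else (p.1, gstep k.2 p.2).
Definition gsrc d : gpt := d.1.
Definition grev d : gdart := (gmove d.1 d.2, (d.2.1, ~~ d.2.2)).
Definition gnext d : gdart := (d.1, (~~ d.2.1, if d.2.1 then d.2.2 else ~~ d.2.2)).
Definition seam d : bool :=
  let c := if d.2.1 then d.1.1 else d.1.2 in
  if d.2.2 then c == ord_max else c == ord0.

Lemma gstepK b : cancel (gstep b) (gstep (~~ b)).
Proof. by case: b; [exact: ordSK | exact: ord_predK]. Qed.

Lemma grevK : involutive grev.
Proof.
case=> [[i j] [[] b]]; rewrite /grev /gmove /= negbK.
  by rewrite gstepK.
by rewrite gstepK.
Qed.

Lemma gnext_inj : injective gnext.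
Proof. by case=> [p [[] []]] [q [[] []]] [] ->. Qed.

Lemma seam_rev d : seam (grev d) = seam d.
Proof.
have E : ord_pred ord0 = ord_max :> I by apply: val_inj; rewrite /= modn_small.
have S0 (i : I) : (ordS i == ord0) = (i == ord_max).
  by rewrite (can2_eq (@ordSK _) (@ord_predK _)) E.
have P0 (i : I) : (ord_pred i == ord_max) = (i == ord0).
  by rewrite (can2_eq (@ord_predK _) (@ordSK _)) -E ord_predK.
by case: d => [[i j] [[] []]]; rewrite /seam /grev /gmove /gstep /= ?S0 ?P0.
Qed.

(** An even edge set [C] avoiding the seam 2-colours the cells: the colour of a
    cell is the parity of the vertical edges of [C] in its row to the east of
    it. Evenness at the points makes this colour change across the horizontal
    edges of [C] as well, by induction from the last column. *)
Lemma torus_jordan (C : gdart -> bool) :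
    circulation gsrc grev C -> (forall d, C d -> ~~ seam d) ->
  exists lam : gdart -> bool, forall d,
    lam (gnext (grev d)) = lam d /\ lam (grev d) = lam d (+) C d.
Proof.
move=> [Csym Ceven] Cseam.
pose v (i j : I) := C ((i, j), (false, true)).
pose h (i j : I) := C ((i, j), (true, true)).
have Ch0 j : h ord_max j = false.
  by apply/negbTE/negP => /Cseam; rewrite /seam eqxx.
have Cv0 i : v i ord_max = false.
  by apply/negbTE/negP => /Cseam; rewrite /seam eqxx.
have even i j : h i j (+) h (ord_pred i) j (+) v i j (+) v i (ord_pred j) = false.
  rewrite -[RHS](Ceven (i, j)) /bnd.
  rewrite (reindex_onto (fun k => ((i, j), k)) snd); last first.
    by case=> p k /eqP /= <-.
  rewrite (eq_bigl predT); last by move=> k; rewrite /gsrc /= !eqxx.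
  transitivity (\big[addb/false]_(k1 : bool) \big[addb/false]_(k2 : bool)
     C ((i, j), (k1, k2))); last by rewrite pair_bigA; apply: eq_bigr => -[].
  rewrite !big_bool /=.
  rewrite -[C (_, (true, false))]Csym -[C (_, (false, false))]Csym.
  rewrite /grev /gmove /= -/(h i j) -/(v i j).
  by rewrite -/(h (ord_pred i) j) -/(v i (ord_pred j)) -!addbA.
(* The parity of the vertical edges of row [j] to the east of column [i]. *)
pose L (i j : I) := \big[addb/false]_(k : I | i < k) v k j.
have Lmax j : L ord_max j = false.
  by apply: big_pred0 => k; rewrite /= ltnNge -ltnS ltn_ord.
have LS (i j : I) : (i < m)%N -> L i j = v (ordS i) j (+) L (ordS i) j.
  move=> lt_im; have Si : ordS i = i.+1 :> nat by rewrite /= modn_small.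
  rewrite {1}/L (bigD1 (ordS i)) ?Si //=; congr (_ (+) _).
  by apply: eq_bigl => k; rewrite Si -val_eqE [val (ordS i)]Si [RHS]ltn_neqAle eq_sym andbC.
have Lh i j : L i j (+) L i (ord_pred j) = h i j.
  have [k] := ubnP (m - i); elim: k i => // k IHk i.
  have [->|nmax] := eqVneq i ord_max; first by rewrite !Lmax Ch0.
  have lt_im : (i < m)%N.
    by rewrite ltn_neqAle -ltnS ltn_ord andbT; move: nmax; rewrite -val_eqE.
  have Si : ordS i = i.+1 :> nat by rewrite /= modn_small.
  rewrite ltnS => le_k; rewrite (LS i j) // (LS i (ord_pred j)) //.
  have E1 := even (ordS i) j; rewrite ordSK in E1.
  have E2 : L (ordS i) j (+) L (ordS i) (ord_pred j) = h (ordS i) j.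
    by apply: IHk; rewrite Si subnS prednK ?subn_gt0.
  rewrite -E2 in E1; clear -E1; clearbody L h v.
  by move: E1; case: (L (ordS i) j); case: (L (ordS i) (ord_pred j));
     case: (h i j); case: (v (ordS i) j); case: (v (ordS i) (ord_pred j)).
(* A full turn along a row crosses an even number of edges of [C]: this number
   has the same parity in all rows, and the last row lies on the seam. *)
have W0 j : L ord0 j = v ord0 j.
  have Pmax : ord_pred ord0 = ord_max :> I.
    by apply: val_inj; rewrite /= modn_small.
  have WP (k : I) : L ord0 k (+) v ord0 k = L ord0 (ord_pred k) (+) v ord0 (ord_pred k).
    have := even ord0 k; rewrite Pmax Ch0 -(Lh ord0 k).
    clearbody L h v.
    by case: (v ord0 k); case: (v ord0 (ord_pred k)); case: (L ord0 k);
       case: (L ord0 (ord_pred k)).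
  suff W : L ord0 j (+) v ord0 j = false by clearbody L v; move: W; case: (L ord0 j); case: (v ord0 j).
  have [k] := ubnP (m - j); elim: k j => // k IHk j.
  have [->|nmax] := eqVneq j ord_max.
    by rewrite Cv0 /L big1 // => i _; rewrite Cv0.
  have lt_jm : (j < m)%N.
    by rewrite ltn_neqAle -ltnS ltn_ord andbT; move: nmax; rewrite -val_eqE.
  have Sj : ordS j = j.+1 :> nat by rewrite /= modn_small.
  move=> le_k; rewrite -(ordSK j) -WP IHk // Sj subnS.
  by rewrite prednK ?subn_gt0.
have Lv i j : L i j (+) L (ord_pred i) j = v i j.
  have [->|nz] := eqVneq i ord0.
    by rewrite (_ : ord_pred ord0 = ord_max) ?Lmax ?W0 ?addbF //;
       apply: val_inj; rewrite /= modn_small.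
  rewrite (LS (ord_pred i)) ?ord_predK ?[v i j (+) _]addbC ?addbA ?addbb //.
  rewrite ltn_neqAle -ltnS ltn_ord andbT; apply: contra nz => /eqP E.
  rewrite -(ord_predK i) (_ : ord_pred i = ord_max); last exact: val_inj.
  by rewrite -val_eqE /= modnn.
(* The cell to the right of a dart. *)
pose cell d : gpt :=
  (if d.2.2 then d.1.1 else ord_pred d.1.1,
   if d.2.1 == d.2.2 then ord_pred d.1.2 else d.1.2).
exists (fun d => L (cell d).1 (cell d).2) => -[[i j] [a b]].
rewrite -[C _](_ : (if a then h (if b then i else ord_pred i) j
   else v i (if b then j else ord_pred j)) = _); last first.
  by case: a; case: b => //; rewrite -Csym /grev /gmove /=.
by case: a; case: b; rewrite /grev /gnext /gmove /cell /= ?ordSK; split=> //;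
   rewrite -?Lh -?Lv ?addbA ?addbb // addbC addbA addbb.
Qed.
End Torus.

(** * From grid models to plane maps *)
Section FirstReturn.
Variables (D : finType) (m : D -> D) (S : pred D).
Hypothesis m_inj : injective m.

(** First return of the orbit of [d] to [S]. *)
Definition ret (d : D) : D :=
  odflt d (omap (fun k : 'I_(order m d) => iter k.+1 m d)
    [pick k : 'I_(order m d) | S (iter k.+1 m d) &
       [forall j : 'I_(order m d), (j < k) ==> ~~ S (iter j.+1 m d)]]).

Lemma retP d : S d -> exists k,
  [/\ ret d = iter k.+1 m d, S (ret d) & forall j, j < k -> ~~ S (iter j.+1 m d)].
Proof.
move=> Sd; rewrite /ret; case: pickP => [k /andP[Sk /forallP minK] | no] /=.
  exists k; split=> // j lt_jk.
  by have /implyP := minK (Ordinal (ltn_trans lt_jk (ltn_ord k))); apply.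
have exk : exists k, S (iter k.+1 m d).
  by exists (order m d).-1; rewrite orderSpred iter_order.
case: (ex_minnP exk) => k Sk kmin.
have lt_k : k < order m d.
  by rewrite -orderSpred ltnS; apply: kmin; rewrite orderSpred iter_order.
have /negP[] := no (Ordinal lt_k); rewrite /= Sk; apply/forallP => j.
by apply/implyP => lt_jk; apply: contraL lt_jk => /kmin; rewrite -leqNgt.
Qed.

Lemma ret_inj : {in S &, injective ret}.
Proof.
have main d1 d2 k1 k2 : S d1 -> S d2 -> k1 <= k2 ->
    iter k1.+1 m d1 = iter k2.+1 m d2 ->
    (forall j, j < k2 -> ~~ S (iter j.+1 m d2)) -> d1 = d2.
  move=> S1 S2 le12 E min2.
  have {}E : d1 = iter (k2 - k1) m d2.
    have inj k : injective (iter k m) by elim: k => // k IHk x y /m_inj/IHk.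
    apply: (inj k1.+1).
    by rewrite E -iterD addSn subnKC.
  case Ek: (k2 - k1) E => [|j] // E.
  have /negP[] : ~~ S (iter j.+1 m d2); last by rewrite -E.
  by apply: min2; rewrite -Ek leq_subr.
move=> d1 d2 S1 S2 E.
have [k1 [r1 _ min1]] := retP S1; have [k2 [r2 _ min2]] := retP S2.
rewrite r1 r2 in E; have [le12|/ltnW le21] := leqP k1 k2.
  exact: main E min2.
by symmetry; apply: main le21 _ min1.
Qed.

End FirstReturn.

Definition swapd (V : Type) (d : V * V) : V * V := (d.2, d.1).

Lemma swapdK V : involutive (@swapd V). Proof. by case. Qed.

Section PlaneMap.
Variables (V : finType) (a : rel V).

Definition dart : pred (V * V) := fun d => a d.1 d.2.

(** A rotation system [n] on the darts of [a] for which the Jordan curve theorem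
    holds: a set of edges that is even at each vertex is the boundary of a set
    [lam] of faces. The two equations on [lam] say that it changes when a dart
    of [C] is passed in the rotation or crossed, hence that it is constant along
    [n \o swapd], the traversal of a face. *)
Record plane_map (n : V * V -> V * V) : Prop := PlaneMap {
  map_inj : injective n;
  map_out : forall d, ~~ dart d -> n d = d;
  map_dart : forall d, dart (n d) = dart d;
  map_src : forall d, (n d).1 = d.1;
  map_jordan : forall C : V * V -> bool,
    (forall d, C d -> dart d) -> circulation fst (@swapd V) C ->
    exists lam : V * V -> bool, forall d, dart d ->
      lam (n d) = lam d (+) C d /\ lam (swapd d) = lam d (+) C d }.

Definition inner m (b : gpt m -> option V) : pred (gdart m) := fun d =>
  [&& ~~ seam d, b (gsrc d) != None & b (gsrc (grev d)) == b (gsrc d)].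

(** Blobs of grid points, one for each vertex, each connected without crossing
    the seam, such that blobs of adjacent vertices touch. Touching blobs of
    nonadjacent vertices are harmless. *)
Definition grid_model : Prop :=
  exists (m : nat) (b : gpt m -> option V),
    (forall p q, b p = b q -> b p != None ->
      connect (link (@gsrc m) (@grev m) (inner b)) p q) /\
    (forall u v, a u v -> exists d : gdart m,
        [/\ ~~ seam d, b (gsrc d) = Some u & b (gsrc (grev d)) = Some v]).

Hypotheses (a_sym : symmetric a) (a_irr : irreflexive a).

(** Each edge is represented by one grid dart between the two blobs. Following
    the contour of a blob, that is, turning around a point and stepping over
    inner edges, and stopping at the next representative gives the rotation. An
    even set [C] of edges becomes a set of grid darts that is even in each blob,
    and a join inside the blobs makes it even at each grid point, so the Jordan
    property of the grid applies. *)
Lemma plane_map_of_grid : grid_model -> exists n, plane_map n.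
Proof.
case=> m [b [bconn badj]].
have [D0|[d0 _]] : (forall d, ~~ dart d) \/ exists d, dart d.
  case: (pickP dart) => [d dd|no]; first by right; exists d.
  by left => d; rewrite no.
  exists id; split=> // C CD _; exists (fun=> false) => d dd.
  by have := D0 d; rewrite dd.
pose okr u v (d : gdart m) := [&& ~~ seam d, b (gsrc d) == Some u
  & b (gsrc (grev d)) == Some v].
have [r0 r0P] : exists r0 : V * V -> gdart m, forall w, dart w -> okr w.1 w.2 (r0 w).
  apply: (@fin_all_exists _ _ (fun w d => dart w -> okr w.1 w.2 d)) => -[u v].
  case: (boolP (a u v)) => [/badj[d [d1 d2 d3]]|nauv].
    by exists d => _; rewrite /okr d1 d2 d3 !eqxx.
  exists ((ord0, ord0), (true, true)); rewrite /dart /=.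
  by rewrite (negPf nauv).
(* Opposite darts get opposite representatives. *)
pose low (w : V * V) := enum_rank w.1 < enum_rank w.2.
pose r w := if low w then r0 w else grev (r0 (swapd w)).
have dswap w : dart (swapd w) = dart w by rewrite /dart a_sym.
have rswap w : dart w -> r (swapd w) = grev (r w).
  case: w => u v; rewrite /dart /= /r /low /swapd /= => auv.
  case: ltngtP => [| |E]; rewrite ?grevK //.
  by move: auv; rewrite (enum_rank_inj (val_inj E)) a_irr.
have rP w : dart w -> okr w.1 w.2 (r w).
  move=> dw; rewrite /r; case: ifP => _; first exact: r0P.
  have := r0P (swapd w); rewrite dswap => /(_ dw) /and3P[h1 h2 h3].
  by rewrite /okr seam_rev h1 /gsrc grevK h2 h3.
have r1 w : dart w -> b (gsrc (r w)) = Some w.1 by case/rP/and3P=> _ /eqP.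
have r2 w : dart w -> b (gsrc (grev (r w))) = Some w.2 by case/rP/and3P=> _ _ /eqP.
have rinj : {in dart &, injective r}.
  move=> w1 w2 dw1 dw2 E; have := r1 _ dw1; have := r2 _ dw1.
  by rewrite E r1 // r2 //; case: w1 w2 {dw1 dw2 E} => [? ?] [? ?] [] /= -> [] ->.
pose S : pred (gdart m) := fun d => [exists w, dart w && (r w == d)].
have Sr w : dart w -> S (r w) by move=> dw; apply/existsP; exists w; rewrite dw /=.
pose tau (d : gdart m) := if b (gsrc (grev d)) == b (gsrc d) then grev d else d.
have tauK : involutive tau.
  move=> d; rewrite {2}/tau; case: ifP => E; rewrite /tau ?grevK; last by rewrite E.
  by rewrite eq_sym E.
(* One step along the contour of a blob. *)
pose mu d := gnext (tau d).
have mu_inj : injective mu by apply: inj_comp (@gnext_inj m) (inv_inj tauK).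
have bmu d : b (gsrc (mu d)) = b (gsrc d).
  by rewrite /mu /= /gsrc /= /tau; case: eqP.
pose nx w := if dart w then odflt w [pick w' | dart w' && (r w' == ret mu S (r w))] else w.
have nxP w : dart w -> dart (nx w) /\ r (nx w) = ret mu S (r w).
  move=> dw; rewrite /nx dw; case: pickP => [w' /andP[? /eqP]|] //= no.
  have [_ [_ /existsP[w' Ew'] _]] := retP mu_inj (Sr _ dw).
  by rewrite no in Ew'.
have nx_src w : (nx w).1 = w.1.
  case dw: (dart w); last by rewrite /nx dw.
  have [dn rn] := nxP w dw; apply/Some_inj; rewrite -(r1 _ dn) -(r1 _ dw) rn.
  have [k [-> _ _]] := retP mu_inj (Sr _ dw).
  by elim: k.+1 => //= j <-; rewrite bmu.
have nx_dart w : dart (nx w) = dart w.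
  by case dw: (dart w); [have [] := nxP w dw | rewrite /nx dw].
exists nx; split=> //.
- move=> w1 w2 E; have := congr1 dart E; rewrite !nx_dart.
  case dw1: (dart w1) => dw2; last by move: E; rewrite /nx dw1 -dw2.
  have [_ rn1] := nxP _ dw1; have [_ rn2] := nxP _ (esym dw2).
  apply: rinj => //.
  apply: (@ret_inj _ mu S mu_inj); rewrite ?unfold_in //; try exact: Sr.
  by rewrite -rn1 -rn2 E.
- by move=> d /negPf dd; rewrite /nx dd.
move=> C CD [Csym Ceven].
(* [C] on the representatives; [C2] below completes it inside the blobs. *)
pose C1 (d : gdart m) := \big[addb/false]_(w | dart w) (C w && (r w == d)).
have C1r w : dart w -> C1 (r w) = C w.
  move=> dw; rewrite /C1 (bigD1 w) //= eqxx andbT big1 ?addbF //.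
  move=> w' /andP[dw' ne]; apply/negbTE; rewrite negb_and; apply/orP; right.
  by apply: contra ne => /eqP/(rinj _ _ dw' dw) ->.
have C1out d : ~~ S d -> C1 d = false.
  move=> /existsP nS; apply: big1 => w dw; apply/negbTE/negP => /andP[_ E].
  by apply: nS; exists w; rewrite dw.
have Srev d : S d -> S (grev d).
  case/existsP=> w /andP[dw /eqP <-]; rewrite -rswap //.
  by apply: Sr; rewrite dswap.
have C1rev d : C1 (grev d) = C1 d.
  case: (boolP (S d)) => [/existsP[w /andP[dw /eqP <-]]|nS].
    by rewrite -rswap // !C1r ?dswap // Csym.
  rewrite !C1out //; apply: contra nS => /Srev; by rewrite grevK.
have S_nontau d : S d -> b (gsrc (grev d)) != b (gsrc d).
  case/existsP=> w /andP[dw /eqP <-]; rewrite r1 // r2 //.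
  apply/eqP => -[E]; move: dw; rewrite /dart E a_irr //.
have [C2 [C2sym C2A C2b]] : exists C2 : gdart m -> bool,
    [/\ forall d, C2 (grev d) = C2 d, forall d, C2 d -> inner b d
      & forall x, bnd (@gsrc m) C2 x = bnd (@gsrc m) C1 x].
  apply: (tjoin (b := b) (@grevK m)).
  - move=> d _; apply/eqP => /(congr1 (fun d => d.2.2)) /=.
    by case: d.2.2.
  - move=> d; rewrite /inner seam_rev grevK; case: (seam d) => //=.
    rewrite [b (gsrc d) == _]eq_sym.
    by case: (b (gmove d.1 d.2) =P b (gsrc d)) => [->|]; rewrite ?andbF.
  - exact: bconn.
  - move=> p; apply: contraTT => /negPn/eqP bp; rewrite /bnd big1 // => d /eqP srcd.
    apply: C1out; apply/negP => /existsP[w /andP[dw /eqP E]].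
    by have := r1 _ dw; rewrite E srcd bp.
  - move=> u; rewrite -[RHS](Ceven u) /bnd.
    rewrite (exchange_big_dep (fun d => b (gsrc d) == Some u)) /=; last first.
      by move=> p d bp /eqP ->.
    transitivity (\big[addb/false]_(d | b (gsrc d) == Some u) C1 d).
      by apply: eq_bigr => d bd; rewrite (big_pred1 (gsrc d)) // => p /=;
        rewrite [RHS]eq_sym; case: (gsrc d =P p) => [<-|]; rewrite ?bd ?andbF.
    rewrite /C1 (exchange_big_dep dart) //= [RHS]big_mkcond [LHS]big_mkcond /=.
    apply: eq_bigr => w _; case: ifP => dw; last first.
      by case: ifP => // _; case Cw: (C w) => //; rewrite CD in dw.
    rewrite big_mkcond (bigD1 (r w)) //= r1 // eqxx big1 ?addbF.
      by rewrite ?andbT ?(inj_eq Some_inj) dw ?andbT.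
    by move=> d /negPf; rewrite eq_sym => ->; rewrite andbF; case: ifP.
have C2S d : S d -> C2 d = false.
  move=> Sd; apply/negbTE/negP => /C2A/and3P[_ _]; apply/negP; exact: S_nontau.
have [|d|lam lamP] := @torus_jordan m (fun d => C1 d (+) C2 d).
- split=> [d|p]; first by rewrite C1rev C2sym.
  by rewrite bnd_add C2b addbb.
- case C1d: (C1 d) => /=; last by case/C2A/and3P.
  have : S d by apply: contraTT C1d => /C1out ->.
  by case/existsP=> w /andP[dw /eqP <-] _; case/and3P: (rP _ dw).
exists (fun w => lam (r w)) => w dw; have [dn rn] := nxP w dw; split; last first.
  rewrite rswap //; have [_ ->] := lamP (r w).
  by rewrite C1r // C2S ?addbF // Sr.
have lamn d : lam (gnext d) = lam d (+) (C1 d (+) C2 d).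
  by have [E _] := lamP (grev d); rewrite grevK in E; rewrite E; case: (lamP d).
have lammu d : ~~ S d -> lam (mu d) = lam d.
  move=> nSd; rewrite /mu /tau; case: ifP => [_|E]; first by case: (lamP d).
  rewrite lamn C1out // (_ : C2 d = false) ?addbF //.
  by apply/negbTE/negP => /C2A/and3P[_ _]; rewrite E.
rewrite rn; have [k [-> _ kmin]] := retP mu_inj (Sr _ dw).
have -> : lam (iter k.+1 mu (r w)) = lam (mu (r w)).
  elim: k kmin => // k IHk kmin; rewrite iterS lammu ?kmin // IHk // => j lt_jk.
  by rewrite kmin // ltnW.
rewrite /mu /tau (negPf (S_nontau _ (Sr _ dw))) lamn C1r // C2S ?addbF //.
exact: Sr.
Qed.

End PlaneMap.

Lemma grid_model_sub (V : finType) (a a' : rel V) :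
  subrel a' a -> grid_model a -> grid_model a'.
Proof.
move=> sub [m [b [h1 h2]]]; exists m, b; split=> // u v /sub; exact: h2.
Qed.

(** * Blobs from walks *)
Section Walks.

Variables (V E : finType) (tl hd : E -> V) (a : rel V).
Hypothesis tl_hd : forall e, tl e != hd e.
Hypothesis a_edge : forall u v, a u v -> exists e,
  tl e = u /\ hd e = v \/ tl e = v /\ hd e = u.
Hypothesis a_sym : symmetric a.

Variables (m T n1 n2 : nat) (w : E -> nat -> gpt m).
Hypotheses (n1_gt0 : 0 < n1) (le_n12 : n1 <= n2) (le_n2T : n2 <= T).

Definition neigh (p q : gpt m) : Prop :=
  exists d : gdart m, [/\ ~~ seam d, gsrc d = p & gsrc (grev d) = q].

(** The walk of an edge starts near its tail, runs in the middle and ends near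
    its head; these parts are attributed to the tail, to the edge itself and to
    the head. *)
Definition lab e j : V + E :=
  if j < n1 then inl (tl e) else if j < n2 then inr e else inl (hd e).

(** Parts of a drawing that are disjoint: different vertices, an edge and a
    vertex that is not one of its ends, different edges. *)
Definition conflict (x y : V + E) : bool :=
  match x, y with
  | inl u, inl v => u != v
  | inl u, inr e => (u != tl e) && (u != hd e)
  | inr e, inl u => (u != tl e) && (u != hd e)
  | inr e, inr e' => e != e'
  end.

Hypothesis w_step : forall e j, j < T ->
  w e j = w e j.+1 \/ neigh (w e j) (w e j.+1).
Hypothesis w_lab : forall e e' j j', j <= T -> j' <= T ->
  w e j = w e' j' -> ~~ conflict (lab e j) (lab e' j').
Variable base : V -> gpt m.
Hypotheses (w0 : forall e, w e 0 = base (tl e)) (wT : forall e, w e T = base (hd e)).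

(* The blob [B u] consists of the points [H u] attributed to [u] and, for the
   edges with tail [u], of the points of their walks before the first visit to
   the part of the head: this makes blobs of adjacent vertices touch. *)
Let H u p := exists e j, [/\ j <= T, lab e j = inl u & w e j = p].
Let B u p := H u p \/ exists e j, [/\ j <= T, tl e = u, w e j = p
  & forall j', j' <= j -> ~ H (hd e) (w e j')].

Let H_inj u v p : H u p -> H v p -> u = v.
Proof.
case=> e [j [lej lu wp]] [e' [j' [lej' lv wp']]].
have := w_lab lej lej' (etrans wp (esym wp')).
by rewrite lu lv /= negbK => /eqP.
Qed.

Let lab_prefix e j : j <= T -> (forall j', j' <= j -> ~ H (hd e) (w e j')) ->
  lab e j = inl (tl e) \/ lab e j = inr e.
Proof.
move=> lej nH; rewrite /lab; case: ltnP => h1; first by left.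
case: ltnP => h2; first by right.
case: (nH j (leqnn _)); exists e, j; split=> //.
by rewrite /lab !ltnNge h1 h2.
Qed.

Let B_inj u v p : B u p -> B v p -> u = v.
Proof.
have HP u' v' p' : H u' p' -> B v' p' -> u' = v'.
  move=> Hu [/(H_inj Hu)//|[e [j [lej tle wp nH]]]].
  have [lp|lp] := lab_prefix lej nH.
    by apply: H_inj Hu _; exists e, j; rewrite -tle.
  case: Hu => e' [j' [lej' lu wp']].
  have := w_lab lej' lej (etrans wp' (esym wp)); rewrite lu lp /= negb_and !negbK.
  case/orP=> [/eqP->//|/eqP E']; case: (nH j (leqnn _)).
  by exists e', j'; rewrite lu E' wp wp'.
case=> [Hu /(HP _ _ _ Hu)//|[e [j [lej tle wp nH]]]].
case=> [Hv|[e' [j' [lej' tle' wp' nH']]]].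
  by symmetry; apply: HP Hv _; right; exists e, j.
have [lp|lp] := lab_prefix lej nH.
  apply: (HP _ _ p); first by exists e, j; rewrite lp tle.
  by right; exists e', j'.
have [lp'|lp'] := lab_prefix lej' nH'.
  symmetry; apply: (HP _ _ p); first by exists e', j'; rewrite lp' tle'.
  by right; exists e, j.
have := w_lab lej lej' (etrans wp (esym wp')); rewrite lp lp' /= negbK => /eqP E'.
by rewrite -tle -tle' E'.
Qed.

Let beta p := [pick u | `[< B u p >]].

Let betaP u p : B u p -> beta p = Some u.
Proof.
move=> Bu; rewrite /beta; case: pickP => [v /asboolP Bv|/(_ u)/asboolP//].
by congr Some; apply: B_inj Bv Bu.
Qed.

Let betaB u p : beta p = Some u -> B u p.
Proof. by rewrite /beta; case: pickP => // v /asboolP Bv [<-]. Qed.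

Let lk := link (@gsrc m) (@grev m) (inner beta).

Let lk_sym : connect_sym lk.
Proof.
apply: sym_connect_sym => p q; suff h p' q' : lk p' q' -> lk q' p'.
  by apply/idP/idP; apply: h.
case/existsP=> d /and3P[Ad /eqP <- /eqP <-]; apply/existsP; exists (grev d).
rewrite grevK !eqxx !andbT; move: Ad; rewrite /inner grevK seam_rev.
by case/and3P=> -> nb /eqP ->; rewrite nb eqxx.
Qed.

Let neigh_connect u p q : p = q \/ neigh p q -> B u p -> B u q -> connect lk p q.
Proof.
move=> [-> //|[d [sd <- <-]]] Bp Bq; apply: connect1; apply/existsP; exists d.
by rewrite !eqxx !andbT /inner sd (betaP Bp) (betaP Bq) /=.
Qed.

Let walk_connect u e i j : i <= j -> j <= T ->
  (forall k, i <= k <= j -> B u (w e k)) -> connect lk (w e i) (w e j).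
Proof.
elim: j => [|j IHj] le_ij lejT Bw; first by move: le_ij; rewrite leqn0 => /eqP->.
move: le_ij; rewrite leq_eqVlt => /orP[/eqP->//|]; rewrite ltnS => le_ij.
apply: (connect_trans (y := w e j)).
  apply: IHj => //; first exact: ltnW.
  by move=> k /andP[h1 h2]; apply: Bw; rewrite h1 ltnW.
apply: (neigh_connect (u := u)); first exact: w_step.
  by apply: Bw; rewrite le_ij leqnSn.
by apply: Bw; rewrite leqnn ltnW.
Qed.

Let H_connect u p : H u p -> connect lk p (base u).
Proof.
case=> e [j [lej lu <-]]; have HB p' : H u p' -> B u p' by left.
move: lu; rewrite /lab; case: ltnP => h1.
  case=> tu; rewrite lk_sym -tu -w0; apply: (walk_connect (u := u)) => // k.
  move=> /andP[_ lek]; apply: HB; exists e, k; split=> //.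
    exact: leq_trans lek lej.
  by rewrite /lab (leq_ltn_trans lek h1) tu.
case: ltnP => // h2 [hu]; rewrite -hu -wT; apply: (walk_connect (u := u)) => // k.
move=> /andP[lek leT]; apply: HB; exists e, k; split=> //.
by rewrite /lab !ltnNge (leq_trans h1 lek) (leq_trans h2 lek) hu.
Qed.

Let B_connect u p : B u p -> connect lk p (base u).
Proof.
case=> [|[e [j [lej tle <- nH]]]]; first exact: H_connect.
rewrite lk_sym -tle -w0; apply: (walk_connect (u := u)) => // k /andP[_ lek].
right; exists e, k; split=> //; first exact: leq_trans lek lej.
by move=> j' lej'; apply: nH; apply: leq_trans lej' lek.
Qed.

Lemma grid_model_of_walks : grid_model a.
Proof.
have edge_dart e : exists d, [/\ ~~ seam d, beta (gsrc d) = Some (tl e)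
    & beta (gsrc (grev d)) = Some (hd e)].
  have exj : exists j, `[< j <= T /\ H (hd e) (w e j) >].
    exists T; apply/asboolP; split=> //; exists e, T; split=> //.
    by rewrite /lab !ltnNge (leq_trans le_n12 le_n2T) le_n2T.
  case: (ex_minnP exj) => j /asboolP[lejT Hj] jmin.
  have nH k : k < j -> ~ H (hd e) (w e k).
    move=> ltkj Hk; have : j <= k; last by rewrite leqNgt ltkj.
    apply: jmin; apply/asboolP; split=> //; apply: leq_trans lejT; exact: ltnW.
  case: j lejT Hj nH {jmin} => [|j] lejT Hj nH.
    have /H_inj/(_ Hj)/eqP : H (tl e) (w e 0).
      by exists e, 0; split=> //; rewrite /lab n1_gt0.
    by rewrite (negPf (tl_hd e)).
  have Bj : B (tl e) (w e j).
    right; exists e, j; split=> //; exact: ltnW.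
  have BSj : B (hd e) (w e j.+1) by left.
  have [E0|[d [sd s1 s2]]] := w_step e lejT.
    by have := tl_hd e; rewrite E0 in Bj; rewrite (B_inj Bj BSj) eqxx.
  by exists d; rewrite s1 s2 !(betaP Bj, betaP BSj).
exists m, beta; split=> // [p q|u v].
  case bp: (beta p) => [u|] // /esym/betaB Bq _.
  apply: connect_trans (B_connect (betaB bp)) _.
  by rewrite -/lk lk_sym; apply: B_connect.
case/a_edge=> e; have [d [sd d1 d2]] := edge_dart e.
case=> -[<- <-]; first by exists d.
by exists (grev d); rewrite seam_rev grevK.
Qed.

End Walks.

Local Open Scope classical_set_scope.
Local Open Scope ring_scope.

(** * Discretizing a drawing *)
Section Curves.
Variable R : realType.
Implicit Types (f g : R -> R * R) (A B : set R).

Definition close (r : R) (p q : R * R) : Prop :=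
  `|p.1 - q.1| < r /\ `|p.2 - q.2| < r.

Lemma closeC r p q : close r p q -> close r q p.
Proof. by case=> h1 h2; split; rewrite distrC. Qed.

Lemma close_trans r s p q t : close r p q -> close s q t -> close (r + s) p t.
Proof.
case=> h1 h2 [k1 k2]; split.
  by rewrite (le_lt_trans (ler_distD q.1 _ _)) // ltrD.
by rewrite (le_lt_trans (ler_distD q.2 _ _)) // ltrD.
Qed.

Lemma close_le r s p q : r <= s -> close r p q -> close s p q.
Proof. by move=> le_rs [h1 h2]; split; apply: lt_le_trans le_rs. Qed.

Lemma curve_near f A (s e : R) : {within A, continuous f} -> A s -> 0 < e ->
  \forall s' \near s, A s' -> close e (f s) (f s').
Proof.
move=> /subspace_continuousP fc As e0; have /cvg_ballP/(_ e e0) := fc s As.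
rewrite near_withinE; apply: filterS => s' h /h [] /=.
by rewrite /ball /=.
Qed.

Lemma curves_apart f g A B : compact A -> compact B ->
    {within A, continuous f} -> {within B, continuous g} ->
    (forall s t, A s -> B t -> f s <> g t) ->
  exists2 r : R, 0 < r & forall s t, A s -> B t -> ~ close r (f s) (g t).
Proof.
move=> cA cB fc gc fg.
have /compact_near_coveringP/near_covering_withinP cAB := compact_setX cA cB.
have h : \forall r \near (0^'+ : set_system R),
    A `*` B `<=` (fun st => ~ close r (f st.1) (g st.2)).
  apply: (cAB R (0^'+) (fun r st => ~ close r (f st.1) (g st.2))).
  move=> [s t] [/= As Bt].
  have [e e0 ne] : exists2 e : R, 0 < e & ~ close e (f s) (g t).
    have := fg s t As Bt; rewrite (surjective_pairing (f s)) (surjective_pairing (g t)).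
    have [E1|ne1] := eqVneq (f s).1 (g t).1.
      have [E2|ne2] := eqVneq (f s).2 (g t).2; first by rewrite E1 E2.
      move=> _; exists `|(f s).2 - (g t).2|; first by rewrite normr_gt0 subr_eq0.
      by case=> _; rewrite ltxx.
    move=> _; exists `|(f s).1 - (g t).1|; first by rewrite normr_gt0 subr_eq0.
    by case; rewrite ltxx.
  have e30 : 0 < e / 3 by rewrite divr_gt0.
  have ns := curve_near fc As e30; have nt := curve_near gc Bt e30.
  exists ([set st | (A st.1 -> close (e / 3) (f s) (f st.1)) /\
                    (B st.2 -> close (e / 3) (g t) (g st.2))],
          [set r : R | r < e / 3]) => /=.
    split; last exact: nbhs_right_lt.
    exists ([set s' | A s' -> close (e / 3) (f s) (f s')],
            [set t' | B t' -> close (e / 3) (g t) (g t')]) => //=.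
  move=> [[s' t'] r] /= [[hs ht] hr] [As' Bt'] c; apply: ne.
  have -> : e = e / 3 + (e / 3 + e / 3) by lra.
  apply: close_trans (hs As') _; apply: close_trans (closeC (ht Bt')).
  by apply: close_le c; apply: ltW.
have [r [hr r0]] := @filter_ex _ _ (at_right_proper_filter (0 : R)) _
  (filterI h (nbhs_right_gt (0 : R))).
by exists r => // s t As Bt; apply: (hr (s, t)).
Qed.

Lemma curve_uniform f A (e : R) : compact A -> {within A, continuous f} -> 0 < e ->
  exists2 r : R, 0 < r &
    forall s t, A s -> A t -> `|s - t| < r -> close e (f s) (f t).
Proof.
move=> cA fc e0; have /compact_near_coveringP/near_covering_withinP nA := cA.
have h : \forall r \near (0^'+ : set_system R),
    A `<=` (fun s => forall t, A t -> `|s - t| < r -> close e (f s) (f t)).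
  apply: (nA R (0^'+) (fun r s => forall t, A t -> `|s - t| < r -> close e (f s) (f t))).
  move=> s As.
  have e20 : 0 < e / 2 by rewrite divr_gt0.
  have /nbhs_ballP[d /= d0 hd] := curve_near fc As e20.
  exists (ball s (d / 2), [set r : R | r < d / 2]) => /=.
    by split; [apply: nbhsx_ballx; rewrite divr_gt0 | apply: nbhs_right_lt; rewrite divr_gt0].
  move=> [s' r] /= [bs hr] As' t At tr.
  rewrite [e]splitr; apply: (@close_trans _ _ _ (f s)).
    apply: closeC; apply: hd As'; apply: le_ball bs; lra.
  apply: hd At; rewrite [d]splitr; apply: ball_triangle bs _.
  by rewrite /ball /=; apply: lt_trans tr hr.
have [r [hr r0]] := @filter_ex _ _ (at_right_proper_filter (0 : R)) _
  (filterI h (nbhs_right_gt (0 : R))).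
by exists r => // s t As At; apply: (hr s As t At).
Qed.

End Curves.

Local Close Scope ring_scope.
Local Close Scope classical_set_scope.

Local Open Scope ring_scope.

Lemma finite_lower_bound (R : realFieldType) (I : finType) (r : I -> R) :
  (forall i, 0 < r i) -> exists2 r0 : R, 0 < r0 & forall i, r0 <= r i.
Proof.
move=> r_gt0; have s_ge0 : 0 <= \sum_i (r i)^-1.
  by apply: sumr_ge0 => i _; rewrite invr_ge0 ltW.
exists (1 + \sum_i (r i)^-1)^-1; first by rewrite invr_gt0; lra.
move=> i; rewrite -[leRHS]invrK lef_pV2 ?posrE ?invr_gt0 //; last by lra.
rewrite (bigD1 i) //= addrCA lerDl addr_ge0 // sumr_ge0 // => j _.
by rewrite invr_ge0 ltW.
Qed.

Lemma nat_step (i j : nat) : (i < j + 2)%N -> (j < i + 2)%N ->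
  (i == j) || (i.+1 == j) || (i == j.+1).
Proof. lia. Qed.

Lemma half_cases (n j : nat) : (j <= 6 * n)%N ->
  [/\ (j./2 <= 3 * n)%N, (uphalf j <= 3 * n)%N
    & uphalf j = j./2 \/ (j./2 < 3 * n)%N /\ uphalf j = (j./2).+1].
Proof. by move=> h; split; lia. Qed.

Lemma third_cases (n j : nat) : (j <= 6 * n)%N ->
  let k := if (j < 2 * n)%N then 0%N else if (j < 4 * n)%N then 1%N else 2%N in
  (k * n <= j./2 <= k.+1 * n)%N.
Proof. by move=> h; do !case: ifP; lia. Qed.

Lemma half_succ_odd j : odd j -> uphalf j.+1 = uphalf j /\ j.+1./2 = (j./2).+1.
Proof. lia. Qed.

Lemma half_succ_even j : ~~ odd j -> uphalf j.+1 = (uphalf j).+1 /\ j.+1./2 = j./2.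
Proof. lia. Qed.

Section Discretize.
Variables (R : realType) (G : sgraph) (pt : G -> R * R) (arc : edge G -> R -> R * R).
Hypothesis draw : plane_drawing pt arc.
Variables (tl hd : edge G -> G).
Hypothesis tlhd : forall e, [/\ val e = [set tl e; hd e]%SET,
  arc e 0 = pt (tl e) & arc e 1 = pt (hd e)].

(** The thirds of an arc play the roles of the three parts of a walk. *)
Definition piece (k : nat) : set R := [set` `[k%:R / 3, k.+1%:R / 3]].

Definition lab3 e (k : nat) : G + edge G :=
  if k == 0%N then inl (tl e) else if k == 1%N then inr e else inl (hd e).

Lemma piece01 k t : (k < 3)%N -> piece k t -> t \in `[0, 1].
Proof.
by case: k => [|[|[|]]] // _; rewrite /piece /= !in_itv /= => /andP[? ?]; apply/andP; lra.
Qed.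

Lemma pieces_disjoint e e' k k' s t : (k < 3)%N -> (k' < 3)%N ->
  conflict tl hd (lab3 e k) (lab3 e' k') -> piece k s -> piece k' t ->
  arc e s <> arc e' t.
Proof.
move=> lk lk' cf ps pt' E.
have s01 := piece01 lk ps; have t01 := piece01 lk' pt'.
have endP (f : edge G) j r : (j < 3)%N -> piece j r -> r \in `[0, 1] ->
    r \notin `]0, 1[ -> exists x, arc f r = pt x /\ lab3 f j = inl x.
  move=> lj pj; rewrite !in_itv /= negb_and -!leNgt => /andP[r0 r1].
  have [_ a0 a1] := tlhd f.
  case/orP=> hr.
    have r0' : r = 0 by clear a0 a1 E; lra.
    exists (tl f); rewrite r0' a0; split=> //; case: j lj pj => [|[|[|]]] // _.
      by rewrite /piece /= in_itv /= r0' => /andP[h _]; exfalso; clear a0 a1 E; lra.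
    by rewrite /piece /= in_itv /= r0' => /andP[h _]; exfalso; clear a0 a1 E; lra.
  have r1' : r = 1 by clear a0 a1 E; lra.
  exists (hd f); rewrite r1' a1; split=> //; case: j lj pj => [|[|[|]]] // _.
    by rewrite /piece /= in_itv /= r1' => /andP[_ h]; exfalso; clear a0 a1 E; lra.
  by rewrite /piece /= in_itv /= r1' => /andP[_ h]; exfalso; clear a0 a1 E; lra.
case: (boolP (s \in `]0, 1[)) => hs; case: (boolP (t \in `]0, 1[)) => ht.
- have [ee|ne] := eqVneq e e'; last by apply: (arc_disjoint draw _ hs ht E); apply/eqP.
  subst e'; have st : s = t by exact: (arc_inj draw s01 t01 E).
  subst t; move: cf ps pt'; rewrite /piece /= !in_itv /=.
  case: k lk => [|[|[|]]] // _; case: k' lk' => [|[|[|]]] // _;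
    rewrite /lab3 /= ?eqxx ?andbF // => _ /andP[h1 h2] /andP[h3 h4]; clear E; lra.
- have [x [tx _]] := endP e' _ _ lk' pt' t01 ht.
  by apply: (@arc_avoid_pt _ _ _ _ draw e s x hs); rewrite E.
- have [x [tx _]] := endP e _ _ lk ps s01 hs.
  by apply: (@arc_avoid_pt _ _ _ _ draw e' t x ht); rewrite -E.
have [x [sx lx]] := endP e _ _ lk ps s01 hs.
have [y [ty ly]] := endP e' _ _ lk' pt' t01 ht.
have xy : x = y by apply: (pt_inj draw); rewrite -sx -ty.
by move: cf; rewrite lx ly xy /= eqxx.
Qed.

(** Disjoint compact pieces have a positive distance, and there are finitely
    many pairs of pieces. *)
Lemma drawing_scale : exists2 r : R, 0 < r &
  forall e e' k k' s t, (k < 3)%N -> (k' < 3)%N ->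
    conflict tl hd (lab3 e k) (lab3 e' k') -> piece k s -> piece k' t ->
    ~ close r (arc e s) (arc e' t).
Proof.
have cont e k : (k < 3)%N -> {within piece k, continuous (arc e)}%classic.
  move=> lk; apply: continuous_subspaceW (arc_continuous draw (e := e)).
  by move=> t /(piece01 lk).
pose P (x : (edge G * edge G) * ('I_3 * 'I_3)) (r : R) := 0 < r /\
  (conflict tl hd (lab3 x.1.1 x.2.1) (lab3 x.1.2 x.2.2) ->
   forall s t, piece x.2.1 s -> piece x.2.2 t ->
    ~ close r (arc x.1.1 s) (arc x.1.2 t)).
have /fin_all_exists[r rP] : forall x, exists r, P x r.
  case=> [[e e'] [k k']]; rewrite /P /=.
  case cf: (conflict _ _ _ _); last by exists 1; split.
  have [r r0 hr] := curves_apart (@segment_compact _ _ _) (@segment_compact _ _ _)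
    (cont e k (ltn_ord k)) (cont e' k' (ltn_ord k'))
    (fun s t ps pt' => pieces_disjoint (ltn_ord k) (ltn_ord k') cf ps pt').
  by exists r; split=> // _; exact: hr.
have [r0 r00 hr0] := finite_lower_bound (fun x => (rP x).1).
exists r0 => // e e' k k' s t lk lk' cf ps pt' c.
have [_ /(_ cf s t ps pt')] := rP ((e, e'), (Ordinal lk, Ordinal lk')).
by apply; apply: close_le c; apply: hr0.
Qed.

(** The arcs are sampled with steps below a quarter of the distance between
    disjoint pieces, on a grid with cells of that size. To move along grid edges
    only, the two coordinates advance alternately: at step [j] the abscissa is
    that of sample [uphalf j] and the ordinate that of sample [j./2]. *)
Lemma grid_model_of_drawing : grid_model (@adj G).
Proof.
have [r r_gt0 apart] := drawing_scale.
(* A sample lies within 2 eps of its grid point, so two samples at the same grid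
   point are less than 4 eps = r apart. *)
pose eps : R := r / 4; have eps0 : 0 < eps by rewrite divr_gt0.
have [dlt dlt0 unif] : exists2 d : R, 0 < d & forall e s t, s \in `[0, 1] ->
    t \in `[0, 1] -> `|s - t| < d -> close eps (arc e s) (arc e t).
  have /fin_all_exists[d dP] : forall e, exists d : R, 0 < d /\
      forall s t, s \in `[0, 1] -> t \in `[0, 1] -> `|s - t| < d ->
        close eps (arc e s) (arc e t).
    move=> e; have [d d0 hd0] := curve_uniform (@segment_compact _ _ _)
      (arc_continuous draw (e := e)) eps0.
    by exists d.
  have [d0 d00 hd0] := finite_lower_bound (fun e => (dP e).1).
  exists d0 => // e s t s01 t01 st; apply: (dP e).2 => //.
  exact: lt_le_trans st (hd0 e).
(* Each third of an arc gets [n] steps. *)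
pose n := (Num.truncn dlt^-1).+1.
have n_gt0 : 0 < n%:R :> R by rewrite ltr0n.
have n_dlt : (3 * n%:R)^-1 < dlt.
  rewrite -[ltRHS]invrK ltf_pV2 ?posrE ?mulr_gt0 ?invr_gt0 //.
  apply: (@lt_le_trans _ _ n%:R); first exact: truncnS_gt.
  by lra.
pose par (i : nat) : R := i%:R / (3 * n%:R).
have par01 i : (i <= 3 * n)%N -> par i \in `[0, 1].
  move=> lei; rewrite in_itv /= /par divr_ge0 ?mulr_ge0 ?ler0n //=.
  rewrite ler_pdivrMr ?mulr_gt0 // mul1r -natrM ler_nat //.
pose p e i := arc e (par i).
have p_close e i : (i < 3 * n)%N -> close eps (p e i) (p e i.+1).
  move=> lti; apply: unif; rewrite ?par01 //; first exact: ltnW.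
  rewrite distrC /par -mulrBl -natrB // subSnn mul1r ger0_norm //.
  by rewrite invr_ge0 mulr_ge0 // ltW.
(* A translation that makes all coordinates of samples nonnegative. *)
pose M : R := \sum_e \sum_(i < (3 * n).+1) (`|(p e i).1| + `|(p e i).2|).
have pM e i : (i <= 3 * n)%N -> 0 <= (p e i).1 + M /\ 0 <= (p e i).2 + M.
  move=> lei; have : `|(p e i).1| + `|(p e i).2| <= M.
    rewrite /M (bigD1 e) //= (bigD1 (Ordinal (lei : (i < (3 * n).+1)%N))) //=.
    rewrite -addrA lerDl addr_ge0 //; first by apply: sumr_ge0 => j _; rewrite addr_ge0.
    by apply: sumr_ge0 => e' _; apply: sumr_ge0 => j _; rewrite addr_ge0.
  have := ler_norm (- (p e i).1); have := ler_norm (- (p e i).2); rewrite !normrN.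
  have := normr_ge0 (p e i).1; have := normr_ge0 (p e i).2; lra.
pose cx e i := Num.truncn (((p e i).1 + M) / eps).
pose cy e i := Num.truncn (((p e i).2 + M) / eps).
have cell (x : R) : 0 <= x -> (Num.truncn (x / eps))%:R * eps <= x
    < ((Num.truncn (x / eps))%:R + 1) * eps.
  move=> x0; have := @truncn_itv _ (x / eps) (divr_ge0 x0 (ltW eps0)).
  by rewrite ler_pdivlMr // ltr_pdivrMr // -natr1.
have cell_step (x y : R) : 0 <= x -> 0 <= y -> `|x - y| < eps ->
    (fun i j : nat => (i == j) || (i.+1 == j) || (i == j.+1))
      (Num.truncn (x / eps)) (Num.truncn (y / eps)).
  move=> x0 y0 xy; set i := Num.truncn _; set j := Num.truncn _; have /andP[i1 i2] := cell _ x0; have /andP[j1 j2] := cell _ y0.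
  have lt1 (u v : nat) (z t : R) : u%:R * eps <= z -> t < (v%:R + 1) * eps ->
      z - t < eps -> (u < v + 2)%N.
    move=> h1 h2 h3; rewrite -(ltr_nat R) natrD -(ltr_pM2r eps0).
    by rewrite mulrDl; lra.
  have h1 : (i < j + 2)%N by apply: lt1 i1 j2 _; move: xy; rewrite ltr_norml; lra.
  have h2 : (j < i + 2)%N by apply: lt1 j1 i2 _; move: xy; rewrite ltr_norml; lra.
  exact: nat_step.
pose m := (\sum_e \sum_(i < (3 * n).+1) (cx e i + cy e i)).+1.
have cm e i : (i <= 3 * n)%N -> (cx e i < m)%N /\ (cy e i < m)%N.
  move=> lei; have : (cx e i + cy e i <= m.-1)%N.
    rewrite /m (bigD1 e) //= (bigD1 (Ordinal (lei : (i < (3 * n).+1)%N))) //=.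
    by rewrite -addnA leq_addr.
  rewrite /= => h; split; rewrite ltnS; apply: leq_trans h; first exact: leq_addr.
  exact: leq_addl.
pose w e j : gpt m := (inord (cx e (uphalf j)), inord (cy e j./2)).
pose T := (6 * n)%N; pose n1 := (2 * n)%N; pose n2 := (4 * n)%N.
have halfT j : (j <= T)%N -> (j./2 <= 3 * n)%N by case/half_cases.
have uphalfT j : (j <= T)%N -> (uphalf j <= 3 * n)%N by case/half_cases.
have near_cell e j : (j <= T)%N ->
    `|(p e j./2).1 + M - (w e j).1%:R * eps| < 2 * eps /\
    `|(p e j./2).2 + M - (w e j).2%:R * eps| < 2 * eps.
  move=> lej; have [c1 c2] := cm e _ (uphalfT _ lej).
  have [d1 d2] := cm e _ (halfT _ lej).
  rewrite /w /= !inordK ?(ltn_trans c1) ?(ltn_trans d2) //.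
  have [m1 m2] := pM e _ (halfT _ lej); have [q1 q2] := pM e _ (uphalfT _ lej).
  have /andP[] := cell _ q1; have /andP[] := cell _ m2; rewrite -/(cx e _) -/(cy e _).
  move=> h1 h2 h3 h4; rewrite !ltr_norml !mulrDl !mul1r in h2 h4 *.
  have [_ _ [E|[lt E]]] := half_cases lej.
    by rewrite E in h3 h4 *; split; apply/andP; split; lra.
  have [] := p_close e _ lt; rewrite !ltr_norml E in h3 h4 *.
  by move=> /andP[k1 k2] /andP[k3 k4]; split; apply/andP; split; lra.
pose pc j := if (j < n1)%N then 0%N else if (j < n2)%N then 1%N else 2%N.
have pc3 j : (pc j < 3)%N by rewrite /pc; do !case: ifP.
have labE e j : lab tl hd n1 n2 e j = lab3 e (pc j).
  by rewrite /lab /pc /lab3; do !case: ifP.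
have pcP j : (j <= T)%N -> piece (pc j) (par j./2).
  move=> lej; rewrite /piece /= in_itv /= /par.
  suff /andP[h1 h2] : (pc j * n <= j./2 <= (pc j).+1 * n)%N.
    have {}h1 : (pc j)%:R * n%:R <= (j./2)%:R :> R by rewrite -natrM ler_nat.
    have {}h2 : (j./2)%:R <= (pc j).+1%:R * n%:R :> R by rewrite -natrM ler_nat.
    have n30 : 0 < 3 * n%:R :> R by rewrite mulr_gt0.
    apply/andP; split.
      by rewrite ler_pdivrMr // mulrAC ler_pdivlMr //; lra.
    by rewrite ler_pdivrMr // mulrAC ler_pdivlMr //; lra.
  exact: third_cases.
have tlne e : tl e != hd e.
  have [eE _ _] := tlhd e; have /= := valP e.
  rewrite eE inE => /existsP[x /existsP[y /andP[xy /eqP E]]].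
  apply/eqP => h; have := cards2 x y; rewrite -E h cards2 eqxx /=.
  by case: eqP xy => [->|//]; rewrite adj_irrefl.
pose base u : gpt m := (inord (Num.truncn (((pt u).1 + M) / eps)),
                        inord (Num.truncn (((pt u).2 + M) / eps))).
apply: (@grid_model_of_walks _ _ tl hd _ tlne _ m T n1 n2 w _ _ _ _ _ base) => //.
- move=> u v uv; have eP : [set u; v]%SET \in edge_set G.
    by rewrite inE; apply/existsP; exists u; apply/existsP; exists v; rewrite uv /=.
  exists (exist _ [set u; v]%SET eP).
  case: (tlhd (exist _ [set u; v]%SET eP)) (tlne (exist _ [set u; v]%SET eP)).
  move: (tl _) (hd _) => x y /= E _ _ xy.
  have xin : x \in [set u; v]%SET by rewrite E finset.set21.
  have yin : y \in [set u; v]%SET by rewrite E finset.set22.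
  move: xin yin; rewrite !inE => /orP[] /eqP xE /orP[] /eqP yE.
  - by rewrite xE yE eqxx in xy.
  - by left.
  - by right.
  - by rewrite xE yE eqxx in xy.
- by rewrite /n1 /n2 leq_mul2r orbT.
- by rewrite /n2 /T leq_mul2r orbT.
- move=> e j ltj; have [c1 _] := cm e _ (uphalfT _ ltj); have [c2 _] := cm e _ (uphalfT _ (ltnW ltj)).
  have [_ d1] := cm e _ (halfT _ ltj); have [_ d2] := cm e _ (halfT _ (ltnW ltj)).
  have inordS k : (k < m)%N -> inord k.+1 = ordS (inord k : 'I_m.+1).
    move=> ltk; apply: val_inj; rewrite /= !inordK //; last exact: ltnW.
    by rewrite modn_small.
  have nmax k : (k < m)%N -> (inord k == ord_max :> 'I_m.+1) = false.
    by move=> ltk; rewrite -val_eqE /= inordK ?ltn_eqF // ltnW.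
  have neighC q q' : neigh q q' -> @neigh m q' q.
    by case=> d [sd <- <-]; exists (grev d); rewrite seam_rev grevK.
  have hor k y : (k < m)%N -> @neigh m (inord k, y) (inord k.+1, y).
    by move=> ltk; exists ((inord k, y), (true, true)); rewrite /seam /= nmax // inordS.
  have ver k x : (k < m)%N -> @neigh m (x, inord k) (x, inord k.+1).
    by move=> ltk; exists ((x, inord k), (false, true)); rewrite /seam /= nmax // inordS.
  have step_le k k' (z : 'I_m.+1) : (k < m)%N -> (k' < m)%N ->
      (k == k') || (k.+1 == k') || (k == k'.+1) ->
      ((inord k, z) = (inord k', z) :> gpt m \/ @neigh m (inord k, z) (inord k', z)) /\
      ((z, inord k) = (z, inord k') :> gpt m \/ @neigh m (z, inord k) (z, inord k')).
    move=> lk lk' /orP[/orP[]|] /eqP E.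
    - by rewrite E; split; left.
    - by rewrite -E; split; right; [exact: hor|exact: ver].
    by rewrite E; split; right; apply: neighC; [exact: hor|exact: ver].
  have [odj|evj] := boolP (odd j).
    have [E1 E2] := half_succ_odd odj.
    have lt3 : (j./2 < 3 * n)%N by have := halfT _ ltj; rewrite E2.
    have [_ h] := p_close e _ lt3.
    have [_ m1] := pM e _ (halfT _ (ltnW ltj)); have [_ m2] := pM e _ lt3.
    rewrite /w E1 E2 in d1 d2 *; case: (step_le _ _ (inord (cx e (uphalf j))) d2 d1) => //.
    by apply: cell_step => //; rewrite opprD addrACA subrr addr0.
  have [E1 E2] := half_succ_even evj.
  have lt3 : (uphalf j < 3 * n)%N by have := uphalfT _ ltj; rewrite E1.
  have [h _] := p_close e _ lt3.
  have [m1 _] := pM e _ (uphalfT _ (ltnW ltj)); have [m2 _] := pM e _ lt3.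
  rewrite /w E1 E2 in c1 c2 *; case: (step_le _ _ (inord (cy e j./2)) c2 c1) => //.
  by apply: cell_step => //; rewrite opprD addrACA subrr addr0.
- move=> e e' j j' lej lej' E; apply/negP; rewrite !labE => cf.
  apply: (apart e e' _ _ _ _ (pc3 j) (pc3 j') cf (pcP j lej) (pcP j' lej')).
  have [h1 h2] := near_cell e j lej; have [h3 h4] := near_cell e' j' lej'.
  rewrite E in h1 h2; rewrite /close -/(p e _) -/(p e' _).
  move: h1 h2 h3 h4; rewrite /eps !ltr_norml => /andP[h1 h2] /andP[h3 h4].
  by move=> /andP[k1 k2] /andP[k3 k4]; split; apply/andP; split; lra.
- move=> e; have [_ e0 _] := tlhd e.
  have par0 : par 0%N = 0 by rewrite /par mul0r.
  have -> : w e 0%N = (inord (cx e 0%N), inord (cy e 0%N)) by [].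
  by rewrite /base /cx /cy /p par0 e0.
move=> e; have [_ _ e1] := tlhd e.
have -> : w e T = (inord (cx e (3 * n)%N), inord (cy e (3 * n)%N)).
  rewrite /w /T (_ : (6 * n = (3 * n).*2)%N) ?doubleK ?uphalf_double //.
  by rewrite -mul2n mulnA.
have par1 : par (3 * n)%N = 1 by rewrite /par natrM divff // mulf_neq0 ?pnatr_eq0.
by rewrite /base /cx /cy /p par1 e1.
Qed.

End Discretize.

Lemma planar_grid_model (R : realType) (G : sgraph) :
  planar R G -> grid_model (@adj G).
Proof.
case=> pt [arc draw].
have /fin_all_exists[tl tlP] : forall e : edge G, exists x, exists y,
    [/\ val e = [set x; y]%SET, arc e 0 = pt x & arc e 1 = pt y].
  by move=> e; apply: (arc_ends draw).
have /fin_all_exists[hd hdP] := tlP.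
apply: (@grid_model_of_drawing R G pt arc draw tl hd) => e; exact: hdP.
Qed.

Local Close Scope ring_scope.

Definition deg (V : finType) (a : rel V) (x : V) : nat := #|a x|.

(** * Euler's inequality *)
Section Euler.
Variable R : realFieldType.
Variables (V : finType) (a : rel V) (n : V * V -> V * V).
Hypotheses (a_sym : symmetric a) (a_irr : irreflexive a) (mapn : plane_map a n).

Definition face (d : V * V) : V * V := n (swapd d).
Lemma faceE d : face d = n (swapd d).
Proof. by []. Qed.

Definition flen (d : V * V) : nat := order face d.

Lemma face_inj : injective face.
Proof. exact: inj_comp (map_inj mapn) (inv_inj (@swapdK V)). Qed.

Lemma dart_swapd d : dart a (swapd d) = dart a d.
Proof. by rewrite /dart a_sym. Qed.

Lemma dart_face d : dart a (face d) = dart a d.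
Proof. by rewrite /face (map_dart mapn) dart_swapd. Qed.

Lemma face_src d : (face d).1 = d.2.
Proof. by rewrite /face (map_src mapn). Qed.

Lemma jordan_face (C : V * V -> bool) :
    (forall d, C d -> dart a d) -> circulation fst (@swapd V) C ->
  exists lam : V * V -> bool, forall d, dart a d ->
    lam (face d) = lam d /\ lam (swapd d) = lam d (+) C d.
Proof.
move=> CD Ccirc; have [lam lamP] := map_jordan mapn CD Ccirc.
exists lam => d dd; have [_ E] := lamP d dd; split=> //.
have [|-> _] := lamP (swapd d); first by rewrite dart_swapd.
by rewrite E (Ccirc.1 d) -addbA addbb addbF.
Qed.

Lemma invariant_fconnect (T : eqType) (k : V * V -> T) d d' :
  (forall d, dart a d -> k (face d) = k d) -> dart a d -> fconnect face d d' ->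
  k d' = k d.
Proof.
move=> kf dd /iter_findex <-; elim: (findex _ _ _) => //= j <-.
by rewrite kf //; elim: j => //= j; rewrite dart_face.
Qed.

Let darts := [set d | dart a d].
Let half := [set d | dart a d & enum_rank d.1 < enum_rank d.2].
Let Csub (A : {set V * V}) d := (d \in A) || (swapd d \in A).
Let odds (A : {set V * V}) := [set p | bnd fst (Csub A) p].
Let even := [set A in powerset half | odds A == set0].
Let V0 := [set x | 0 < deg a x].
Let roots := [set froot face d | d in darts].

Let half_excl d : d \in half -> swapd d \notin half.
Proof.
by rewrite !inE => /andP[_ lt]; rewrite negb_and -leqNgt (ltnW lt) orbT.
Qed.

Let half_or d : dart a d -> d \in half \/ swapd d \in half.
Proof.
move=> dd; rewrite !inE dart_swapd dd /=.
case: ltngtP => [||E]; [by left|by right|].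
by move: dd; rewrite /dart (enum_rank_inj (val_inj E)) a_irr.
Qed.

Let card_darts : #|darts| = 2 * #|half|.
Proof.
have -> : darts = half :|: [set swapd d | d in half].
  apply/setP => d; rewrite inE in_setU; apply/idP/orP => [dd|].
    have [h|h] := half_or dd; first by left.
    by right; apply/imsetP; exists (swapd d); rewrite ?swapdK.
  case; first by rewrite inE => /andP[].
  by case/imsetP => d'; rewrite inE => /andP[dd _] ->; rewrite dart_swapd.
rewrite cardsU card_imset; last exact: inv_inj (@swapdK V).
rewrite (_ : _ :&: _ = set0) ?cards0 ?subn0 ?mul2n ?addnn //.
apply/setP => d; rewrite !inE; apply/negbTE/negP => /andP[dh /imsetP[d' d'h E]].
have : d \in half by rewrite inE.
by move/half_excl; rewrite E swapdK d'h.
Qed.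

Let Csub_half (A : {set V * V}) d : A \subset half -> d \in half -> Csub A d = (d \in A).
Proof.
move=> sub dh; rewrite /Csub; case: (boolP (swapd d \in A)) => [|_]; last by rewrite orbF.
by move/(subsetP sub); rewrite (negPf (half_excl dh)).
Qed.

Let Csub_swap (A : {set V * V}) d : Csub A (swapd d) = Csub A d.
Proof. by rewrite /Csub swapdK orbC. Qed.

Let Csub_dart (A : {set V * V}) d : A \subset half -> Csub A d -> dart a d.
Proof.
move=> sub /orP[] /(subsetP sub); rewrite inE => /andP[] //.
by rewrite dart_swapd.
Qed.

Let sd (A B : {set V * V}) := [set d | (d \in A) (+) (d \in B)].

Let sd_half (A B : {set V * V}) : A \subset half -> B \subset half -> sd A B \subset half.
Proof.
move=> sA sB; apply/subsetP => d; rewrite inE.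
case: (boolP (d \in A)) => [/(subsetP sA)//|_] /=; exact: (subsetP sB).
Qed.

Let Csub_sd (A B : {set V * V}) d : A \subset half -> B \subset half ->
  Csub (sd A B) d = Csub A d (+) Csub B d.
Proof.
move=> sA sB; have sAB := sd_half sA sB.
have main d' : d' \in half -> Csub (sd A B) d' = Csub A d' (+) Csub B d'.
  by move=> dh; rewrite !Csub_half // inE.
case: (boolP (dart a d)) => [/half_or[/main//|/main]|nd].
  by rewrite !Csub_swap.
have no (A' : {set V * V}) : A' \subset half -> Csub A' d = false.
  by move=> sA'; apply/negbTE; apply: contra nd; apply: Csub_dart.
by rewrite !no.
Qed.

Let odds_sd (A B : {set V * V}) : A \subset half -> B \subset half ->
  odds (sd A B) = [set p | (p \in odds A) (+) (p \in odds B)].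
Proof.
move=> sA sB; apply/setP => p; rewrite !inE -bnd_add.
by apply: eq_bigr => d _; apply: Csub_sd.
Qed.

(* The handshake lemma. *)
Let odds_even (A : {set V * V}) : A \subset half -> \big[addb/false]_p (p \in odds A) = false.
Proof.
move=> sA; rewrite (eq_bigr (fun p => \big[addb/false]_(d | d.1 == p) Csub A d)); last first.
  by move=> p _; rewrite inE.
rewrite (exchange_big_dep predT) //=.
rewrite (eq_bigr (Csub A)); last 
  by move=> d _; rewrite (big_pred1 d.1) // => p; rewrite /= eq_sym.
rewrite (bigID (mem half)) /= [X in _ (+) X](bigID (fun d => swapd d \in half)) /=.
rewrite [X in _ (+) (_ (+) X)]big1 ?addbF; last first.
  move=> d /andP[h1 h2]; apply/negbTE/negP => /(Csub_dart sA)/half_or[].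
    by rewrite (negPf h1).
  by rewrite (negPf h2).
rewrite [X in _ (+) X](reindex_inj (inv_inj (@swapdK V))) /=.
rewrite [X in _ (+) X](eq_bigl (mem half)); last first.
  move=> d /=; rewrite swapdK; case: (boolP (d \in half)) => dh; rewrite ?andbF ?andbT //.
  exact: half_excl.
by rewrite [X in _ (+) X](eq_bigr (Csub A)) ?addbb // => d _; rewrite Csub_swap.
Qed.

Let sdK (A0 : {set V * V}) : injective (fun A => sd A A0).
Proof.
move=> A B /setP E; apply/setP => d; have := E d; rewrite !inE.
by case: (d \in A0); case: (d \in A); case: (d \in B).
Qed.

Let card_fiber Y : #|[set A in powerset half | odds A == Y]| <= #|even|.
Proof.
case: (set_0Vmem [set A in powerset half | odds A == Y]) => [->|[A0]].
  by rewrite cards0.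
rewrite !inE => /andP[sA0 /eqP oA0].
rewrite -(card_imset _ (@sdK A0)); apply: subset_leq_card.
apply/subsetP => y /imsetP[A]; rewrite !inE => /andP[sA /eqP oA] ->.
rewrite sd_half //=; apply/eqP/setP => p; rewrite odds_sd // oA oA0 !inE.
exact: addbb.
Qed.

Let odds_V0 (A : {set V * V}) : A \subset half -> odds A \subset V0.
Proof.
move=> sA; apply/subsetP => p; rewrite !inE; apply: contraTT.
rewrite -eqn0Ngt => /eqP/card0_eq d0; rewrite /bnd big1 // => d /eqP dp.
apply/negbTE/negP => /(Csub_dart sA); rewrite /dart dp => ad.
by have : d.2 \in a p; [exact: ad | rewrite d0].
Qed.

Let card_odds v0 : v0 \in V0 -> #|odds @: powerset half| <= 2 ^ #|V0|.-1.
Proof.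
move=> v00; have -> : #|V0|.-1 = #|V0 :\ v0| by rewrite (cardsD1 v0 V0) v00.
rewrite -card_powerset -(card_in_imset (f := fun Y => Y :\ v0)).
  apply: subset_leq_card; apply/subsetP => y /imsetP[z /imsetP[A + ->] ->].
  by rewrite !inE => sA; apply: setSD; apply: odds_V0.
move=> _ _ /imsetP[A + ->] /imsetP[B + ->]; rewrite !inE => sA sB /setP E.
apply/setP => p; have [->|ne] := eqVneq p v0; last first.
  by have := E p; rewrite !in_setD1 ne.
have EA := odds_even sA; have EB := odds_even sB.
rewrite (bigD1 v0) //= in EA; rewrite (bigD1 v0) //= in EB.
rewrite (eq_bigr (fun q => q \in odds A)) in EB; last first.
  by move=> q ne; have := E q; rewrite !in_setD1 ne.
move: EA EB; case: (\big[_/_]_(_ | _) _); rewrite ?addbT ?addbF => EA EB.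
  by apply: negb_inj; rewrite EA EB.
by rewrite EA EB.
Qed.

(* Each even set is the boundary of two complementary sets of faces, which
   determine it. *)
Let card_even : (exists d, dart a d) -> 2 * #|even| <= 2 ^ #|roots|.
Proof.
case=> d0 dd0.
have /fin_all_exists[lam lamP] : forall A : {set V * V}, exists l : V * V -> bool,
    A \in even -> forall d, dart a d -> l (face d) = l d /\
       l (swapd d) = l d (+) Csub A d.
  move=> A; case: (boolP (A \in even)); last by exists xpred0.
  rewrite !inE => /andP[sA /eqP/setP oA].
  have [||l lP] := jordan_face (C := Csub A).
  - by move=> d; apply: Csub_dart.
  - split=> [d|p]; first exact: Csub_swap.
    by have := oA p; rewrite !inE.
  by exists l.
(* The boolean exchanges the two sides of an even set. *)
pose g (x : {set V * V} * bool) := [set r in roots | lam x.1 r (+) x.2].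
have dom : #|setX even [set: bool]| = 2 * #|even| by rewrite cardsX cardsT card_bool mulnC.
rewrite -dom -card_powerset -(card_in_imset (f := g)).
  apply: subset_leq_card; apply/subsetP => _ /imsetP[x _ ->]; rewrite inE.
  by apply/subsetP => r; rewrite inE => /andP[].
move=> [A b] [B b']; rewrite !inE !andbT /= => eA eB /setP E.
have eA' : A \in even by rewrite !inE. 
have eB' : B \in even by rewrite !inE.
have lr d : dart a d -> lam A d (+) b = lam B d (+) b'.
  move=> dd; have cr : fconnect face d (froot face d) by apply: connect_root.
  rewrite -(invariant_fconnect (k := lam A) _ dd cr); last first.
    by move=> d' dd'; case: (lamP A eA' d' dd').
  rewrite -(invariant_fconnect (k := lam B) _ dd cr); last first.
    by move=> d' dd'; case: (lamP B eB' d' dd').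
  have := E (froot face d); rewrite !inE /=.
  by rewrite (_ : froot face d \in roots) //; apply/imsetP; exists d; rewrite ?inE.
have CC d : dart a d -> Csub A d = Csub B d.
  move=> dd; have [_ l1] := lamP A eA' d dd; have [_ l2] := lamP B eB' d dd.
  have := lr _ dd; have /lr : dart a (swapd d) by rewrite dart_swapd.
  rewrite l1 l2; case: (lam A d); case: (lam B d); case: (b); case: (b');
    by case: (Csub A d); case: (Csub B d).
have sA : A \subset half by case/andP: eA.
have sB : B \subset half by case/andP: eB.
have AB : A = B.
  apply/setP => d; case: (boolP (d \in half)) => dh.
    by rewrite -[LHS](Csub_half sA) // -[RHS](Csub_half sB) // CC //; move: dh;
       rewrite inE => /andP[].
  by rewrite (contraNF (subsetP sA d) dh) (contraNF (subsetP sB d) dh).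
by congr pair => //; have := lr _ dd0; rewrite AB => /addbI.
Qed.

(* The subsets of the edge set are classified by their sets of odd vertices:
   there are at most 2 ^ (V - 1) classes, as odd sets have an even cardinality,
   and each class is a coset of the group of even sets. *)
Let euler_card : (exists d, dart a d) -> #|half| + 2 <= #|V0| + #|roots|.
Proof.
move=> exd; have [d0 dd0] := exd.
have v00 : d0.1 \in V0.
  by rewrite inE; apply/card_gt0P; exists d0.2.
have V0_gt0 : 0 < #|V0| by apply/card_gt0P; exists d0.1.
have h1 : 2 ^ #|half| <= #|odds @: powerset half| * #|even|.
  rewrite -card_powerset -sum1_card (partition_big_imset odds) /= -sum_nat_const.
  apply: leq_sum => Y _; rewrite sum1dep_card.
  apply: leq_trans (card_fiber Y); apply: subset_leq_card.
  by apply/subsetP => A; rewrite !inE.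
have h2 := card_odds v00; have h3 := card_even exd.
have : 2 ^ #|half|.+1 <= 2 ^ (#|V0|.-1 + #|roots|).
  rewrite expnS expnD; apply: leq_trans (leq_mul (leqnn 2) h1) _.
  by rewrite mulnCA; apply: leq_mul.
rewrite leq_exp2l //; lia.
Qed.

Local Open Scope ring_scope.

Let sum_nodes : \sum_(d | dart a d) (deg a d.1)%:R^-1 = #|V0|%:R :> R.
Proof.
rewrite (partition_big (fun d => d.1) (mem V0)) /=; last first.
  by move=> d dd; rewrite inE; apply/card_gt0P; exists d.2.
rewrite (eq_bigr (fun=> 1)) ?sumr_const // => x; rewrite inE => deg_gt0.
rewrite (eq_bigr (fun=> (deg a x)%:R^-1)); last by move=> d /andP[_ /eqP->].
rewrite sumr_const -[LHS]mulr_natl [X in X%:R * _](_ : _ = deg a x).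
  by rewrite divff // pnatr_eq0 -lt0n.
rewrite /deg -(card_imset (a x) (f := pair x)); last by move=> y z [].
apply: eq_card => -[u v]; rewrite unfold_in /= /dart /=.
apply/andP/imsetP => [[auv /eqP <-]|[y xy [-> ->]]]; first by exists v.
by split.
Qed.

Let sum_faces : \sum_(d | dart a d) (flen d)%:R^-1 = #|roots|%:R :> R.
Proof.
rewrite (partition_big (froot face) (mem roots)) /=; last first.
  by move=> d dd; apply/imsetP; exists d; rewrite ?inE.
rewrite (eq_bigr (fun=> 1)) ?sumr_const // => _ /imsetP[d0 + ->]; rewrite inE => dd0.
have sym := fconnect_sym face_inj.
rewrite (eq_bigr (fun=> (flen d0)%:R^-1)); last first.
  move=> d /andP[_]; rewrite root_connect // => /(same_connect sym) E.
  by congr (_%:R^-1); apply: eq_card.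
rewrite sumr_const -[LHS]mulr_natl [X in X%:R * _](_ : _ = flen d0); last first.
  apply: eq_card => d; transitivity (dart a d && fconnect face d0 d).
    by rewrite [LHS]unfold_in root_connect // sym.
  transitivity (fconnect face d0 d); last by [].
  case: (boolP (fconnect face d0 d)) => [cd|]; rewrite ?andbF // andbT.
  by rewrite (invariant_fconnect (k := dart a) _ dd0 cd) ?dd0 // => d' _; exact: dart_face.
by rewrite divff ?pnatr_eq0 -?lt0n ?order_gt0.
Qed.

(** The vertex [d.1] and the face of [d] have their charges, degree minus 4 and
    length minus 4, spread evenly over their darts. *)
Lemma euler_charge : (exists d, dart a d) ->
  \sum_(d | dart a d) (2 - 4 / (deg a d.1)%:R - 4 / (flen d)%:R) <= - 8 :> R.
Proof.
move=> exd; rewrite !sumrB sumr_const -!mulr_sumr sum_nodes sum_faces.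
have -> : #|dart a| = #|darts| by apply: eq_card => d; rewrite inE.
have h1 : #|darts|%:R = 2 * #|half|%:R :> R by rewrite card_darts natrM.
have h2 : #|half|%:R + 2 <= #|V0|%:R + #|roots|%:R :> R.
  by rewrite -!natrD ler_nat euler_card.
rewrite -[2 *+ _]mulr_natr h1; lra.
Qed.

End Euler.

Definition restr (V : finType) (a : rel V) (W : {set V}) : rel V :=
  [rel x y | [&& a x y, x \in W & y \in W]].

(** * Maps of 2-connected graphs *)
Section TwoConnected.
Variables (V : finType) (a : rel V) (n : V * V -> V * V) (U : {set V}).
Hypotheses (a_sym : symmetric a) (a_irr : irreflexive a) (mapn : plane_map a n).
Hypothesis aU : forall x y, a x y -> x \in U.
Hypothesis conn2 : forall v p q, p \in U :\ v -> q \in U :\ v ->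
  connect (restr a (U :\ v)) p q.
Hypothesis U3 : 3 < #|U|.

Local Notation face := (face n).
Local Notation flen := (flen n).

Lemma restr_link W p q : connect (restr a W) p q ->
  connect (link fst (@swapd V) (fun d => restr a W d.1 d.2)) p q.
Proof.
apply: connect_sub => x y xy; apply: connect1; apply/existsP; exists (x, y).
by rewrite xy !eqxx.
Qed.

Lemma restr_sym W : symmetric (restr a W).
Proof. by move=> x y; rewrite /restr /= a_sym; congr (_ && _); rewrite andbC. Qed.

(** Removing [u] leaves a path from [x1] to [x2]; it closes up to an even set
    with exactly two darts at [u]. *)
Lemma cycle_through u x1 x2 : a u x1 -> a u x2 -> x1 != x2 ->
  exists C : V * V -> bool, [/\ forall d, C d -> dart a d,
    circulation fst (@swapd V) C &
    forall x, C (u, x) = (x == x1) || (x == x2)].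
Proof.
move=> a1 a2 ne.
have inW x : a u x -> x \in U :\ u.
  move=> ux; rewrite in_setD1 (aU (y := u)) 1?a_sym // andbT.
  by apply: contraTneq ux => ->; rewrite a_irr.
have [|||P [Psym PA Pb]] := path_flow (@swapdK V) (A := fun d => restr a (U :\ u) d.1 d.2)
    (p := x1) (q := x2) (src := fst).
- move=> d /and3P[ad _ _]; apply: contraTneq ad => E.
  by rewrite -[d.2]/((swapd d).1) E a_irr.
- by move=> d; apply: restr_sym.
- by apply: restr_link; apply: conn2; apply: inW.
have nP x : P (u, x) = false.
  by apply/negbTE/negP => /PA/and3P[_]; rewrite /= in_setD1 eqxx.
pose E x := fun d : V * V => pred1 (u, x) d (+) pred1 (x, u) d.
have Esym x d : E x (swapd d) = E x d.
  by rewrite /E /= !(can2_eq (@swapdK V) (@swapdK V)) addbC.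
have Eb x p : bnd fst (E x) p = (u == p) (+) (x == p).
  by rewrite bnd_add !bnd1.
have neu x : a u x -> (x == u) = false.
  by move=> ux; apply/negbTE; apply: contraTneq ux => ->; rewrite a_irr.
exists (fun d => P d (+) (E x1 d (+) E x2 d)); split=> [d /=||x /=].
- case: (boolP (P d)) => [/PA/and3P[]//|_] /=.
  rewrite /E /dart /=; have [->//|_] := eqVneq d (u, x1).
  have [->/=|_] := eqVneq d (x1, u); first by rewrite a_sym.
  have [->//|_] := eqVneq d (u, x2).
  by have [->/=|_] := eqVneq d (x2, u); first by rewrite a_sym.
- split=> [d|p]; first by rewrite Psym !Esym.
  rewrite bnd_add (bnd_add _ (E x1) (E x2)) !Eb Pb.
  by case: (u == p); case: (x1 == p); case: (x2 == p).
rewrite nP /E /= !xpair_eqE eqxx [u == x1]eq_sym [u == x2]eq_sym (neu _ a1) (neu _ a2) /= ?addbF.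
have [->|//] := eqVneq x x1; by rewrite (negPf ne).
Qed.

(** If the orbit of [d1] under the rotation missed [d2], then the face set
    bounded by a cycle through both would change once only along this orbit. *)
Lemma node_trans d1 d2 : dart a d1 -> dart a d2 -> d1.1 = d2.1 -> fconnect n d1 d2.
Proof.
case: d1 d2 => [u x1] [u' x2] /= a1 a2 E; subst u'.
have [->|ne] := eqVneq x1 x2; first exact: connect0.
apply/negPn/negP => nc.
have [C [CD Ccirc Cu]] := cycle_through a1 a2 ne.
have [lam lamP] := map_jordan mapn CD Ccirc.
have step k : k < order n (u, x1) ->
    lam (iter k.+1 n (u, x1)) = ~~ lam (u, x1).
  elim: k => [|k IHk] lt_k.
    by have [-> _] := lamP _ a1; rewrite Cu eqxx addbT.
  have dk : forall j, dart a (iter j n (u, x1)) /\ (iter j n (u, x1)).1 = u.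
    by elim=> //= j [h1 h2]; rewrite (map_dart mapn) (map_src mapn).
  rewrite iterS; have [-> _] := lamP _ (dk k.+1).1.
  rewrite IHk ?(ltnW lt_k) //; have := (dk k.+1).2.
  case E: (iter k.+1 n (u, x1)) => [u' x] /= uE; subst u'; rewrite Cu.
  have [xE|_] := eqVneq x x1; last have [xE|_] := eqVneq x x2; last by rewrite addbF.
    have := findex_iter lt_k; rewrite E xE => h.
    by have := findex0 n (u, x1); rewrite h.
  by case/negP: nc; rewrite -xE -E; apply: fconnect_iter.
have := step (order n (u, x1)).-1; rewrite orderSpred leqnn => /(_ isT).
rewrite (iter_order (map_inj mapn)); by case: (lam _).
Qed.

Lemma order_node d : dart a d -> order n d = deg a d.1.
Proof.
move=> dd; rewrite /order /deg -(card_imset (a d.1) (f := pair d.1)); last first.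
  by move=> y z [].
apply: eq_card => d'; rewrite unfold_in; apply/idP/imsetP => [/iter_findex <-|].
  have [h1 h2] : dart a (iter (findex n d d') n d) /\ (iter (findex n d d') n d).1 = d.1.
    by elim: (findex n d d') => //= j [h1 h2]; rewrite (map_dart mapn) (map_src mapn).
  exists (iter (findex n d d') n d).2; last by rewrite -h2 -surjective_pairing.
  by rewrite unfold_in -h2.
by case=> y dy ->; apply: node_trans.
Qed.

(** A face that leaves [u] twice would lie on both sides of a cycle that uses
    these two darts. *)
Lemma face_simple d1 d2 : dart a d1 -> d1.1 = d2.1 -> fconnect face d1 d2 -> d1 = d2.
Proof.
move=> dd1 E fc; have dd2 : dart a d2.
  rewrite (invariant_fconnect a_sym mapn (k := dart a) _ dd1 fc) //.
  by move=> d _; apply: (dart_face a_sym mapn).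
apply/eqP/negPn/negP => ne.
case: d1 d2 => [u x1] [u' x2] /= in dd1 dd2 E fc ne *; subst u'.
have nex : x1 != x2 by apply: contra ne => /eqP->.
have [C [CD Ccirc Cu]] := cycle_through dd1 dd2 nex.
have [lam lamP] := map_jordan mapn CD Ccirc.
have lamface : lam (u, x2) = lam (u, x1).
  apply: (invariant_fconnect a_sym mapn _ dd1 fc) => d dd.
  have [_ h1] := lamP _ dd; have ds : dart a (swapd d) by rewrite dart_swapd.
  by have [-> _] := lamP _ ds; rewrite h1 Ccirc.1 -addbA addbb addbF.
have nc := node_trans dd1 dd2 erefl; have idx := iter_findex nc.
have le_idx := findex_max nc.
have idx0 : 0 < findex n (u, x1) (u, x2) by rewrite lt0n findex_eq0.
have step k : k < findex n (u, x1) (u, x2) -> lam (iter k.+1 n (u, x1)) = ~~ lam (u, x1).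
  elim: k => [|k IHk] lt_k.
    by have [-> _] := lamP _ dd1; rewrite Cu eqxx addbT.
  have dk : forall j, dart a (iter j n (u, x1)) /\ (iter j n (u, x1)).1 = u.
    by elim=> //= j [h1 h2]; rewrite (map_dart mapn) (map_src mapn).
  rewrite iterS; have [-> _] := lamP _ (dk k.+1).1.
  rewrite IHk ?(ltnW lt_k) //; have := (dk k.+1).2.
  have lt_k' := ltn_trans lt_k le_idx.
  case Ek: (iter k.+1 n (u, x1)) => [u' x] /= uE; subst u'; rewrite Cu.
  have [xE|_] := eqVneq x x1; last have [xE|_] := eqVneq x x2; last by rewrite addbF.
    have := findex_iter lt_k'; rewrite Ek xE => h.
    by have := findex0 n (u, x1); rewrite h.
  have := findex_iter lt_k'; rewrite Ek xE => h.
  by rewrite h ltnn in lt_k.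
have := step (findex n (u, x1) (u, x2)).-1; rewrite prednK // leqnn => /(_ isT).
by rewrite idx lamface; case: (lam _).
Qed.

Lemma flen_face d : flen (face d) = flen d.
Proof.
by apply: eq_card => d'; symmetry; apply: (same_fconnect1 (face_inj mapn)).
Qed.

Lemma deg_ge2 x y : a x y -> 1 < deg a x.
Proof.
move=> xy; rewrite ltnNge; apply/negP => le1.
have only z : a x z -> z = y.
  by move=> xz; apply: (card_le1_eqP le1).
have : 0 < #|U :\: [set x; y]|.
  rewrite cardsD subn_gt0; apply: leq_ltn_trans (ltnW U3).
  apply: leq_trans (subset_leq_card (subsetIr _ _)) _; rewrite cards2.
  by case: (_ == _).
case/card_gt0P=> z; rewrite !inE negb_or => /andP[/andP[zx zy] zU].
have /connectP[[|p s] /=] : connect (restr a (U :\ y)) x z.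
  apply: conn2; rewrite in_setD1 ?zy ?zU // (aU xy) andbT.
  by apply: contraTneq xy => ->; rewrite a_irr.
  by move=> _ zE; rewrite zE eqxx in zx.
case/andP=> /and3P[/only -> _]; by rewrite in_setD1 eqxx.
Qed.

Lemma flen_ge3 d : dart a d -> 2 < flen d.
Proof.
move=> dd; rewrite /flen; have ford := iter_order (face_inj mapn) d.
have := order_gt0 face d; case E: (order face d) ford => [|[|[|k]]] //=.
  move=> h; move: dd; rewrite /dart -{1}h (face_src mapn) a_irr //.
move=> h _; have fd : face d = swapd d.
  have h1 : (face d).1 = d.2 by rewrite (face_src mapn).
  have h2 : (face d).2 = d.1 by rewrite -(face_src mapn) h.
  by rewrite (surjective_pairing (face d)) h1 h2.
have dsd : dart a (swapd d) by rewrite dart_swapd.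
have := order_node dsd; rewrite (_ : order n (swapd d) = 1).
  by have := deg_ge2 dsd; case: (deg a _) => [|[|]].
apply/eqP; rewrite eqn_leq order_gt0 andbT; rewrite leqNgt; apply/negP => gt1.
have := findex_iter gt1; rewrite /= -/(face d) fd.
by rewrite findex0.
Qed.

(** The triangle bounds a set of faces; the rest of the graph is connected, so
    it lies on one side. A face on the other side only visits the three vertices
    of the triangle. *)
Lemma facial_triangle u v w :
    a u v -> a v w -> a u w ->
    (forall p q, p \in U :\: [set u; v; w] -> q \in U :\: [set u; v; w] ->
       connect (restr a (U :\: [set u; v; w])) p q) ->
  n (u, v) = (u, w) /\ flen (u, w) = 3 \/ n (u, w) = (u, v) /\ flen (u, v) = 3.
Proof.
move=> uv vw uw conn3; set K := [set u; v; w] in conn3.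
have neq x y : a x y -> x != y by apply: contraTneq => ->; rewrite a_irr.
have uK : u \in K by rewrite !inE eqxx.
have vK : v \in K by rewrite !inE eqxx orbT.
have wK : w \in K by rewrite !inE eqxx orbT.
have neuv := neq _ _ uv; have nevw := neq _ _ vw; have neuw := neq _ _ uw.
have Kadj x y : x \in K -> y \in K -> x != y -> a x y.
  rewrite !inE -!orbA => /or3P[]/eqP-> /or3P[]/eqP->; rewrite ?eqxx // => _;
    by rewrite // a_sym.
pose C d := [&& d.1 \in K, d.2 \in K & d.1 != d.2].
have CD d : C d -> dart a d by case/and3P; apply: Kadj.
have Ccirc : circulation fst (@swapd V) C.
  split=> [d|p].
    by rewrite /C /= eq_sym; case: (d.1 \in K); case: (d.2 \in K).
  case: (boolP (p \in K)) => pK; last first.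
    by rewrite /bnd big1 // => d /eqP dp; rewrite /C dp (negPf pK).
  have -> : bnd fst C p = \big[addb/false]_(y in K) (p != y).
    rewrite /bnd [RHS]big_mkcond (reindex_onto (pair p) snd) /=; last first.
      by case=> x y /= /eqP->.
    apply: eq_big => y; first by rewrite !eqxx.
    by rewrite /C /= pK; case: (y \in K).
  rewrite /K -setUA !big_setU1 /= ?big_set1 ?inE ?negb_or ?neuv ?neuw //.
  move: pK; rewrite !inE -orbA => /or3P[]/eqP->; rewrite eqxx ?neuv ?nevw ?neuw //.
    by rewrite [v == u]eq_sym neuv.
  by rewrite [w == u]eq_sym neuw [w == v]eq_sym nevw.
have [lam lamP] := map_jordan mapn CD Ccirc.
have [z zK] : exists z, z \in U :\: K.
  apply/card_gt0P; rewrite cardsD subn_gt0.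
  apply: leq_ltn_trans U3; apply: leq_trans (subset_leq_card (subsetIr _ _)) _.
  by rewrite /K -setUA cardsU1 cards2; case: (_ \notin _); case: (_ != _).
have [y zy] : exists y, a z y.
  have [/eqP Uz|[y]] := set_0Vmem (U :\: K :\ z).
    have : u \in U :\ z by rewrite in_setD1 (aU uv) andbT; apply: contraTneq zK => <-; rewrite in_setD uK.
    have zUu : z \in U :\ u by rewrite in_setD1; move: zK; rewrite in_setD => /andP[zK ->]; rewrite andbT; apply: contraNneq zK => ->.
    move=> _; have vUu : v \in U :\ u by rewrite in_setD1 eq_sym neuv (aU vw).
    case/connectP: (conn2 zUu vUu) => [[|p s] /=]; last by case/andP=> /and3P[zp _ _]; exists p.
    by move=> _ zv; move: zK; rewrite in_setD -zv vK.
  rewrite in_setD1 => /andP[yz yK]; case/connectP: (conn3 _ _ zK yK) => [[|p s] /=].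
    by move=> _ E; rewrite E eqxx in yz.
  by case/andP=> /and3P[zp _ _]; exists p.
(* The side that contains the rest of the graph. *)
pose l := lam (z, y).
have out d : dart a d -> d.1 \notin K -> lam d = l.
  have node d1 d2 : dart a d1 -> dart a d2 -> d1.1 = d2.1 -> d1.1 \notin K -> lam d2 = lam d1.
    move=> dd1 dd2 E nK; have /iter_findex <- := node_trans dd1 dd2 E.
    elim: (findex n d1 d2) => //= j <-.
    have [h1 h2] : dart a (iter j n d1) /\ (iter j n d1).1 = d1.1.
      by elim: j => //= j [h1 h2]; rewrite (map_dart mapn) (map_src mapn).
    by have [-> _] := lamP _ h1; rewrite /C h2 (negPf nK) addbF.
  move=> dd nK; have d1K : d.1 \in U :\: K by rewrite in_setD nK (aU dd).
  have /connectP[s] := conn3 _ _ zK d1K.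
  elim: s d dd {d1K} nK z y zy zK @l => [|p s IHs] d dd nK z y zy zK l /=.
    by move=> _ E; apply: (node (z, y)) => //; rewrite -E.
  case/andP=> /and3P[zp _ pK] ps E.
  rewrite (IHs d dd nK p z _ pK ps E); last by rewrite a_sym.
  have dzp : dart a (z, p) by [].
  have [_ /= ->] := lamP _ dzp; rewrite /C /=.
  move: (zK); rewrite in_setD => /andP[/negPf zK' _]; rewrite zK' addbF.
  by apply: (node (z, y)); rewrite //= zK'.
have main x1 x2 : a x1 x2 -> x1 \in K -> x2 \in K -> lam (x1, x2) != l -> flen (x1, x2) = 3
    /\ exists x3, [/\ x3 \in K, face (x1, x2) = (x2, x3), face (x2, x3) = (x3, x1),
      face (x3, x1) = (x1, x2) & x3 != x1 /\ x3 != x2].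
  move=> a12 x1K x2K nl.
  pose F j := iter j face (x1, x2).
  have FD j : dart a (F j) by elim: j => //= j; rewrite (dart_face a_sym mapn).
  have Fl j : lam (F j) = lam (x1, x2).
    elim: j => //= j <-; have [_ h1] := lamP _ (FD j).
    have ds : dart a (swapd (F j)) by rewrite dart_swapd.
    by have [-> _] := lamP _ ds; rewrite h1 Ccirc.1 -addbA addbb addbF.
  have FK j : (F j).1 \in K.
    by apply/negPn/negP => /(out _ (FD j)); rewrite Fl => E; rewrite E eqxx in nl.
  have F12 j : (F j).2 = (F j.+1).1 by rewrite /F iterS (face_src mapn).
  have le3 : flen (x1, x2) <= 3.
    rewrite leqNgt; apply/negP => gt3.
    have cardK : #|K| <= 3.
      by rewrite /K -setUA cardsU1 cards2; case: (_ \notin _); case: (_ != _).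
    have inj : {in gtn 4 &, injective (fun j : nat => (F j).1)}.
      move=> i j; rewrite !inE => lti ltj E.
      have lti' := leq_trans lti gt3; have ltj' := leq_trans ltj gt3.
      have EF : F i = F j.
        apply: face_simple => //; apply: (connect_trans (y := (x1, x2))).
          by rewrite (fconnect_sym (face_inj mapn)); apply: fconnect_iter.
        exact: fconnect_iter.
      by have := findex_iter lti'; rewrite -/(F i) EF (findex_iter ltj').
    have : 4 <= #|K|.
      have u4 : uniq [seq (F j).1 | j <- iota 0 4].
        rewrite map_inj_in_uniq ?iota_uniq // => i j.
        by rewrite !mem_iota; apply: inj.
      have := card_uniqP u4; rewrite size_map size_iota => <-.
      apply: subset_leq_card; apply/subsetP => _ /mapP[j _ ->]; exact: FK.
    by rewrite leqNgt ltnS cardK.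
  have f3 : flen (x1, x2) = 3.
    by apply/eqP; rewrite eqn_leq le3 flen_ge3.
  split=> //; have ford : F 3 = (x1, x2).
    by rewrite /F -[X in iter X]f3 (iter_order (face_inj mapn)).
  exists (F 1).2.
  have E1 : F 1 = (x2, (F 1).2).
    by rewrite [LHS]surjective_pairing; congr pair; rewrite -(F12 0).
  have E2 : F 2 = ((F 1).2, x1).
    by rewrite [LHS]surjective_pairing (F12 1) (F12 2) ford.
  split=> //; first by rewrite (F12 1).
  - by rewrite -{1}E1.
  - by rewrite -E2.
  have := FD 1; have := FD 2; rewrite E1 E2 /dart /= => h1 h2.
  by split; apply: neq => //; rewrite a_sym.
have K3 s t : s \in K -> t \in K -> s != t ->
    forall r, r \in K -> r != s -> r != t ->
    forall r', r' \in K -> r' != s -> r' != t -> r = r'.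
  clear -K neuv nevw neuw; rewrite /K; move=> hs ht ne r hr n1 n2 r' hr' m1 m2.
  move: hs ht hr hr' ne n1 n2 m1 m2; rewrite !inE -!orbA.
  by move=> /or3P[]/eqP-> /or3P[]/eqP-> /or3P[]/eqP-> /or3P[]/eqP->; rewrite ?eqxx.
have duv : dart a (u, v) by [].
have [_ /= lvu] := lamP _ duv; rewrite /C /= uK vK neuv addbT in lvu.
case: (eqVneq (lam (u, v)) l) => E.
  left; have [||f3 [x3 [x3K f1 _ _ [n1 n2]]]] := main v u _ vK uK.
  - by rewrite a_sym.
  - by rewrite lvu E; case: (l).
  have wE : w = x3 by apply: (K3 v u) => //; rewrite eq_sym.
  rewrite wE; have fE : n (u, v) = (u, x3) by rewrite -f1.
  by split=> //; rewrite -fE -f3 (flen_face (v, u)).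
right; have [f3 [x3 [x3K f1 f2 f4 [n1 n2]]]] := main u v uv uK vK E.
have -> : w = x3 by apply: (K3 u v) => //; rewrite eq_sym.
by split.
Qed.

End TwoConnected.

(** * Minimal fragments *)
Section Fragments.
Variables (V : finType) (b : rel V).
Hypotheses (b_sym : symmetric b) (b_irr : irreflexive b).

Definition clique (K : {set V}) : bool :=
  [forall x in K, forall y in K, (x != y) ==> b x y].

Lemma cliqueP (K : {set V}) : reflect {in K &, forall x y, x != y -> b x y} (clique K).
Proof.
apply: (iffP forall_inP) => [h x y xK yK|h x xK].
  by move/forall_inP: (h x xK) => /(_ y yK)/implyP.
by apply/forall_inP => y yK; apply/implyP; apply: h.
Qed.

Lemma clique_sub (K K' : {set V}) : K \subset K' -> clique K' -> clique K.
Proof. by move=> /subsetP s /cliqueP h; apply/cliqueP => x y /s ? /s ?; apply: h. Qed.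

Definition nbh (x : V) : {set V} := [set y | b x y].

Fact hubs_key : unit. Proof. exact: tt. Qed.
(** The neighbourhood of a hub is a triangle that separates it from the rest.
    Cutting along it leaves a single vertex with three roots, a piece too small
    for a contradiction, so these triangles are exempted from minimality. *)
Definition hubs : {set V} :=
  locked_with hubs_key [set x | (#|nbh x| == 3) && clique (nbh x)].

Lemma in_hubs x : (x \in hubs) = (#|nbh x| == 3) && clique (nbh x).
Proof. by rewrite /hubs locked_withE inE. Qed.

Lemma hub_clique x y z : x \in hubs -> b x y -> b x z -> y != z -> b y z.
Proof.
by rewrite in_hubs => /andP[_ /cliqueP h] xy xz; apply: h; rewrite inE.
Qed.

Lemma hub_deg x : x \in hubs -> #|nbh x| = 3.
Proof. by rewrite in_hubs => /andP[/eqP]. Qed.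

Hypothesis hub_indep : forall x y, x \in hubs -> b x y -> y \notin hubs.

(** The roots [Q] are the only vertices of [U] that may have lost neighbours.
    The core vertex ensures that minimal fragments do not degenerate to a hub
    and its neighbours. *)
Record fragment (U Q : {set V}) : Prop := Fragment {
  frag_sub : Q \subset U;
  frag_hub : forall q, q \in Q -> q \notin hubs;
  frag_clique : clique Q;
  frag_card : #|Q| <= 3;
  frag_closed : forall c y, c \in U -> c \notin Q -> b c y -> y \in U;
  frag_pos : forall c, c \in U -> c \notin Q -> exists y, b c y;
  frag_core : exists c, [/\ c \in U, c \notin Q & c \notin hubs] }.

Section Minimal.
Variables U Q : {set V}.
Hypothesis fragU : fragment U Q.
Hypothesis minU : forall U' Q', fragment U' Q' -> #|U| <= #|U'|.

Lemma frag_closed_hub x y : x \in U -> x \in hubs -> b x y -> y \in U.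
Proof.
move=> xU xX; apply: (frag_closed fragU) => //.
by apply: contraL xX; apply: (frag_hub fragU).
Qed.

(** A hub all of whose neighbours are roots could be deleted. *)
Lemma hub_core x : x \in U -> x \in hubs ->
  exists c, [/\ c \in U, c \notin Q, c \notin hubs & b x c].
Proof.
move=> xU xX; case: (boolP [exists c, [&& c \in U, c \notin Q, c \notin hubs & b x c]]).
  by case/existsP=> c /and4P[? ? ? ?]; exists c.
move/existsPn=> no; have [s h k q cl ps [c0 [c1 c2 c3]]] := fragU.
have xQ : x \notin Q by apply: contraL xX; apply: h.
have : #|U| <= #|U :\ x|; last by rewrite [#|U|](cardsD1 x) xU ltnn.
apply: (minU (Q' := Q)); split=> //.
- apply/subsetP => y yQ; rewrite in_setD1 (subsetP s) // andbT.
  by apply: contraNneq xQ => <-.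
- move=> c y; rewrite !in_setD1 => /andP[cx cU] cQ cy; rewrite (cl c y) // andbT.
  apply: contraTneq cy => ->; apply: contra (no c) => cx'.
  rewrite cU cQ b_sym cx' !andbT; apply: hub_indep xX _.
  by rewrite b_sym.
- by move=> c; rewrite in_setD1 => /andP[_]; apply: ps.
exists c0; split=> //; rewrite in_setD1 c1 andbT.
by apply: contraNneq c3 => ->.
Qed.

(** A root with no neighbour in the core could be deleted. *)
Lemma frag_attach q : q \in Q -> exists c, [/\ c \in U, c \notin Q, c \notin hubs & b q c].
Proof.
move=> qQ; case: (boolP [exists c, [&& c \in U, c \notin Q, c \notin hubs & b q c]]).
  by case/existsP=> c /and4P[? ? ? ?]; exists c.
move/existsPn=> no; have [s h k qc cl ps [c0 [c1 c2 c3]]] := fragU.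
have qU := subsetP s q qQ.
have : #|U| <= #|U :\ q|; last by rewrite [#|U|](cardsD1 q) qU ltnn.
apply: (minU (Q' := Q :\ q)); split=> //.
- exact: setSD.
- by move=> y; rewrite in_setD1 => /andP[_]; apply: h.
- by apply: clique_sub k; apply: subD1set.
- by apply: leq_trans qc; rewrite subset_leq_card ?subD1set.
- move=> c y; rewrite !in_setD1 negb_and negbK => /andP[cq cU].
  rewrite (negPf cq) /= => cQ cy; rewrite (cl c y) // andbT.
  apply: contraTneq cy => ->; apply/negP => cq'.
  case: (boolP (c \in hubs)) => cX; last first.
    by have /negP[] := no c; rewrite cU cQ cX b_sym cq'.
  have [c' [c'U c'Q c'X cc']] := hub_core cU cX.
  have /negP[] := no c'; rewrite c'U c'Q c'X; apply: hub_clique cX cq' cc' _.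
  by apply: contraNneq c'Q => <-.
- move=> c; rewrite !in_setD1 negb_and negbK => /andP[/negPf-> cU] /=.
  exact: ps.
exists c0; rewrite !in_setD1 negb_and negbK c1 c2 c3 orbT andbT; split=> //.
by apply: contraNneq c2 => ->.
Qed.

(* A component of the core minus a clique [K] that misses the roots, together
   with the hubs attached to it and with [K] as the new roots, is a smaller
   fragment. *)
Let frag_comp (K : {set V}) r0 r1 :
    K \subset U -> (forall x, x \in K -> x \notin hubs) -> clique K -> #|K| <= 3 ->
    let W := (U :\: hubs) :\: K in
    r0 \in W -> r1 \in W -> ~~ connect (restr b W) r0 r1 ->
    (forall q, q \in Q -> q \notin K -> ~~ connect (restr b W) r0 q) -> False.
Proof.
move=> KU KX Kc K3 W r0W r1W nc noQ.
pose B := [set r in W | connect (restr b W) r0 r].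
pose Y := [set x in U :&: hubs | [exists c in B, b x c]].
have YE x : (x \in Y) = [&& x \in U, x \in hubs & [exists c in B, b x c]].
  by rewrite inE in_setI andbA.
have BW c : c \in B -> [/\ c \in U, c \notin hubs, c \notin K & c \notin Q].
  rewrite !inE => /andP[/and3P[cK cX cU] cc]; rewrite cU cK; split=> //.
  by apply: contraL cc => /noQ; apply.
have Badj c y : c \in B -> y \in W -> b c y -> y \in B.
  rewrite inE => /andP[cW cc] yW cy; rewrite inE yW; apply: connect_trans cc _.
  by apply: connect1; rewrite /restr /= cy cW yW.
have : #|U| <= #|K :|: (B :|: Y)|.
  apply: (minU (Q' := K)); split=> //; first exact: subsetUl.
    move=> c y; rewrite !in_setU => /orP[-> //|cBY] cK cy.
    have yU : y \in U.
      case/orP: cBY => [cB|]; last first.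
        by rewrite YE => /and3P[cU cX _]; apply: (frag_closed_hub cU cX cy).
      by have [cU _ _ cQ] := BW _ cB; apply: (frag_closed fragU) cy.
    case: (boolP (y \in K)) => //= yK; apply/orP.
    case: (boolP (y \in hubs)) => yX.
      right; rewrite YE yU yX /=; case/orP: cBY => [cB|].
        by apply/existsP; exists c; rewrite cB b_sym.
      by rewrite YE => /and3P[_ cX _]; have := hub_indep cX cy; rewrite yX.
    left; have yW : y \in W by rewrite !in_setD yK yX.
    case/orP: cBY => [cB|]; first exact: Badj yW cy.
    rewrite YE => /and3P[_ cX /existsP[c' /andP[c'B cc']]].
    have [->//|ne] := eqVneq y c'; apply: (Badj c') => //.
    by apply: hub_clique cX cc' cy _; rewrite eq_sym.
    move=> c; rewrite !in_setU => /orP[-> //|/orP[/BW[cU _ _ cQ] _|]].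
      exact: (frag_pos fragU).
    rewrite YE => /and3P[cU cX _] _; apply: (frag_pos fragU) => //.
    by apply: contraL cX; apply: (frag_hub fragU).
  have r0B : r0 \in B by rewrite inE r0W connect0.
  exists r0; have [? ? ? ?] := BW _ r0B; split=> //.
  by rewrite !in_setU r0B orbT.
rewrite leqNgt => /negP[]; apply: proper_card; apply/properP; split.
  apply/subsetP => y; rewrite !in_setU => /or3P[/(subsetP KU)//|/BW[]//|].
  by rewrite YE => /andP[].
have r1B : r1 \notin B by rewrite inE r1W (negPf nc).
move: r1W; rewrite !in_setD => /and3P[r1K r1X r1U]; exists r1 => //.
by rewrite !in_setU YE (negPf r1K) (negPf r1B) (negPf r1X) andbF.
Qed.

(** If the clique [K] separated [p] from [q], then the remaining roots, being
    pairwise adjacent, would lie on one side at most, and the other side would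
    give a smaller fragment. *)
Lemma frag_conn_core (K : {set V}) :
    K \subset U -> (forall x, x \in K -> x \notin hubs) -> clique K -> #|K| <= 3 ->
    let W := (U :\: hubs) :\: K in
  forall p q, p \in W -> q \in W -> connect (restr b W) p q.
Proof.
move=> KU KX Kc K3 W p q pW qW; apply/negPn/negP => nc.
have csym : connect_sym (restr b W).
  by apply: sym_connect_sym; apply: restr_sym.
case: (boolP [exists r in Q, (r \notin K) && connect (restr b W) p r]).
  case/existsP=> r /and3P[rQ rK pr].
  apply: (frag_comp KU KX Kc K3 qW pW); first by rewrite csym.
  move=> r' r'Q r'K; apply: contra nc => qr'.
  apply: connect_trans pr _; rewrite csym; apply: connect_trans qr' _.
  have rW s : s \in Q -> s \notin K -> s \in W.
    move=> sQ sK; rewrite !in_setD sK (subsetP (frag_sub fragU)) // andbT.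
    exact: (frag_hub fragU sQ).
  have [->|ne] := eqVneq r' r; first exact: connect0.
  apply: connect1; rewrite /restr /= !rW // !andbT.
  by apply: (cliqueP _ (frag_clique fragU)).
move/existsPn => no; apply: (frag_comp KU KX Kc K3 pW qW nc) => r rQ rK.
by have := no r; rewrite rQ rK.
Qed.

(** Hubs outside [K] stay attached to the core. *)
Lemma frag_conn (K : {set V}) :
    K \subset U -> clique (K :\: hubs) -> #|K :\: hubs| <= 3 ->
    (forall x, x \in U :&: hubs -> x \notin K -> ~~ (nbh x \subset K)) ->
  forall p q, p \in U :\: K -> q \in U :\: K -> connect (restr b (U :\: K)) p q.
Proof.
move=> KU Kc K3 Khub.
have csym : connect_sym (restr b (U :\: K)).
  by apply: sym_connect_sym; apply: restr_sym.
pose W := (U :\: hubs) :\: (K :\: hubs).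
have WE x : (x \in W) = [&& x \in U, x \notin K & x \notin hubs].
  by rewrite !in_setD; case: (x \in hubs); case: (x \in K); case: (x \in U).
have coreW p : p \in U :\: K -> exists2 p', p' \in W & connect (restr b (U :\: K)) p p'.
  rewrite in_setD => /andP[pK pU]; case: (boolP (p \in hubs)) => pX; last first.
    by exists p; rewrite ?WE ?pU ?pK.
  have /subsetPn[y + yK] : ~~ (nbh p \subset K) by apply: Khub; rewrite ?in_setI ?pU.
  rewrite inE => py; have yU := frag_closed_hub pU pX py.
  exists y; first by rewrite WE yU yK (hub_indep pX py).
  by apply: connect1; rewrite /restr /= py !in_setD pK pU yK yU.
have conW p q : p \in W -> q \in W -> connect (restr b (U :\: K)) p q.
  have KXU : K :\: hubs \subset U by apply: subset_trans (subsetDl _ _) KU.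
  have KX x : x \in K :\: hubs -> x \notin hubs by rewrite in_setD => /andP[].
  move=> pW qW; apply: connect_sub (frag_conn_core KXU KX Kc K3 pW qW) => x y.
  rewrite /restr /= !WE => /and3P[xy /and3P[xU xK _] /and3P[yU yK _]].
  by apply: connect1; rewrite /= xy !in_setD xU xK yU yK.
move=> p q pUK qUK; have [p' p'W pp'] := coreW _ pUK; have [q' q'W qq'] := coreW _ qUK.
apply: connect_trans pp' _; rewrite csym; apply: connect_trans qq' _.
by rewrite csym; apply: conW.
Qed.

Lemma frag_conn1 v p q : v \in U -> p \in U :\ v -> q \in U :\ v ->
  connect (restr b (U :\ v)) p q.
Proof.
move=> vU; have eU : U :\ v = U :\: [set v] by [].
apply: frag_conn.
- by rewrite sub1set.
- apply/cliqueP => x y; rewrite !inE => /andP[_ /eqP->] /andP[_ /eqP->].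
  by rewrite eqxx.
- apply: leq_trans (subset_leq_card (subsetDl _ _)) _; by rewrite cards1.
move=> x; rewrite in_setI => /andP[_ /hub_deg d3] _; apply/negP => /subset_leq_card.
by rewrite d3 cards1.
Qed.

Lemma frag_conn3 u v w : u \in U -> v \in U -> w \in U ->
    b u v -> b v w -> b u w ->
    (exists2 x, x \in U :&: hubs & nbh x = [set u; v; w]) \/
  forall p q, p \in U :\: [set u; v; w] -> q \in U :\: [set u; v; w] ->
     connect (restr b (U :\: [set u; v; w])) p q.
Proof.
move=> uU vU wU uv vw uw; set K := [set u; v; w].
have cardK : #|K| <= 3.
  by rewrite /K -setUA cardsU1 cards2; case: (_ \notin _); case: (_ != _).
case: (boolP [exists x in U :&: hubs, nbh x == K]) => [/existsP[x /andP[xX /eqP e]]|no].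
  by left; exists x.
right; apply: frag_conn.
- by apply/subsetP => y; rewrite !inE -orbA => /or3P[]/eqP->.
- apply: clique_sub (subsetDl _ _) _; apply/cliqueP => x y; rewrite !inE -!orbA.
  by move=> /or3P[]/eqP-> /or3P[]/eqP->; rewrite ?eqxx // b_sym.
- exact: leq_trans (subset_leq_card (subsetDl _ _)) cardK.
move=> x xUX xK; apply/negP => sub; move/existsPn: no => /(_ x); rewrite xUX /=.
case/negP; rewrite eqEcard sub; apply: leq_trans cardK _.
by move: xUX; rewrite in_setI => /andP[_ /hub_deg->].
Qed.

End Minimal.

Lemma minimal_fragment U0 Q0 : fragment U0 Q0 ->
  exists U Q, fragment U Q /\ forall U' Q', fragment U' Q' -> #|U| <= #|U'|.
Proof.
move=> f0; have exk : exists k, [exists U : {set V}, exists Q : {set V},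
   (#|U| == k) && (boolp.asbool (fragment U Q))].
  by exists #|U0|; apply/existsP; exists U0; apply/existsP; exists Q0;
     rewrite eqxx; apply/boolp.asboolP.
case: (ex_minnP exk) => k /existsP[U /existsP[Q /andP[/eqP Uk /boolp.asboolP f]]] kmin.
exists U, Q; split=> // U' Q' f'; rewrite Uk; apply: kmin.
by apply/existsP; exists U'; apply/existsP; exists Q'; rewrite eqxx; apply/boolp.asboolP.
Qed.

End Fragments.

(** What discharging needs to know of a minimal fragment: [a] is the graph
    induced on [U], [n] its rotation system, [Q] the set of roots and [X] the
    set of hubs. Every triangle is a face unless it surrounds a hub. *)
Record frag_map (V : finType) (a : rel V) (n : V * V -> V * V) (U Q X : {set V}) :
    Prop := FragMap {
  fm_sym : symmetric a;
  fm_irr : irreflexive a;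
  fm_map : plane_map a n;
  fm_in : forall x y, a x y -> x \in U;
  fm_conn2 : forall v p q, p \in U :\ v -> q \in U :\ v ->
    connect (restr a (U :\ v)) p q;
  fm_card : 3 < #|U|;
  fm_sub : Q \subset U;
  fm_Q3 : #|Q| <= 3;
  fm_clique : forall p q, p \in Q -> q \in Q -> p != q -> a p q;
  fm_attach : forall q, q \in Q -> exists c, [/\ a q c, c \notin Q & c \notin X];
  fm_hubQ : forall x, x \in X -> x \notin Q;
  fm_hub : forall x, x \in X -> deg a x = 3 /\
    forall y z, a x y -> a x z -> y != z -> a y z;
  fm_indep : forall x y, x \in X -> a x y -> y \notin X;
  fm_tri : forall u v w, a u v -> a v w -> a u w ->
    (exists2 x, x \in X & forall y, a x y = (y \in [set u; v; w])) \/
    (n (u, v) = (u, w) /\ flen n (u, w) = 3 \/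
     n (u, w) = (u, v) /\ flen n (u, v) = 3);
  fm_core : forall K : {set V}, K \subset U -> (forall x, x \in K -> x \notin X) ->
    clique a K -> #|K| <= 3 ->
    forall p q, p \in (U :\: X) :\: K -> q \in (U :\: X) :\: K ->
      connect (restr a ((U :\: X) :\: K)) p q }.

(** The whole graph without roots is a fragment, so there is a minimal one. *)
Lemma frag_map_exists (V : finType) (b : rel V) :
    symmetric b -> irreflexive b -> grid_model b ->
    (forall x y, b x y -> 3 <= deg b x) ->
    (forall x y, x \in hubs b -> b x y -> y \notin hubs b) ->
    (exists x y, b x y) ->
  exists (U Q X : {set V}) n, let a := restr b U in
    [/\ frag_map a n U Q X, forall c, c \in U -> c \notin Q -> deg a c = deg b c,
        forall x, x \in X -> x \in hubs b
      & forall x, x \in U -> x \in hubs b -> x \in X].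
Proof.
move=> bs bi gm dmin hub [x0 [y0 xy0]].
have degE x : deg b x = #|nbh b x| by rewrite /deg /nbh cardsE.
have f0 : fragment b [set x | 0 < deg b x] set0.
  split=> //; rewrite ?sub0set ?cards0 //.
  - by move=> q; rewrite inE.
  - by apply/cliqueP => x y; rewrite inE.
  - move=> c y _ _ cy; rewrite inE; apply/card_gt0P; exists c.
    by rewrite unfold_in bs.
  - by move=> c; rewrite inE => /card_gt0P[y]; exists y.
  have pos x y : b x y -> x \in [set x | 0 < deg b x].
    by move=> xy; rewrite inE; apply/card_gt0P; exists y.
  case: (boolP (x0 \in hubs b)) => [x0X|x0X]; last first.
    by exists x0; rewrite (pos _ _ xy0) inE.
  exists y0; rewrite (pos y0 x0) 1?bs // inE; split=> //.
  exact: hub x0X xy0.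
have [U [Q [fU minU]]] := minimal_fragment f0.
pose a := restr b U.
have as_ : symmetric a by apply: restr_sym.
have ai : irreflexive a by move=> x; rewrite /a /restr /= bi.
have [n mapn] : exists n, plane_map a n.
  apply: plane_map_of_grid => //; apply: grid_model_sub gm => x y /and3P[] //.
have restrE (W : {set V}) x y : W \subset U -> restr a W x y = restr b W x y.
  move=> WU; rewrite /a /restr /=; case: (boolP (x \in W)) => [/(subsetP WU)->|];
    last by rewrite !andbF.
  by case: (boolP (y \in W)) => [/(subsetP WU)->|]; rewrite ?andbT ?andbF.
have conE (W : {set V}) p q : W \subset U -> connect (restr b W) p q -> connect (restr a W) p q.
  by move=> WU; apply: connect_sub => x y; rewrite -restrE // => /connect1.
have dE c : c \in U -> c \notin Q -> deg a c = deg b c.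
  move=> cU cQ; have h y : a c y = b c y.
    rewrite /a /restr /= cU /=.
    by case: (boolP (b c y)) => //= /(frag_closed fU cU cQ).
  by apply: eq_card => y; apply: h.
have Ub c : c \in U -> c \notin Q -> 3 <= deg b c.
  by move=> cU cQ; have [y cy] := frag_pos fU cU cQ; apply: (dmin c y).
have U3 : 3 < #|U|.
  have [c [cU cQ cX]] := frag_core fU.
  rewrite (cardsD1 c) cU ltnS; apply: leq_trans (Ub _ cU cQ) _; rewrite degE.
  apply: subset_leq_card; apply/subsetP => y; rewrite !inE => cy.
  by rewrite (frag_closed fU cU cQ cy) andbT; apply: contraTneq cy => ->; rewrite bi.
have conn2 v p q : p \in U :\ v -> q \in U :\ v -> connect (restr a (U :\ v)) p q.
  move=> pU qU; apply: conE; first exact: subD1set.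
  case: (boolP (v \in U)) => vU; first exact: (frag_conn1 bs hub fU minU).
  have UE : U :\ v = U :\: set0.
    by apply/setP => x; rewrite !inE; have [->|//] := eqVneq x v; rewrite (negPf vU).
  rewrite UE in pU qU *; apply: (frag_conn bs hub fU minU) => //.
  - exact: sub0set.
  - by rewrite set0D; apply/cliqueP => x y; rewrite inE.
  - by rewrite set0D cards0.
  move=> x; rewrite in_setI => /andP[_ xX] _; rewrite subset0 -card_gt0.
  by rewrite (hub_deg xX).
exists U, Q, (U :&: hubs b), n; split=> //; last 2 first.
- by move=> x; rewrite in_setI => /andP[].
- by move=> x xU xX; rewrite in_setI xU.
have hubU x y : x \in U :&: hubs b -> b x y -> y \in U.
  by rewrite in_setI => /andP[xU xX]; apply: (frag_closed_hub fU).
split=> //.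
- by move=> x y /and3P[].
- exact: (frag_sub fU).
- exact: (frag_card fU).
- move=> p q pQ qQ ne; rewrite /a /restr /= !(subsetP (frag_sub fU)) // !andbT.
  exact: (cliqueP _ _ (frag_clique fU)).
- move=> q qQ; have [c [cU cQ cX qc]] := frag_attach bs hub fU minU qQ.
  exists c; split=> //; last by rewrite in_setI negb_and cX orbT.
  by rewrite /a /restr /= qc cU (subsetP (frag_sub fU)).
- move=> x; rewrite in_setI => /andP[xU xX]; apply: contraL xX.
  exact: (frag_hub fU).
- move=> x xUX; move: (xUX); rewrite in_setI => /andP[xU xX].
  have xQ : x \notin Q by apply: contraL xX; apply: (frag_hub fU).
  rewrite dE // degE (hub_deg xX); split=> // y z /and3P[xy _ yU] /and3P[xz _ zU] ne.
  by rewrite /a /restr /= yU zU !andbT; apply: (hub_clique xX).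
- move=> x y; rewrite !in_setI => /andP[xU xX] /and3P[xy _ _].
  by rewrite negb_and (hub _ _ xX xy) orbT.
- move=> u v w /and3P[uv uU vU] /and3P[vw _ wU] /and3P[uw _ _].
  have [[x xX xE]|con] := frag_conn3 bs hub fU minU uU vU wU uv vw uw.
    left; exists x => // y; rewrite -xE inE /a /restr /=.
    move: (xX); rewrite in_setI => /andP[xU _]; rewrite xU /=.
    by case: (boolP (b x y)) => //= /(hubU _ _ xX).
  right; apply: (facial_triangle as_ ai mapn (U := U)) => //.
  + by move=> x y /and3P[].
  + by rewrite /a /restr /= uv uU vU.
  + by rewrite /a /restr /= vw vU wU.
  + by rewrite /a /restr /= uw uU wU.
  by move=> p q pU qU; apply: conE; [exact: subsetDl | exact: con].
move=> K KU KX Kc K3 p q pW qW.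
have XE : U :\: (U :&: hubs b) = U :\: hubs b.
  by apply/setP => x; rewrite !(in_setD, in_setI); case: (x \in U); rewrite ?andbF ?andbT.
rewrite XE in pW qW *; apply: conE.
  by apply: subset_trans (subsetDl _ _) (subsetDl _ _).
apply: (frag_conn_core bs hub fU minU) => //.
- move=> x xK; have := KX x xK; rewrite in_setI (subsetP KU) //.
apply/cliqueP => x y xK yK ne.
by have /and3P[] := cliqueP _ _ Kc x y xK yK ne.
Qed.

(** * The discharging scheme *)
Section Discharge.
Variable R : realFieldType.
Variables (V : finType) (a : rel V) (n : V * V -> V * V) (U Q X : {set V}).
Hypothesis fm : frag_map a n U Q X.

Local Notation face := (face n).
Local Notation flen := (flen n).
Local Notation asym := (fm_sym fm).
Local Notation airr := (fm_irr fm).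
Local Notation mapn := (fm_map fm).

Lemma fm_order d : dart a d -> order n d = deg a d.1.
Proof. exact: order_node asym airr mapn (fm_in fm) (fm_conn2 fm) d. Qed.

Lemma fm_trans d1 d2 : dart a d1 -> dart a d2 -> d1.1 = d2.1 -> fconnect n d1 d2.
Proof. exact: node_trans asym airr mapn (fm_in fm) (fm_conn2 fm) d1 d2. Qed.

Lemma fm_face_simple d1 d2 : dart a d1 -> d1.1 = d2.1 -> fconnect face d1 d2 -> d1 = d2.
Proof. exact: face_simple asym airr mapn (fm_in fm) (fm_conn2 fm) d1 d2. Qed.

Lemma fm_flen_ge3 d : dart a d -> 2 < flen d.
Proof. exact: flen_ge3 asym airr mapn (fm_in fm) (fm_conn2 fm) (fm_card fm) d. Qed.

Lemma fm_flen_face d : flen (face d) = flen d.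
Proof. exact: flen_face mapn d. Qed.

Lemma fm_dart_face d : dart a (face d) = dart a d.
Proof. exact: dart_face asym mapn d. Qed.

Lemma fm_iter_node k d : dart a d ->
  dart a (iter k n d) /\ (iter k n d).1 = d.1.
Proof.
by move=> dd; elim: k => //= k [h1 h2]; rewrite (map_dart mapn) (map_src mapn).
Qed.

Lemma fm_iter_inj i j d : dart a d -> i < deg a d.1 -> j < deg a d.1 ->
  (iter i n d).2 = (iter j n d).2 -> i = j.
Proof.
move=> dd; rewrite -fm_order // => lti ltj E.
have [_ h1] := fm_iter_node i dd; have [_ h2] := fm_iter_node j dd.
rewrite -(findex_iter lti) -(findex_iter ltj); congr (findex _ _ _).
by rewrite (surjective_pairing (iter i n d)) (surjective_pairing (iter j n d)) h1 h2 E.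
Qed.

Local Open Scope ring_scope.

Lemma sum_face (F : V * V -> R) :
  \sum_(d | dart a d) F (face d) = \sum_(d | dart a d) F d.
Proof.
rewrite [RHS](reindex_inj (face_inj mapn)) /=.
by apply: eq_bigl => d; rewrite fm_dart_face.
Qed.

Lemma sum_swapd (F : V * V -> R) :
  \sum_(d | dart a d) F (swapd d) = \sum_(d | dart a d) F d.
Proof.
rewrite [RHS](reindex_inj (inv_inj (@swapdK V))) /=.
by apply: eq_bigl => d; rewrite (dart_swapd asym).
Qed.

(** Triangular faces may be balanced over their three darts, other faces dart
    by dart. *)
Lemma sum_faces_ge0 (F : V * V -> R) :
    (forall d, dart a d -> flen d = 3 -> 0 <= F d + F (face d) + F (face (face d))) ->
    (forall d, dart a d -> flen d <> 3 -> 0 <= F d) ->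
  0 <= \sum_(d | dart a d) F d.
Proof.
move=> F3 Fn; rewrite -(pmulr_rge0 (x := 3)) //.
have -> : 3 * \sum_(d | dart a d) F d =
    \sum_(d | dart a d) (F d + F (face d) + F (face (face d))).
  rewrite !big_split /= (sum_face (fun d => F (face d))) sum_face; lra.
apply: sumr_ge0 => d dd; have [f3|/eqP nf3] := eqVneq (flen d) 3%N; first exact: F3.
by rewrite !addr_ge0 ?Fn ?fm_dart_face ?fm_flen_face.
Qed.

Definition node_sum (F : V * V -> R) (v : V) : R :=
  \sum_(d | dart a d && (d.1 == v)) F d.

Lemma node_sumE F d : dart a d ->
  node_sum F d.1 = \sum_(i < deg a d.1) F (iter i n d).
Proof.
move=> dd; rewrite /node_sum -fm_order //.
rewrite (reindex_onto (fun i : 'I_(order n d) => iter i n d)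
   (fun d' => insubd (Ordinal (order_gt0 n d)) (findex n d d'))) /=; last first.
  move=> d' /andP[dd' /eqP E]; have fc := fm_trans dd dd' (esym E).
  by rewrite val_insubd (findex_max fc) iter_findex.
apply: eq_bigl => i; have [-> ->] := fm_iter_node i dd.
by rewrite eqxx -val_eqE val_insubd findex_iter ?ltn_ord /= ?eqxx.
Qed.

Lemma node_sum_next F v : node_sum (fun d => F (n d)) v = node_sum F v.
Proof.
rewrite /node_sum [RHS](reindex_inj (map_inj mapn)) /=.
by apply: eq_bigl => d; rewrite (map_dart mapn) (map_src mapn).
Qed.

Lemma node_sumD F1 F2 v : node_sum (fun d => F1 d + F2 d) v = node_sum F1 v + node_sum F2 v.
Proof. exact: big_split. Qed.

Lemma node_sumZ c F v : node_sum (fun d => c * F d) v = c * node_sum F v.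
Proof. by rewrite /node_sum mulr_sumr. Qed.

Lemma node_card v (P : pred (V * V)) :
  node_sum (fun d => (P d)%:R) v = #|[pred d | [&& dart a d, d.1 == v & P d]]|%:R.
Proof.
rewrite /node_sum -sum1_card natr_sum [RHS]big_mkcond [LHS]big_mkcond /=.
apply: eq_bigr => d _; rewrite inE /=; case: (dart a d) => //=.
by case: (_ == _) => //=; case: (P d).
Qed.

Lemma node_const c v : node_sum (fun=> c) v = (deg a v)%:R * c.
Proof.
rewrite /node_sum sumr_const -[LHS]mulr_natl; congr (_%:R * _).
rewrite /deg -(card_imset (a v) (f := pair v)); last by move=> y z [].
apply: eq_card => -[u w]; rewrite unfold_in /= /dart /=.
by apply/andP/imsetP => [[auv /eqP <-]|[y xy [-> ->]]]; first exists w.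
Qed.

Lemma node_vertex v : (0 < deg a v)%N ->
  node_sum (fun d => 1 - 4 / (deg a d.1)%:R) v = (deg a v)%:R - 4.
Proof.
move=> dv; transitivity (node_sum (fun=> 1 - 4 / (deg a v)%:R) v).
  by apply: eq_bigr => d /andP[_ /eqP->].
rewrite node_const mulrBr mulr1 mulrCA divff ?mulr1 //.
by rewrite pnatr_eq0 -lt0n.
Qed.

Lemma le_node_sum F1 F2 v : (forall d, dart a d -> d.1 = v -> F1 d <= F2 d) ->
  node_sum F1 v <= node_sum F2 v.
Proof. by move=> h; apply: ler_sum => d /andP[dd /eqP]; apply: h. Qed.

Lemma fm_deg_gt0 c : c \in U -> (0 < deg a c)%N.
Proof.
move=> cU; have : (0 < #|U :\ c|)%N.
  by have := fm_card fm; rewrite (cardsD1 c) cU; case: #|_|.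
case/card_gt0P=> y; rewrite in_setD1 => /andP[yc yU].
have : (0 < #|U :\ c :\ y|)%N.
  have := fm_card fm; rewrite (cardsD1 c) cU (cardsD1 y (U :\ c)) in_setD1 yc yU.
  by case: #|_|.
case/card_gt0P=> z; rewrite !in_setD1 => /and3P[zy zc zU].
have cUz : c \in U :\ z by rewrite in_setD1 eq_sym zc.
have yUz : y \in U :\ z by rewrite in_setD1 eq_sym zy.
case/connectP: (fm_conn2 fm cUz yUz) => [[|p s] /=].
  by move=> _ E; rewrite E eqxx in yc.
by case/andP=> /and3P[cp _ _] _ _; apply/card_gt0P; exists p.
Qed.

Lemma fm_core_vertex : exists c, [/\ c \in U, c \notin Q & (0 < deg a c)%N].
Proof.
have : (0 < #|U :\: Q|)%N.
  rewrite cardsD subn_gt0; apply: leq_ltn_trans (fm_card fm).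
  by apply: leq_trans (fm_Q3 fm); apply: subset_leq_card; apply: subsetIr.
by case/card_gt0P=> c; rewrite inE => /andP[cQ cU]; exists c; rewrite fm_deg_gt0.
Qed.

(** [w] is the final charge of the vertices, spread over their darts; the first
    hypothesis says that no face has a negative final charge in total. *)
Lemma discharge (w : V * V -> R) :
    \sum_(d | dart a d) w d <=
      \sum_(d | dart a d) (2 - 4 / (deg a d.1)%:R - 4 / (flen d)%:R) ->
    (forall v, v \in U -> v \notin Q -> 0 <= node_sum w v) ->
    (forall q, q \in Q -> - 8 < #|Q|%:R * node_sum w q) ->
  False.
Proof.
move=> le_w wU wQ.
have [c [cU cQ /card_gt0P[y cy]]] := fm_core_vertex.
have dd : exists d, dart a d by exists (c, y).
have := euler_charge R asym airr mapn dd; apply/negP; rewrite -ltNge.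
apply: lt_le_trans le_w.
have -> : \sum_(d | dart a d) w d = \sum_(v in U) node_sum w v.
  rewrite (partition_big (fun d => d.1) (mem U)) //= => d; exact: (fm_in fm).
rewrite (bigID (mem Q)) /=.
have h2 : 0 <= \sum_(v in U | v \notin Q) node_sum w v.
  by apply: sumr_ge0 => v /andP[]; apply: wU.
suff h1 : - 8 < \sum_(v in U | v \in Q) node_sum w v by lra.
rewrite (eq_bigl (mem Q)); last first.
  by move=> v /=; case: (boolP (v \in Q)) => [/(subsetP (fm_sub fm))->|]; rewrite ?andbF.
have [->|/set0Pn[q0 q0Q]] := eqVneq Q set0; first by rewrite big_set0 oppr_lt0 ltr0n.
have Qgt0 : 0 < #|Q|%:R :> R by rewrite ltr0n; apply/card_gt0P; exists q0.
apply: (@le_lt_trans _ _ (\sum_(v in Q) (- 8 / #|Q|%:R))).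
  rewrite sumr_const -[leRHS]mulr_natl mulrC divfK; first exact: lexx.
  by rewrite gt_eqF.
apply: ltr_sum => [|q qQ]; last by rewrite ltr_pdivrMr // mulrC wQ.
by apply/hasP; exists q0; rewrite ?mem_index_enum.
Qed.

End Discharge.

(** * Triangle-free graphs and graphs without adjacent triangles *)
Section Light.
Variable R : realFieldType.
Variables (V : finType) (a : rel V) (n : V * V -> V * V) (U Q X : {set V}).
Hypothesis fm : frag_map a n U Q X.

Local Notation face := (face n).
Local Notation flen := (flen n).
Local Notation asym := (fm_sym fm).
Local Notation airr := (fm_irr fm).
Local Notation mapn := (fm_map fm).

Lemma flen3P x y : a x y -> flen (x, y) = 3 -> exists z,
  [/\ a y z, a z x, face (x, y) = (y, z), face (y, z) = (z, x) &
      face (z, x) = (x, y)].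
Proof.
move=> xy f3; have fK := iter_order (face_inj mapn) (x, y).
rewrite [order _ _]f3 /= in fK.
have d1 : dart a (face (x, y)) by rewrite (fm_dart_face fm).
have d2 : dart a (face (face (x, y))) by rewrite !(fm_dart_face fm).
have E1 : face (x, y) = (y, (face (x, y)).2).
  by rewrite [LHS]surjective_pairing (face_src mapn).
have E2 : face (face (x, y)) = ((face (x, y)).2, x).
  by rewrite [LHS]surjective_pairing -(face_src mapn (face (face _))) fK (face_src mapn).
exists (face (x, y)).2; split => //.
- by rewrite E1 in d1.
- by rewrite E2 in d2.
- by rewrite -E1 E2.
by rewrite -E2 fK.
Qed.

Local Open Scope ring_scope.

Lemma deg_Q q : q \in Q -> (0 < deg a q)%N.
Proof. by case/(fm_attach fm)=> c [qc _ _]; apply/card_gt0P; exists c. Qed.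

Lemma card_Q q : q \in Q -> (0 < #|Q|)%N.
Proof. by move=> qQ; apply/card_gt0P; exists q. Qed.

Lemma deg_Q3 q : q \in Q -> (#|Q| <= deg a q)%N.
Proof.
move=> qQ; have [c [qc cQ cX]] := fm_attach fm qQ.
have -> : #|Q| = #|c |: Q :\ q|.
  by rewrite cardsU1 !inE (negPf cQ) andbF (cardsD1 q Q) qQ.
apply: subset_leq_card; apply/subsetP => y; rewrite !inE => /orP[/eqP->//|/andP[yq yQ]].
by apply: (fm_clique fm) => //; rewrite eq_sym.
Qed.

(** A vertex of degree at least 6 can give 1/3 along each dart. Here the roots
    are at most two, and a root keeps at least 1 - 4 - 1/3. *)
Lemma triangle_free_light :
    (forall x y z, a x y -> a y z -> a x z -> False) ->
    (forall x, x \in U -> x \notin Q -> (3 <= deg a x)%N) ->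
    (forall x y, x \notin Q -> y \notin Q -> a x y -> deg a x = 3%N -> (6 <= deg a y)%N) ->
  False.
Proof.
move=> notri deg3 light.
pose p (d : V * V) : R := if (d.2 \notin Q) && (deg a d.2 == 3%N) then 1 / 3 else 0.
have p_ge0 d : 0 <= p d by rewrite /p; case: ifP => _ //; lra.
have p_le d : p d <= 1 / 3 by rewrite /p; case: ifP => _ //; lra.
have flen4 d : dart a d -> (4 <= flen d)%N.
  move=> dd; rewrite ltn_neqAle (fm_flen_ge3 fm dd) andbT eq_sym.
  apply/eqP => f3; case: d dd f3 => x y xy /(flen3P xy)[z [yz zx _ _ _]].
  by apply: (notri x y z) => //; rewrite asym.
pose w d : R := (1 - 4 / (deg a d.1)%:R) + (p (swapd d) - p d).
have nodeE v : (0 < deg a v)%N ->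
    node_sum a w v = (deg a v)%:R - 4 + node_sum a (fun d => p (swapd d) - p d) v.
  by move=> dv; rewrite -(node_vertex R dv) -node_sumD.
apply: (discharge fm (w := w)).
- rewrite /w big_split /= [X in _ + X]sumrB (sum_swapd fm) subrr addr0.
  apply: ler_sum => d dd; have h := flen4 d dd.
  have : 4 / (flen d)%:R <= 1 :> R.
    by rewrite ler_pdivrMr ?mul1r ?ler_nat // ltr0n; apply: leq_trans h.
  lra.
- move=> v vU vQ; have d3 := deg3 v vU vQ.
  rewrite nodeE; last exact: leq_trans d3.
  have [v3|nv3] := eqVneq (deg a v) 3%N.
    apply: (@le_trans _ _ ((deg a v)%:R - 4 + node_sum a (fun=> 1 / 3) v)).
      by rewrite node_const v3; lra.
    rewrite lerD2l; apply: le_node_sum => d dd dv.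
    rewrite {1}/p /= dv vQ v3 eqxx /=.
    suff -> : p d = 0 by lra.
    rewrite /p; case: ifP => // /andP[d2Q /eqP d23].
    have := light d.1 d.2; rewrite dv d23 => /(_ vQ d2Q _ v3).
    by move: dd; rewrite /dart dv => dd /(_ dd).
  have [lt6|ge6] := ltnP (deg a v) 6.
    apply: (@le_trans _ _ ((deg a v)%:R - 4 + node_sum a (fun=> 0) v)).
      rewrite node_const mulr0 addr0 subr_ge0 (ler_nat _ 4).
      by rewrite ltn_neqAle eq_sym nv3.
    rewrite lerD2l; apply: le_node_sum => d dd dv.
    suff -> : p d = 0 by rewrite subr0.
    rewrite /p; case: ifP => // /andP[d2Q /eqP d23].
    have dsd : a d.2 d.1 by rewrite asym.
    have := light d.2 d.1 d2Q; rewrite dv => /(_ vQ); rewrite -dv => /(_ dsd d23).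
    by rewrite dv leqNgt lt6.
  apply: (@le_trans _ _ ((deg a v)%:R - 4 + node_sum a (fun=> - 1 / 3) v)).
    have : 6 <= (deg a v)%:R :> R by rewrite (ler_nat _ 6).
    by rewrite node_const; lra.
  rewrite lerD2l; apply: le_node_sum => d _ _.
  by have := p_ge0 (swapd d); have := p_le d; lra.
move=> q qQ; rewrite nodeE ?deg_Q //.
have Q2 : (#|Q| <= 2)%N.
  rewrite leqNgt; apply/negP => Q3.
  have [c] : exists c, c \in Q :\ q by apply/card_gt0P; move: Q3; rewrite (cardsD1 q) qQ; case: #|_|.
  rewrite in_setD1 => /andP[cq cQ].
  have [e] : exists e, e \in Q :\ q :\ c.
    apply/card_gt0P; move: Q3; rewrite (cardsD1 q) qQ (cardsD1 c (Q :\ q)) in_setD1 cq cQ.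
    by case: #|_|.
  rewrite !in_setD1 => /and3P[ec eq eQ].
  by apply: (notri q c e); apply: (fm_clique fm); rewrite // eq_sym.
have : node_sum a (fun=> - 1 / 3) q <= node_sum a (fun d => p (swapd d) - p d) q.
  by apply: le_node_sum => d _ _; have := p_ge0 (swapd d); have := p_le d; lra.
rewrite node_const; have : 1 <= (deg a q)%:R :> R by rewrite (ler_nat _ 1) deg_Q.
move: (node_sum _ _ _) => s; have := card_Q qQ.
by case: #|Q| Q2 => [|[|[|]]] // _ _; lra.
Qed.

(** Each edge has an end that is a root or has degree at least 5, so a triangle
    takes 1/2 from at least two of its ends. Consecutive triangular corners at
    a vertex would form a diamond, hence a vertex of degree 5 has at most two of
    them. *)
Lemma no_diamond_light :
    (forall v x y z, a v x -> a v y -> a v z -> a x y -> a y z -> x != z -> False) ->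
    (forall x, x \in U -> x \notin Q -> (4 <= deg a x)%N) ->
    (forall x y, x \notin Q -> y \notin Q -> a x y -> (9 <= deg a x + deg a y)%N) ->
  False.
Proof.
move=> nodiam deg4 light.
pose big x := (x \in Q) || (5 <= deg a x)%N.
have big2 x y : a x y -> big x || big y.
  move=> xy; rewrite /big; case: (boolP (x \in Q)) => //= xQ.
  case: (boolP (y \in Q)) => [|yQ]; rewrite /= ?orbT //.
  by have := light x y xQ yQ xy; lia.
pose t (d : V * V) : R := (flen d == 3%N)%:R.
pose p d : R := if (flen d == 3%N) && big d.1 then 1 / 2 else 0.
have p_le d : p d <= t d / 2.
  by rewrite /p /t; case: (flen d == 3%N) => /=; [case: (big d.1)|]; lra.
have t_le d : t d <= 1 by rewrite /t; case: (_ == _).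
pose w d : R := (1 - 4 / (deg a d.1)%:R) + (- p d).
have nodeE v : (0 < deg a v)%N ->
    node_sum a w v = (deg a v)%:R - 4 + node_sum a (fun d => - p d) v.
  by move=> dv; rewrite -(node_vertex R dv) -node_sumD.
apply: (discharge fm (w := w)).
- rewrite -subr_ge0 -sumrB.
  rewrite (eq_bigr (fun d => 1 - 4 / (flen d)%:R + p d)); last first.
    by move=> d _; rewrite /w; lra.
  apply: (sum_faces_ge0 fm) => [[x y] xy f3|d dd /eqP nf3].
    have [z [yz zx E1 E2 E3]] := flen3P xy f3.
    have f1 := fm_flen_face fm (x, y); have f2 := fm_flen_face fm (face (x, y)).
    rewrite f1 f2 f3 E1 E2 /p -E1 f1 -?E2 -?E1 ?f2 ?f1 f3 /= E1 E2 /=.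
    have := big2 _ _ xy; have := big2 _ _ yz; have := big2 _ _ zx.
    by case: (big x); case: (big y); case: (big z) => //= _ _ _; lra.
  have h : (4 <= flen d)%N by rewrite ltn_neqAle (fm_flen_ge3 fm dd) andbT eq_sym.
  have : 4 / (flen d)%:R <= 1 :> R.
    by rewrite ler_pdivrMr ?mul1r ?ler_nat // ltr0n; apply: leq_trans h.
  by rewrite /p (negPf nf3) /=; lra.
- move=> v vU vQ; have d4 := deg4 v vU vQ.
  have d40 : (0 < deg a v)%N by apply: leq_trans d4.
  rewrite nodeE //.
  have [le4|gt4] := leqP (deg a v) 4.
    have -> : deg a v = 4%N by apply/eqP; rewrite eqn_leq le4.
    rewrite subrr add0r; apply: sumr_ge0 => d /andP[dd /eqP dv].
    by rewrite /p /big dv (negPf vQ) /= ltnNge le4 andbF oppr0.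
  have tt : 2 * node_sum a t v <= (deg a v)%:R.
    rewrite -[leRHS]mulr1 -node_const mulrDl mul1r.
    rewrite -{2}(node_sum_next fm) -node_sumD.
    apply: le_node_sum => -[v' x1] dd /= vE; subst v'; rewrite /t.
    case: eqP => [f3|_]; last by rewrite add0r; exact: t_le.
    case: eqP => [f3'|_]; last by rewrite addr0.
    exfalso; have [x0 [x10 x0v _ _ E3]] := flen3P dd f3.
    have dn : dart a (n (v, x1)) by rewrite (map_dart mapn).
    move: (map_src mapn (v, x1)) dn f3'; case En: (n (v, x1)) => [v' x2] /= vE dn f3'.
    subst v'; have [z [x2z zv _ _ E3']] := flen3P dn f3'.
    have zx1 : z = x1.
      have : n (v, z) = n (v, x1) by rewrite En -E3'.
      by move/(map_inj mapn) => [].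
    subst z.
    have n0 : n (v, x0) = (v, x1) by rewrite -E3.
    apply: (nodiam v x0 x1 x2) => //; rewrite 1?asym //.
    apply/eqP => E; have gt2 : (2 < deg a v)%N by apply: ltn_trans gt4.
    have dv0 : dart a (v, x0) by rewrite /dart /= asym.
    have := @fm_iter_inj _ _ _ _ _ _ fm 0 2 _ dv0 d40 gt2.
    by rewrite /= n0 En E => /(_ erefl).
  have : - node_sum a t v / 2 <= node_sum a (fun d => - p d) v.
    have -> : - node_sum a t v / 2 = node_sum a (fun d => - 1 / 2 * t d) v.
      by rewrite node_sumZ; lra.
    by apply: le_node_sum => d _ _; have := p_le d; lra.
  have [n_t ntE] : exists k : nat, node_sum a t v = k%:R.
    by rewrite /t node_card; eexists.
  rewrite ntE in tt *; have [le5|gt5] := leqP (deg a v) 5.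
    have d5 : deg a v = 5%N by apply/eqP; rewrite eqn_leq le5 gt4.
    move: tt; rewrite d5 -natrM ler_nat => tt.
    have : n_t%:R <= 2 :> R by rewrite (ler_nat _ _ 2); lia.
    by lra.
  have : 6 <= (deg a v)%:R :> R by rewrite (ler_nat _ 6).
  by lra.
move=> q qQ; rewrite nodeE ?deg_Q //.
have : node_sum a (fun=> - 1 / 2) q <= node_sum a (fun d => - p d) q.
  by apply: le_node_sum => d _ _; have := p_le d; have := t_le d; lra.
rewrite node_const; have := fm_Q3 fm; have := deg_Q3 qQ; have := card_Q qQ.
have : 1 <= (deg a q)%:R :> R by rewrite (ler_nat _ 1) deg_Q.
move: (node_sum _ _ _) => s.
case: #|Q| => [|[|[|[|]]]] // h1 _; rewrite -?(ler_nat R) => h2 _ h3; lra.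
Qed.

End Light.

(** * Consecutive corners at a vertex *)

Ltac dand := repeat match goal with
  | H : is_true (_ && _) |- _ => case/andP: H => ? ?
  end.
Ltac uq := rewrite /= ?inE ?negb_or ?andbT; repeat (apply/andP; split);
  first [done | by rewrite eq_sym].

Section Local.
Variables (V : finType) (a : rel V) (n : V * V -> V * V) (U Q X : {set V}).
Hypothesis fm : frag_map a n U Q X.

Local Notation face := (face n).
Local Notation flen := (flen n).
Local Notation asym := (fm_sym fm).
Local Notation airr := (fm_irr fm).
Local Notation mapn := (fm_map fm).

(** The neighbours of [d.1] in rotation order, starting with [d.2] and repeated
    periodically. The face of the dart to [nb d i.+1] has its corner at [d.1]
    between [nb d i] and [nb d i.+1]. *)
Definition nb (d : V * V) (i : nat) : V := (iter i n d).2.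

Arguments nb : simpl never.

Lemma nbE d i : dart a d -> iter i n d = (d.1, nb d i).
Proof.
by move=> dd; have [_ h] := fm_iter_node fm i dd; rewrite -h -surjective_pairing.
Qed.

Lemma nbS d i : dart a d -> n (d.1, nb d i) = (d.1, nb d i.+1).
Proof. by move=> dd; rewrite -!nbE. Qed.

Lemma nb_adj d i : dart a d -> a d.1 (nb d i).
Proof. by move=> dd; have [] := fm_iter_node fm i dd; rewrite nbE. Qed.

Lemma nb_inj d i j : dart a d -> i < deg a d.1 -> j < deg a d.1 ->
  nb d i = nb d j -> i = j.
Proof. by move=> dd; apply: (fm_iter_inj fm). Qed.

Lemma nb_deg d : dart a d -> nb d (deg a d.1) = nb d 0.
Proof.
by move=> dd; rewrite /nb -(fm_order fm dd) (iter_order (map_inj mapn)).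
Qed.

Lemma nb_uniq d k : dart a d -> k <= deg a d.1 ->
  uniq (d.1 :: [seq nb d i | i <- iota 0 k]).
Proof.
move=> dd lek; rewrite /=; apply/andP; split.
  apply/mapP => -[i _ E]; have := nb_adj i dd; by rewrite -E airr.
rewrite map_inj_in_uniq ?iota_uniq // => i j; rewrite !mem_iota !add0n.
by move=> /andP[_ li] /andP[_ lj]; apply: nb_inj => //; apply: leq_trans lek.
Qed.

Lemma nb_tri d i : dart a d -> flen (d.1, nb d i.+1) = 3 ->
  [/\ a (nb d i) (nb d i.+1),
      face (d.1, nb d i.+1) = (nb d i.+1, nb d i),
      face (nb d i.+1, nb d i) = (nb d i, d.1) &
      face (nb d i, d.1) = (d.1, nb d i.+1)].
Proof.
move=> dd f3; have [z [yz zx E1 E2 E3]] := flen3P fm (nb_adj i.+1 dd) f3.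
have zE : z = nb d i.
  have : n (d.1, z) = n (d.1, nb d i) by rewrite nbS // -E3.
  by move/(map_inj mapn) => [].
by subst z; split=> //; rewrite asym.
Qed.

Lemma nb_face d i : dart a d -> face (nb d i, d.1) = (d.1, nb d i.+1).
Proof. by move=> dd; rewrite faceE /= nbS. Qed.

Lemma face_walk d i : dart a d ->
  [/\ dart a (iter i face d), a (iter i face d).1 (iter i.+1 face d).1,
      (iter i face d).2 = (iter i.+1 face d).1 &
      flen (iter i face d) = flen d].
Proof.
move=> dd; have h : dart a (iter i face d) by elim: i => //= i; rewrite (fm_dart_face fm).
have e : (iter i face d).2 = (iter i.+1 face d).1 by rewrite iterS (face_src mapn).
split=> //; first by rewrite -e.
by elim: i {h e} => //= i <-; rewrite (fm_flen_face fm).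
Qed.

Lemma face_uniq d : dart a d ->
  uniq [seq (iter i face d).1 | i <- iota 0 (flen d)].
Proof.
move=> dd; rewrite map_inj_in_uniq ?iota_uniq // => i j; rewrite !mem_iota !add0n.
move=> /andP[_ li] /andP[_ lj] E.
have [di _ _ _] := face_walk i dd; have [dj _ _ _] := face_walk j dd.
have EF : iter i face d = iter j face d.
  apply: (fm_face_simple fm) => //; apply: (connect_trans (y := d)).
    by rewrite (fconnect_sym (face_inj mapn)); apply: fconnect_iter.
  exact: fconnect_iter.
by rewrite -(findex_iter li) EF (findex_iter lj).
Qed.

Lemma face_ucycle d : dart a d ->
  ucycle a [seq (iter i face d).1 | i <- iota 0 (flen d)].
Proof.
move=> dd; rewrite /ucycle face_uniq // andbT.
have := order_gt0 face d; have := iter_order (face_inj mapn) d.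
rewrite -/(flen d); case: (flen d) => // m Em _ /=.
have step : forall k i, path a (iter i face d).1
   (rcons [seq (iter j face d).1 | j <- iota i.+1 k] (iter (i + k).+1 face d).1).
  elim=> [|k IHk] i; have [_ h _ _] := face_walk i dd.
    by rewrite /= addn0 -iterS h.
  rewrite /= -iterS h /= addnS -addSn; exact: IHk.
by have := step m 0; rewrite add0n Em.
Qed.

(** The edge [yz] does not separate [u] from the rest of the core, so [u] has a
    third neighbour. *)
Lemma tri_deg3 u y z : u \notin X -> y \notin X -> z \notin X ->
    a u y -> a u z -> a y z -> 3 < #|U :\: X| ->
  exists2 w, w \notin X & [&& a u w, w != y & w != z].
Proof.
move=> uX yX zX uy uz yz U4.
have ne p q : a p q -> p != q by apply: contraTneq => ->; rewrite airr.
pose K := [set y; z].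
have [r rW] : exists r, r \in (U :\: X) :\: K :\ u.
  apply/card_gt0P.
  have h1 : #|K| = 2 by rewrite cards2 ne.
  have h2 : #|(U :\: X) :&: K| <= 2 by rewrite -h1 subset_leq_card // subsetIr.
  have := cardsID K (U :\: X); have := cardsD1 u ((U :\: X) :\: K).
  by case: (u \in _) => /=; lia.
move: rW; rewrite in_setD1 => /andP[ru rW].
have uW : u \in (U :\: X) :\: K.
  by rewrite !inE negb_or (ne _ _ uy) (ne _ _ uz) uX (fm_in fm uy).
have KU : K \subset U.
  apply/subsetP => p; rewrite !inE => /orP[]/eqP->; first exact: (fm_in fm yz).
  by apply: (fm_in fm (y := y)); rewrite asym.
have KX p : p \in K -> p \notin X by rewrite !inE => /orP[]/eqP->.
have Kc : clique a K.
  apply/cliqueP => p q; rewrite !inE => /orP[]/eqP-> /orP[]/eqP->; rewrite ?eqxx //.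
  by rewrite asym.
have K3 : #|K| <= 3 by rewrite cards2; case: (_ != _).
case/connectP: (fm_core fm KU KX Kc K3 uW rW) => [[|w s] /=].
  by move=> _ E; rewrite E eqxx in ru.
case/andP=> /and3P[uw _]; rewrite !inE negb_or => /andP[/andP[wy wz] /andP[wX _]] _ _.
by exists w => //; rewrite uw wy wz.
Qed.

Lemma deg3_tri u y z : u \notin X -> y \notin X -> z \notin X ->
    a u y -> a u z -> a y z -> 3 < #|U :\: X| -> 2 < deg a u.
Proof.
move=> uX yX zX uy uz yz U4; have [w wX /and3P[uw wy wz]] := tri_deg3 uX yX zX uy uz yz U4.
have yz' : y != z by apply: contraTneq yz => ->; rewrite airr.
have : #|[set y; z; w]| = 3.
  rewrite -setUA cardsU1 cards2 !inE negb_or yz' eq_sym wy /= [z == w]eq_sym wz //.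
move <-; apply: subset_leq_card; apply/subsetP => p; rewrite !inE -orbA.
by move=> /or3P[]/eqP->.
Qed.

(** With at least three darts at [u], three turns do not come back. *)
Lemma rot3 u y1 y2 y3 : a u y1 -> n (u, y1) = (u, y2) -> n (u, y2) = (u, y3) ->
  2 < deg a u -> y3 != y1.
Proof.
move=> u1 E1 E2 d3; apply/eqP => E; have dd : dart a (u, y1) by [].
have := @nb_inj (u, y1) 0 2 dd (ltn_trans (isT : 0 < 2) d3) d3.
by rewrite /nb /= E1 E2 E => /(_ erefl).
Qed.

Lemma rot4 u y1 y2 y3 y4 : a u y1 -> n (u, y1) = (u, y2) -> n (u, y2) = (u, y3) ->
  n (u, y3) = (u, y4) -> 3 < deg a u -> y4 != y1.
Proof.
move=> u1 E1 E2 E3 d3; apply/eqP => E; have dd : dart a (u, y1) by [].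
have := @nb_inj (u, y1) 0 3 dd (ltn_trans (isT : 0 < 3) d3) d3.
by rewrite /nb /= E1 E2 E3 E => /(_ erefl).
Qed.

End Local.
Arguments nb : simpl never.

Local Open Scope ring_scope.

(** * Graphs without 7-cycles *)

(** What a vertex pays to a triangle with [k] big ends, a big vertex being a
    root or a vertex of degree at least 6; [five] marks the vertices of degree
    5, and [h] tells whether a face of length at least 8 lies across one of the
    sides of the triangle. *)
Definition toll (R : realFieldType) (big five : bool) (k : nat) (h : bool) : R :=
  if big then 1 / 2 else if five then
    match k with
    | 0 => if h then 1 / 6 else 1 / 3
    | 1 => if h then 0 else 1 / 4
    | _ => 0
    end
  else 0.

(** The ends [x], [y], [z] of a triangle are big, or of degree 5 ([dx], [dy],
    [dz]); the booleans [p], [q], [r] mark the sides across which lies a face of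
    length at least 8, which contributes 1/2. *)
Lemma toll_triangle (R : realFieldType) (x y z dx dy dz p q r : bool) :
    (x || y || dx && dy) -> (y || z || dy && dz) -> (z || x || dz && dx) ->
  0 <= (1 - 4 / 3%:R) + toll R x dx (x + y + z) [|| p, q | r] +
      (if p then 1 / 2 else 0) +
    ((1 - 4 / 3%:R) + toll R y dy (x + y + z) [|| p, q | r] +
      (if q then 1 / 2 else 0)) +
    ((1 - 4 / 3%:R) + toll R z dz (x + y + z) [|| p, q | r] +
      (if r then 1 / 2 else 0)).
Proof.
move=> hx hy hz; set k := (x + y + z)%N; set h := [|| p, q | r].
have hh : (if h then 1 / 2 else 0) <= (if p then 1 / 2 else 0) +
    (if q then 1 / 2 else 0) + (if r then 1 / 2 else 0) :> R.
  by rewrite /h {h}; case: p; case: q; case: r; rewrite /=; lra.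
clearbody h; move: hx hy hz; rewrite /k /toll {k}; move: hh.
move: (if p then _ else _) (if q then _ else _) (if r then _ else _) => s t u hh.
case: x; case: y; case: z; rewrite /= ?andbT ?andbF.
all: do ?[case: dx; case: dy; case: dz => //=].
all: by move=> _ _ _; case: h hh => hh; rewrite /= in hh *; lra.
Qed.

Lemma toll_ge0 (R : realFieldType) (b f : bool) k (h : bool) : 0 <= toll R b f k h.
Proof.
rewrite /toll; case: b; first by lra.
case: f; last by lra.
by case: k => [|[|?]]; case: h; lra.
Qed.

Lemma toll_le (R : realFieldType) (b f : bool) k (h : bool) : toll R b f k h <= 1 / 2.
Proof.
rewrite /toll; case: b; first by lra.
case: f; last by lra.
by case: k => [|[|?]]; case: h; lra.
Qed.

Lemma toll_le3 (R : realFieldType) (f : bool) k (h : bool) : toll R false f k h <= 1 / 3.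
Proof.
rewrite /toll /=; case: f; last by lra.
by case: k => [|[|?]]; case: h; lra.
Qed.

Lemma toll_le4 (R : realFieldType) (f : bool) k (h : bool) :
  (0 < k)%N -> toll R false f k h <= 1 / 4.
Proof.
rewrite /toll /=; case: f; last by lra.
by case: k => [|[|?]] // _; case: h; lra.
Qed.

Lemma two_gaps (R : realFieldType) (f : nat -> R) i : f 0%N = 0 ->
  (forall j, f j <= 1) -> (0 < i < 6)%N -> f i = 0 -> \sum_(j < 6) f j <= 4.
Proof.
move=> f0 f1 i6 fi; rewrite !big_ord_recl big_ord0 /bump /= f0.
have := f1 1%N; have := f1 2%N; have := f1 3%N; have := f1 4%N; have := f1 5%N.
by move: fi; case: i i6 => [|[|[|[|[|[|]]]]]] //= _; lra.
Qed.

Local Close Scope ring_scope.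

Section NoSevenCycle.
Variable R : realFieldType.
Variables (V : finType) (a : rel V) (n : V * V -> V * V) (U Q : {set V}).
Hypothesis fm : frag_map a n U Q set0.
Hypothesis noC7 : forall s : seq V, size s = 7 -> ucycle a s -> False.
Hypothesis deg4 : forall x, x \in U -> x \notin Q -> 4 <= deg a x.
Hypothesis light : forall x y, x \notin Q -> y \notin Q -> a x y ->
  10 <= deg a x + deg a y.

Local Notation face := (face n).
Local Notation flen := (flen n).
Local Notation asym := (fm_sym fm).
Local Notation airr := (fm_irr fm).
Local Notation mapn := (fm_map fm).

(** There are no hubs here, so neighbours of a vertex are adjacent only when
    they are consecutive. *)
Lemma chord5 d i j : dart a d -> i < j -> j < deg a d.1 ->
  a (nb n d i) (nb n d j) -> j = i.+1 \/ i = 0 /\ j.+1 = deg a d.1.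
Proof.
move=> dd ltij ltj aij.
have [[x]|[[E _]|[E _]]] := fm_tri fm (nb_adj fm i dd) aij (nb_adj fm j dd).
- by rewrite inE.
- have {}E : nb n d i.+1 = nb n d j by move: E; rewrite (nbS fm) // => -[].
  by left; symmetry; apply: (nb_inj fm dd (leq_ltn_trans ltij ltj) ltj E).
have {}E : nb n d j.+1 = nb n d i by move: E; rewrite (nbS fm) // => -[].
have [ltSj|] := ltnP j.+1 (deg a d.1).
  by have := nb_inj fm dd ltSj (ltn_trans ltij ltj) E; lia.
rewrite leq_eqVlt ltnS leqNgt ltj orbF => /eqP Ej; right; split=> //.
rewrite -Ej (nb_deg fm dd) in E.
by symmetry; apply: (nb_inj fm dd _ (ltn_trans ltij ltj) E); apply: leq_ltn_trans ltj.
Qed.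

Let core_gt3 : 3 < #|U :\: set0|. Proof. by rewrite setD0 (fm_card fm). Qed.

Let adj_ne x y : a x y -> x != y.
Proof. by apply: contraTneq => ->; rewrite airr. Qed.

Definition big x := (x \in Q) || (5 < deg a x).
Definition nbig (d : V * V) : nat := big d.1 + big d.2 + big (face d).2.
Definition hasB (d : V * V) : bool :=
  [|| 8 <= flen (swapd d), 8 <= flen (swapd (face d))
    | 8 <= flen (swapd (face (face d)))].
Definition pay (d : V * V) : R :=
  if flen d == 3 then toll R (big d.1) (deg a d.1 == 5) (nbig d) (hasB d) else 0%R.

Section FiveVertex.
Variables (v x0 : V).
Hypotheses (vx0 : a v x0) (v5 : deg a v = 5) (vQ : v \notin Q).
Let d := (v, x0).
Let dd : dart a d. Proof. exact: vx0. Qed.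
Local Notation x := (nb n d).

Let nochord i j : i < j < 5 -> j != i.+1 -> ~~ ((i == 0) && (j == 4)) -> a (x i) (x j) = false.
Proof.
move=> /andP[ltij ltj] h1 h2; apply/negbTE/negP => aij.
have ltj' : j < deg a d.1 by rewrite v5.
have [E|[E1 E2]] := chord5 dd ltij ltj' aij; first by rewrite E eqxx in h1.
by rewrite v5 in E2; case: E2 => E2; rewrite E1 E2 in h2.
Qed.

Let nbu : uniq [:: v; x 0; x 1; x 2; x 3; x 4].
Proof. by have := nb_uniq fm dd (leqnn (deg a d.1)); rewrite v5. Qed.

(** Suppose that the five faces at [v] are triangles, and consider the face
    across the side opposite to [v] of one of them. Its boundary and paths in
    the wheel around [v] combine to a 7-cycle if its length is at most 7. The
    coincidences that could spoil this cycle are chords of the wheel, or force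
    the vertices [x 0], [x 1] to have degree 3. *)
Lemma full_star_outer :
    (forall i, flen (v, x i) = 3) -> x 0 \notin Q -> x 1 \notin Q ->
  8 <= flen (x 0, x 1).
Proof.
move=> T x0Q x1Q.
have [a01 t1a t1b t1c] := nb_tri fm dd (T 1).
have [a12 t2a t2b t2c] := nb_tri fm dd (T 2).
have [a23 _ _ _] := nb_tri fm dd (T 3).
have [a34 _ _ _] := nb_tri fm dd (T 4).
have x5 : x 5 = x 0 by rewrite -(nb_deg fm dd) v5.
have [a40 t5a t5b t5c] := nb_tri fm dd (T 5).
rewrite x5 /= in a40 t5a t5b t5c.
have av i := nb_adj fm i dd.
have d0 : 3 < deg a (x 0).
  by have := light vQ x0Q (av 0); rewrite v5 -[10]/(5 + 5) leq_add2l => /ltnW.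
have d1 : 3 < deg a (x 1).
  by have := light vQ x1Q (av 1); rewrite v5 -[10]/(5 + 5) leq_add2l => /ltnW.
pose e := (x 0, x 1); have de : dart a e by exact: a01.
rewrite leqNgt; apply/negP => lt8.
have ge3 := fm_flen_ge3 fm de.
pose y i := (iter i face e).1.
have yv i : flen e != 3 -> y i != v.
  apply: contraNneq => yv; have [di _ _ <-] := face_walk fm i de.
  rewrite [iter i face e]surjective_pairing -/(y i) yv; apply/eqP.
  have dvi : dart a (v, (iter i face e).2) by rewrite -yv -surjective_pairing.
  by have /iter_findex <- := fm_trans fm dd dvi erefl; rewrite (nbE fm).
have p1 : n (x 1, x 0) = (x 1, y 2).
  rewrite [LHS](_ : _ = face e) // [LHS]surjective_pairing (face_src mapn) /=.
  by congr pair; have [_ _ ->] := face_walk fm 1 de.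
have l1 : n (x 0, y (flen e).-1) = (x 0, x 1).
  have m0 : 0 < flen e by apply: ltn_trans ge3.
  have Em : face (iter (flen e).-1 face e) = e.
    by rewrite -iterS prednK // (iter_order (face_inj mapn)).
  have E2 : (iter (flen e).-1 face e).2 = x 0 by rewrite -(face_src mapn) Em.
  by rewrite -/e -[RHS]Em [in RHS](surjective_pairing (iter _ _ _)) E2.
have ap : a (x 1) (y 2).
  have : dart a (n (x 1, x 0)) by rewrite (map_dart mapn) /dart /= asym.
  by rewrite p1.
have al : a (x 0) (y (flen e).-1).
  by have : dart a (x 0, x 1) by []; rewrite -l1 (map_dart mapn).
have n1v : n (x 1, v) = (x 1, x 0) by rewrite -t1a.
have n12 : n (x 1, x 2) = (x 1, v) by rewrite -t2b.
have n01 : n (x 0, x 1) = (x 0, v) by rewrite -t1b.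
have n0v : n (x 0, v) = (x 0, x 4) by rewrite -t5a.
have pv : y 2 != v.
  by apply: (rot3 fm _ n1v p1); [rewrite asym | apply: ltn_trans d1].
have p2 : y 2 != x 2 by apply: (rot4 fm a12 n12 n1v p1).
have p3 : y 2 != x 3.
  by apply: contraTneq ap => ->; rewrite (nochord (i := 1) (j := 3)).
have p4 : y 2 != x 4.
  by apply: contraTneq ap => ->; rewrite (nochord (i := 1) (j := 4)).
set l := y (flen e).-1 in l1 al.
have lv : v != l by apply: (rot3 fm al l1 n01); apply: ltn_trans d0.
have l4 : x 4 != l by apply: (rot4 fm al l1 n01 n0v).
have l2 : x 2 != l.
  by rewrite eq_sym; apply: contraTneq al => ->; rewrite (nochord (i := 0) (j := 2)).
have l3 : x 3 != l.
  by rewrite eq_sym; apply: contraTneq al => ->; rewrite (nochord (i := 0) (j := 3)).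
have := nbu; rewrite /= !inE !negb_or => N; dand.
have FUC := face_ucycle fm de.
have FU : uniq [seq y i | i <- iota 0 (flen e)] := face_uniq fm de.
have rev p q : a p q -> a q p by rewrite asym.
have Ex0 : y 0 = x 0 by []. 
have Ex1 : y 1 = x 1 by rewrite /y /= (face_src mapn).
have El : l = y (flen e).-1 by [].
have ay i : a (y i) (y i.+1) by have [_ ? _ _] := face_walk fm i de.
clear l1; clearbody l y.
have rv0 := rev _ _ (av 0); have rv4 := rev _ _ (av 4); have rv1 := rev _ _ (av 1).
have rv2 := rev _ _ (av 2); have rp := rev _ _ ap; have rl := rev _ _ al.
have r40 := rev _ _ a40; have r12 := rev _ _ a12.
have ay2 := ay 2; have ay3 := ay 3; have ay4 := ay 4.
case Em: (flen e) ge3 lt8 => [|[|[|[|[|[|[|[|?]]]]]]]] // _ _;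
  rewrite Em in FU FUC yv; rewrite Em /= in El; last exact: noC7 FUC.
all: rewrite /= Ex0 Ex1 !inE !negb_or in FU; (try have {}yv := fun i => yv i isT); dand.
- subst l; apply: (noC7 (s := [:: x 0; y 2; x 1; x 2; x 3; x 4; v])) => //.
  rewrite /ucycle /=; apply/andP; split; last by uq.
  by rewrite al rp a12 a23 a34 rv4 av.
- subst l; apply: (noC7 (s := [:: x 1; y 2; y 3; x 0; x 4; x 3; v])) => //.
  rewrite /ucycle /=; apply/andP; split; last by uq.
  by rewrite ap ay2 rl (rev _ _ a40) (rev _ _ a34) (rev _ _ (av 3)) av.
- subst l; have qv := yv 3; have [q4|q4] := eqVneq (y 3) (x 4).
    apply: (noC7 (s := [:: x 1; y 2; y 3; y 4; x 0; v; x 2])) => //.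
    rewrite /ucycle /=; apply/andP; split; last by (rewrite q4 in qv *; uq).
    by rewrite ap ay2 ay3 rl rv0 av r12.
  apply: (noC7 (s := [:: x 1; y 2; y 3; y 4; x 0; x 4; v])) => //.
  rewrite /ucycle /=; apply/andP; split; last by uq.
  by rewrite ap ay2 ay3 rl (rev _ _ a40) rv4 av.
subst l; have qv := yv 3; have qw := yv 4.
  apply: (noC7 (s := [:: x 1; y 2; y 3; y 4; y 5; x 0; v])) => //.
  rewrite /ucycle /=; apply/andP; split; last by uq.
  by rewrite ap ay2 ay3 ay4 rl rv0 av.
Qed.

(** Likewise for the only face at [v] that is not a triangle. *)
Lemma four_fan_outer :
    (forall i, 0 < i < 5 -> flen (v, x i) = 3) -> flen (v, x 0) <> 3 ->
  8 <= flen (v, x 0).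
Proof.
move=> T nT.
have [a01 t1a t1b t1c] := nb_tri fm dd (T 1 isT).
have [a12 _ _ _] := nb_tri fm dd (T 2 isT).
have [a23 _ _ _] := nb_tri fm dd (T 3 isT).
have [a34 t4a t4b t4c] := nb_tri fm dd (T 4 isT).
have av i := nb_adj fm i dd.
have rev p q : a p q -> a q p by rewrite asym.
have nX p : p \notin (set0 : {set V}) by rewrite inE.
have d0 : 2 < deg a (x 0).
  by apply: (deg3_tri fm (nX _) (nX _) (nX _) (rev _ _ (av 0)) a01 (av 1) core_gt3).
have d4 : 2 < deg a (x 4).
  by apply: (deg3_tri fm (nX _) (nX _) (nX _) (rev _ _ (av 4)) (rev _ _ a34) (av 3) core_gt3).
have de : dart a (v, x 0) by exact: av.
pose e := (v, x 0); rewrite -/e in de nT *.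
rewrite leqNgt; apply/negP => lt8.
have ge3 := fm_flen_ge3 fm de.
pose y i := (iter i face e).1.
have x5 : x 5 = x 0 by rewrite -(nb_deg fm dd) v5.
have Em : face (iter (flen e).-1 face e) = e.
  by rewrite -iterS prednK ?(iter_order (face_inj mapn)) // (ltn_trans _ ge3).
have El : iter (flen e).-1 face e = (x 4, v).
  apply: (face_inj mapn); rewrite Em.
  by have := nb_face fm 4 dd; rewrite x5.
have p1 : n (x 0, v) = (x 0, y 2).
  rewrite [LHS](_ : _ = face e) // [LHS]surjective_pairing (face_src mapn) /=.
  by congr pair; have [_ _ ->] := face_walk fm 1 de.
have y4 : y (flen e).-1 = x 4 by rewrite /y El.
have m1 : (flen e).-2.+1 = (flen e).-1 by case: (flen e) ge3 => [|[|[|]]].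
have q1 : n (x 4, y (flen e).-2) = (x 4, v).
  have E2 : (iter (flen e).-2 face e).2 = x 4.
    have [_ _ -> _] := face_walk fm (flen e).-2 de.
    by rewrite m1 El.
  rewrite -El -m1 iterS [in RHS](surjective_pairing (iter _ _ _)) E2.
  by rewrite faceE.
have ap : a (x 0) (y 2).
  have : dart a (n (x 0, v)) by rewrite (map_dart mapn) /dart /= asym.
  by rewrite p1.
have aq : a (x 4) (y (flen e).-2).
  have : dart a (x 4, v) by rewrite /dart /= asym; apply: av.
  by rewrite -q1 (map_dart mapn).
have n01 : n (x 0, x 1) = (x 0, v) by rewrite -t1b.
have n4v : n (x 4, v) = (x 4, x 3) by rewrite -t4a.
have y_1 : y 2 != x 1 by apply: (rot3 fm a01 n01 p1 d0).
have y_2 : y 2 != x 2.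
  by apply: contraTneq ap => ->; rewrite (nochord (i := 0) (j := 2)).
have y_3 : y 2 != x 3.
  by apply: contraTneq ap => ->; rewrite (nochord (i := 0) (j := 3)).
have z_3 : x 3 != y (flen e).-2 by apply: (rot3 fm aq q1 n4v d4).
have z_1 : x 1 != y (flen e).-2.
  by rewrite eq_sym; apply: contraTneq aq => ->; rewrite asym (nochord (i := 1) (j := 4)).
have z_2 : x 2 != y (flen e).-2.
  by rewrite eq_sym; apply: contraTneq aq => ->; rewrite asym (nochord (i := 2) (j := 4)).
have := nbu; rewrite /= !inE !negb_or => N; dand.
have FUC := face_ucycle fm de.
have FU : uniq [seq y i | i <- iota 0 (flen e)] := face_uniq fm de.
have Ey0 : y 0 = v by [].
have Ey1 : y 1 = x 0 by rewrite /y /= (face_src mapn).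
have ay i : a (y i) (y i.+1) by have [_ ? _ _] := face_walk fm i de.
have ay2 := ay 2; have ay3 := ay 3; have ay4 := ay 4.
have rv0 := rev _ _ (av 0); have rv4 := rev _ _ (av 4).
have rv3 := rev _ _ (av 3); have rv2 := rev _ _ (av 2).
have rp := rev _ _ ap; have rq := rev _ _ aq; have rv1 := rev _ _ (av 1).
have r01 := rev _ _ a01; have r34 := rev _ _ a34; have av4 := av 4.
have av3 := av 3; have r2 := rev _ _ ay2; have r3 := rev _ _ ay3; have r4 := rev _ _ ay4.
clear q1; clearbody y.
case El': (flen e) ge3 lt8 nT => [|[|[|[|[|[|[|[|?]]]]]]]] // _ _ _;
  rewrite El' in FU FUC aq rq z_1 z_2 z_3 y4; last exact: noC7 FUC.
all: rewrite /= Ey0 Ey1 !inE !negb_or in FU;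
  rewrite /= in aq rq z_1 z_2 z_3 y4; rewrite ?y4 in FU ay2 ay3 ay4 r2 r3 r4; dand.
- apply: (noC7 (s := [:: v; x 4; y 2; x 0; x 1; x 2; x 3])) => //.
  rewrite /ucycle /=; apply/andP; split; last by uq.
  by rewrite av4 aq rp a01 a12 a23 rv3.
- apply: (noC7 (s := [:: v; x 4; y 3; y 2; x 0; x 1; x 2])) => //.
  rewrite /ucycle /=; apply/andP; split; last by uq.
  by rewrite av4 aq r2 rp a01 a12 rv2.
have [w1|w1] := eqVneq (y 3) (x 1).
  apply: (noC7 (s := [:: v; x 3; x 4; y 4; y 3; y 2; x 0])) => //.
  rewrite /ucycle /=; apply/andP; split; last by (rewrite w1; uq).
  by rewrite av3 a34 aq r3 r2 rp rv0.
apply: (noC7 (s := [:: v; x 4; y 4; y 3; y 2; x 0; x 1])) => //.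
rewrite /ucycle /=; apply/andP; split; last by uq.
by rewrite av4 aq r3 r2 rp a01 rv1.
Qed.

End FiveVertex.

Local Open Scope ring_scope.

(** With at most three triangles, 1/3 each is affordable. With four, the fifth
    face is long and two of them pay at most 1/6. With five, a triangle whose
    outer side avoids [Q] pays at most 1/6, and the neighbours of [v] in [Q] are
    at most two consecutive ones, being pairwise adjacent. *)
Lemma five_pays v x0 : a v x0 -> deg a v = 5%N -> v \notin Q ->
    flen (v, x0) <> 3%N \/ (forall y, a v y -> flen (v, y) = 3%N) ->
  node_sum a pay v <= 1.
Proof.
move=> vx0 v5 vQ T.
pose d := (v, x0); have dd : dart a d by [].
pose x := nb n d.
have vN : big v = false by rewrite /big (negPf vQ) v5.
have payT j : flen (v, x j.+1) = 3%N -> pay (v, x j.+1) =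
    toll R false true (big (x j.+1) + big (x j)) (hasB (v, x j.+1)).
  move=> f3; have [_ t1 _ _] := nb_tri fm dd f3.
  by rewrite /pay f3 eqxx vN /= v5 eqxx /nbig t1 /= vN.
have payN j : flen (v, x j) <> 3%N -> pay (v, x j) = 0.
  by move=> /eqP/negPf nf3; rewrite /pay nf3.
have le13 i : pay (v, x i) <= 1 / 3.
  rewrite /pay vN; case: ifP => _; [exact: toll_le3 | lra].
have sumE : node_sum a pay v =
    pay (v, x 0) + pay (v, x 1) + pay (v, x 2) + pay (v, x 3) + pay (v, x 4).
  rewrite (node_sumE fm pay dd) v5 !big_ord_recl big_ord0 addr0.
  rewrite (nbE fm _ dd) (nbE fm _ dd) (nbE fm _ dd) (nbE fm _ dd) (nbE fm _ dd).
  by rewrite !addrA.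
case: (eqVneq (flen (v, x 0)) 3%N) => [T0|/eqP nT0]; last first.
  have p0 := payN 0%N nT0; rewrite sumE p0.
  case: (eqVneq (flen (v, x 1)) 3%N) => [T1|/eqP/payN->]; last first.
    by have := le13 2%N; have := le13 3%N; have := le13 4%N; lra.
  case: (eqVneq (flen (v, x 2)) 3%N) => [T2|/eqP/payN->]; last first.
    by have := le13 1%N; have := le13 3%N; have := le13 4%N; lra.
  case: (eqVneq (flen (v, x 3)) 3%N) => [T3|/eqP/payN->]; last first.
    by have := le13 1%N; have := le13 2%N; have := le13 4%N; lra.
  case: (eqVneq (flen (v, x 4)) 3%N) => [T4|/eqP/payN->]; last first.
    by have := le13 1%N; have := le13 2%N; have := le13 3%N; lra.
  have T' i : (0 < i < 5)%N -> flen (v, x i) = 3%N.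
    by case: i => [|[|[|[|[|?]]]]].
  have B0 := four_fan_outer vx0 v5 T' nT0.
  have x5 : x 5 = x 0 by rewrite /x -(nb_deg fm dd) v5.
  have h1 : pay (v, x 1) <= 1 / 6.
    rewrite payT // (_ : hasB _ = true); last first.
      have [_ t1 t2 _] := nb_tri fm dd T1; rewrite /hasB t1 t2 /swapd /= B0 !orbT //.
    by rewrite /toll /=; case: (_ + _)%N => [|[|?]]; lra.
  have h4 : pay (v, x 4) <= 1 / 6.
    rewrite payT // (_ : hasB _ = true); last first.
      rewrite /hasB /swapd /= -(fm_flen_face fm (x 4, v)).
      by rewrite (nb_face fm 4 dd) -/(x 5) x5 /= B0.
    by rewrite /toll /=; case: (_ + _)%N => [|[|?]]; lra.
  by have := le13 2%N; have := le13 3%N; lra.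
have {}T i : flen (v, x i) = 3%N.
  by case: T => [|h]; [rewrite -[x0]/(x 0) T0 | apply: h; apply: (nb_adj fm i dd)].
have shift k j : nb n (v, x k) j = x (j + k)%N.
  by rewrite /x /nb -[(v, _)](nbE fm k dd) -iterD.
have x5 : x 5 = x 0 by rewrite /x -(nb_deg fm dd) v5.
have outer k : x k \notin Q -> x k.+1 \notin Q -> pay (v, x k.+1) <= 1 / 6.
  move=> kQ k1Q; have B : (8 <= flen (x k, x k.+1))%N.
    have := @full_star_outer v (x k) (nb_adj fm k dd) v5 vQ.
    rewrite !shift add0n add1n; apply=> // i; rewrite shift; exact: T.
  have [_ t1 _ _] := nb_tri fm dd (T k.+1).
  rewrite payT // (_ : hasB _ = true).
    by rewrite /toll /=; case: (_ + _)%N => [|[|?]]; lra.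
  by rewrite /hasB t1 /swapd /= B orbT.
have oneQ k : x k \in Q \/ x k.+1 \in Q -> pay (v, x k.+1) <= 1 / 4.
  move=> kQ; rewrite payT //.
  by apply: toll_le4; rewrite /big; case: kQ => -> //; rewrite addn1.
have twoQ k : x k \in Q -> x k.+1 \in Q -> pay (v, x k.+1) <= 0.
  by move=> kQ k1Q; rewrite payT // /big kQ k1Q /toll /=; lra.
have qq i j : (i < j < 5)%N -> x i \in Q -> x j \in Q -> j = i.+1 \/ i = 0%N /\ j = 4%N.
  move=> /andP[lij lj] iQ jQ; have ltj : (j < deg a d.1)%N by rewrite v5.
  have ne : x i != x j.
    apply/eqP => E; have E' := nb_inj fm dd (ltn_trans lij ltj) ltj E.
    by move: lij; rewrite E' ltnn.
  have [|[-> E]] := chord5 dd lij ltj (fm_clique fm iQ jQ ne); first by left.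
  by right; split=> //; move: E; rewrite v5 => -[].
have bnd k : pay (v, x k.+1) <= (if x k \in Q then (if x k.+1 \in Q then 0 else 1 / 4)
    else (if x k.+1 \in Q then 1 / 4 else 1 / 6)).
  case: ifP => h1; case: ifP => h2.
  - exact: twoQ.
  - by apply: oneQ; left.
  - by apply: oneQ; right.
  by apply: outer; rewrite ?h1 ?h2.
have no i j : (i < j < 5)%N -> j != i.+1 -> ~~ ((i == 0%N) && (j == 4%N)) ->
    ~~ ((x i \in Q) && (x j \in Q)).
  move=> lij h1 h2; apply/negP => /andP[iQ jQ].
  have [E|[E1 E2]] := qq i j lij iQ jQ; first by rewrite E eqxx in h1.
  by rewrite E1 E2 in h2.
have b0 := bnd 0%N; have b1 := bnd 1%N; have b2 := bnd 2%N; have b3 := bnd 3%N.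
have := bnd 4%N; rewrite x5 => b4.
have := no 0%N 2%N isT isT isT; have := no 0%N 3%N isT isT isT.
have := no 1%N 3%N isT isT isT; have := no 1%N 4%N isT isT isT.
have := no 2%N 4%N isT isT isT; rewrite sumE.
move: b0 b1 b2 b3 b4.
by case: (x 0 \in Q); case: (x 1 \in Q); case: (x 2 \in Q); case: (x 3 \in Q);
   case: (x 4 \in Q) => //= *; lra.
Qed.

(** Five consecutive triangles contain a 7-cycle through the centre. *)
Lemma no_five_fan d : dart a d -> (5 < deg a d.1)%N ->
  exists2 i, (0 < i < 6)%N & flen (d.1, nb n d i) <> 3%N.
Proof.
move=> dd d6; case: (boolP [exists i : 'I_6, (0 < i)%N && (flen (d.1, nb n d i) != 3%N)]).
  case/existsP=> i /andP[i0 /eqP nf]; exists i => //; by rewrite i0 ltn_ord.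
move/existsPn => no.
have T i : (0 < i < 6)%N -> flen (d.1, nb n d i) = 3%N.
  move=> /andP[i0 i6]; have := no (Ordinal i6); rewrite /= i0 negbK.
  by move/eqP.
have [a01 _ _ _] := nb_tri fm dd (T 1%N isT).
have [a12 _ _ _] := nb_tri fm dd (T 2%N isT).
have [a23 _ _ _] := nb_tri fm dd (T 3%N isT).
have [a34 _ _ _] := nb_tri fm dd (T 4%N isT).
have [a45 _ _ _] := nb_tri fm dd (T 5%N isT).
have nbu := nb_uniq fm dd d6.
case: (noC7 (s := d.1 :: [seq nb n d i | i <- iota 0 6])) => //.
rewrite /ucycle nbu andbT /= (nb_adj fm) // a01 a12 a23 a34 a45 /=.
by rewrite asym (nb_adj fm).
Qed.

(** Besides the tolls, a face of length at least 8 can give 1/2 across each of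
    its sides, as 1 - 4/8 = 1/2. A vertex of degree 6 has at most four triangles
    to pay, and a vertex of higher degree misses at least one. *)
Lemma no_seven_cycle_light : False.
Proof.
have big_or x y : a x y -> big x = false -> big y = false ->
    (deg a x == 5%N) && (deg a y == 5%N).
  move=> xy; rewrite /big => /negbT; rewrite negb_or -leqNgt => /andP[xQ x5].
  move=> /negbT; rewrite negb_or -leqNgt => /andP[yQ y5].
  by have := light xQ yQ xy; rewrite !eqn_leq x5 y5 /=; lia.
have pay_le d : pay d <= (flen d == 3%N)%:R / 2.
  rewrite /pay; case: (flen d == 3%N); last by rewrite mul0r.
  exact: toll_le.
have pay_ge0 d : 0 <= pay d by rewrite /pay; case: ifP => _ //; exact: toll_ge0.
(* What the face across a side gives to a triangle. *)
pose r d : R := if (flen d == 3%N) && (8 <= flen (swapd d))%N then 1 / 2 else 0.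
pose w d : R := (1 - 4 / (deg a d.1)%:R) + - pay d.
have nodeE v : (0 < deg a v)%N ->
    node_sum a w v = (deg a v)%:R - 4 - node_sum a pay v.
  by move=> dv; rewrite -(node_vertex R dv) /w node_sumD [X in _ + X]sumrN.
apply: (discharge fm (w := w)).
- rewrite -subr_ge0 -sumrB.
  rewrite (_ : \sum_(d | dart a d) _ =
    \sum_(d | dart a d) (1 - 4 / (flen d)%:R + pay d + (r d - r (swapd d)))); last first.
    rewrite [RHS]big_split /= [X in _ = _ + X]sumrB (sum_swapd fm) subrr addr0.
    by apply: eq_bigr => d _; rewrite /w; lra.
  apply: (sum_faces_ge0 fm) => [[x y] xy f3|d dd nf3].
    have [z [yz zx E1 E2 E3]] := flen3P fm xy f3.
    have f1 : flen (y, z) = 3%N by rewrite -E1 (fm_flen_face fm).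
    have f2 : flen (z, x) = 3%N by rewrite -E2 (fm_flen_face fm).
    rewrite E1 E2 f3 f1 f2 /r /swapd /= f3 f1 f2 /= !andbF !subr0.
    have orE p q : a p q -> big p || big q || (deg a p == 5%N) && (deg a q == 5%N).
      by move=> pq; case bp: (big p) => //; case bq: (big q) => //; exact: big_or.
    have := toll_triangle R (8 <= flen (y, x))%N (8 <= flen (z, y))%N (8 <= flen (x, z))%N
      (orE _ _ xy) (orE _ _ yz) (orE _ _ zx).
    have -> : pay (x, y) = toll R (big x) (deg a x == 5%N) (big x + big y + big z)
        [|| 8 <= flen (y, x), 8 <= flen (z, y) | 8 <= flen (x, z)]%N.
      by rewrite /pay f3 eqxx /nbig /hasB E1 E2.
    have -> : pay (y, z) = toll R (big y) (deg a y == 5%N) (big x + big y + big z)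
        [|| 8 <= flen (y, x), 8 <= flen (z, y) | 8 <= flen (x, z)]%N.
      rewrite /pay f1 eqxx /nbig /hasB E2 E3 /swapd /=; congr (toll _ _ _ _ _).
        by rewrite addnC addnA.
      by rewrite orbA orbC.
    have -> : pay (z, x) = toll R (big z) (deg a z == 5%N) (big x + big y + big z)
        [|| 8 <= flen (y, x), 8 <= flen (z, y) | 8 <= flen (x, z)]%N.
      rewrite /pay f2 eqxx /nbig /hasB E3 E1 /swapd /=; congr (toll _ _ _ _ _).
        by rewrite -addnA addnC.
      by rewrite orbC orbA.
    by [].
  have h4 : (4 <= flen d)%N.
    by rewrite ltn_neqAle (fm_flen_ge3 fm dd) andbT eq_sym; apply/eqP.
  have f0 : 0 < (flen d)%:R :> R by rewrite ltr0n; apply: leq_trans h4.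
  have hk : 4 / (flen d)%:R <= 1 :> R by rewrite ler_pdivrMr // mul1r (ler_nat _ 4).
  rewrite /r swapdK; move/eqP/negPf: (nf3) => ->; have := pay_ge0 d.
  case: (flen (swapd d) == 3%N) => /=; last by lra.
  case: (leqP 8 (flen d)) => [h8|_]; last by lra.
  have : 4 / (flen d)%:R <= 1 / 2 :> R.
    by rewrite ler_pdivrMr //; have : 8 <= (flen d)%:R :> R; [rewrite (ler_nat _ 8)|lra].
  by lra.
- move=> v vU vQ; have d4 := deg4 vU vQ.
  have d40 : (0 < deg a v)%N by apply: leq_trans d4.
  rewrite nodeE //; have [y0 y0P] : exists y, a v y by apply/card_gt0P: d40.
  (* The numbering starts at a corner that is not a triangle, if there is one. *)
  have [y [vy yP]] : exists y, a v y /\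
      (flen (v, y) <> 3%N \/ forall y, a v y -> flen (v, y) = 3%N).
    case: (boolP [exists y, a v y && (flen (v, y) != 3%N)]).
      by case/existsP=> y /andP[vy /eqP nf]; exists y; split=> //; left.
    move/existsPn => no; exists y0; split=> //; right=> y vy.
    by have := no y; rewrite vy negbK => /eqP.
  have [le5|gt5] := leqP (deg a v) 5.
    have [E|ne5] := eqVneq (deg a v) 5%N.
      by have := five_pays vy E vQ yP; rewrite E; lra.
    have E4 : deg a v = 4%N.
      by apply/eqP; rewrite eqn_leq d4 andbT -ltnS ltn_neqAle ne5.
    rewrite E4 subrr sub0r oppr_ge0.
    apply: sumr_le0 => d /andP[dd /eqP dv].
    by rewrite /pay /big dv (negPf vQ) E4 /=; case: ifP.
  have dd : dart a (v, y) by [].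
  have [i i6 nfi] := no_five_fan dd gt5.
  pose t d : R := (flen d == 3%N)%:R.
  have t_le d : t d <= 1 by rewrite /t; case: (_ == _).
  have le_t : node_sum a pay v <= node_sum a t v / 2.
    have -> : node_sum a t v / 2 = node_sum a (fun d => 1 / 2 * t d) v.
      by rewrite node_sumZ; lra.
    by apply: le_node_sum => d _ _; have := pay_le d; rewrite /t; lra.
  have nf0 : flen (v, y) <> 3%N.
    case: yP => // all3; case: nfi; apply: all3; exact: (nb_adj fm i dd).
  have t0 : t (v, y) = 0 by rewrite /t; move/eqP/negPf: nf0 => ->.
  have tE := node_sumE fm t dd; rewrite /= in tE.
  have tle : node_sum a t v <= (deg a v)%:R - 1.
    rewrite tE; case: (deg a v) d40 => // k _; rewrite big_ord_recl /= t0 add0r.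
    apply: (@le_trans _ _ (\sum_(j < k) 1)); first exact: ler_sum.
    by rewrite sumr_const card_ord -natr1; lra.
  have [E6|ne6] := eqVneq (deg a v) 6%N; last first.
    have : 7 <= (deg a v)%:R :> R by rewrite (ler_nat _ 7) ltn_neqAle eq_sym ne6.
    by lra.
  suff : node_sum a t v <= 4 by rewrite E6; lra.
  have tN j : iter j n (v, y) = (v, nb n (v, y) j) by rewrite (nbE fm).
  have ti : t (v, nb n (v, y) i) = 0 by rewrite /t; move/eqP/negPf: nfi => ->.
  rewrite -tN in ti; rewrite tE E6.
  exact: (two_gaps (f := fun j => t (iter j n (v, y))) t0 (fun j => t_le _) i6 ti).
move=> q qQ; rewrite nodeE ?(deg_Q fm) //.
have : node_sum a pay q <= node_sum a (fun=> 1 / 2) q.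
  apply: le_node_sum => d _ _; have := pay_le d; case: (_ == _) => /=; lra.
rewrite node_const; have := fm_Q3 fm; have := deg_Q3 fm qQ; have := card_Q qQ.
have : 1 <= (deg a q)%:R :> R by rewrite (ler_nat _ 1) (deg_Q fm).
move: (node_sum _ _ _) => s.
case: #|Q| => [|[|[|[|]]]] // h1 _; rewrite -?(ler_nat R) => h2 _ h3; lra.
Qed.

End NoSevenCycle.

(** * Graphs without 6-cycles: the corners of a vertex *)
Section NoSixCycle.
Variables (V : finType) (a : rel V) (n : V * V -> V * V) (U Q X : {set V}).
Hypothesis fm : frag_map a n U Q X.
Hypothesis noC6 : forall s : seq V, size s = 6 -> ucycle a s -> False.

Local Notation face := (face n).
Local Notation flen := (flen n).
Local Notation asym := (fm_sym fm).
Local Notation airr := (fm_irr fm).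
Local Notation mapn := (fm_map fm).

Let adj_ne x y : a x y -> x != y.
Proof. by apply: contraTneq => ->; rewrite airr. Qed.

Let rev x y : a x y -> a y x. Proof. by rewrite asym. Qed.

Let nbh_card x : #|[set y | a x y]| = deg a x.
Proof. by rewrite /deg -[#|a x|]cardsE; apply: eq_card => y; rewrite !inE. Qed.

Section Center.
Variable v : V.
Hypothesis v5 : 4 < deg a v.

Let vX : v \notin X.
Proof. by apply: contraL v5 => /(fm_hub fm)[-> _]. Qed.

(** If at most three vertices are not hubs, then the neighbours of [v] include
    three hubs, all with the same neighbourhood [v], [p], [q], and these six
    vertices carry a 6-cycle. *)
Lemma core_gt3 : 3 < #|U :\: X|.
Proof.
rewrite ltnNge; apply/negP => le3.
have sub x y : x \in X -> a x y -> y \in (U :\: X) :\ x.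
  move=> xX xy; rewrite !inE (fm_indep fm xX xy) (fm_in fm (rev xy)) andbT.
  by rewrite eq_sym (adj_ne xy).
have full x y : x \in X -> y \in U :\: X -> a x y.
  move=> xX yW; have [d3 _] := fm_hub fm xX.
  have s : [set z | a x z] \subset U :\: X.
    by apply/subsetP => z; rewrite inE => /(sub _ _ xX); rewrite in_setD1 => /andP[].
  have : [set z | a x z] == U :\: X.
    by rewrite eqEcard s nbh_card d3.
  by move/eqP/setP/(_ y); rewrite inE yW.
have W3 : #|U :\: X| = 3 \/ forall x, x \notin X.
  case: (boolP [exists x, x \in X]) => [/existsP[x xX]|/existsPn]; last by right.
  left; apply/eqP; rewrite eqn_leq le3 -(fm_hub fm xX).1 -nbh_card.
  apply: subset_leq_card; apply/subsetP => z; rewrite inE => /(sub _ _ xX).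
  by rewrite in_setD1 => /andP[].
have vU : v \in U by have [y /(fm_in fm)] : exists y, a v y by apply/card_gt0P; apply: ltn_trans v5.
have vW : v \in U :\: X by rewrite inE vX.
have cardN : #|[set y | a v y] :&: X| + #|[set y | a v y] :\: X| = deg a v.
  by rewrite cardsID nbh_card.
have NW : #|[set y | a v y] :\: X| < #|U :\: X|.
  apply: proper_card; apply/properP; split.
    apply: setSD; apply/subsetP => y; rewrite inE => /rev; exact: (fm_in fm).
  by exists v => //; rewrite !inE airr andbF.
have : 2 < #|[set y | a v y] :&: X|.
  move: cardN v5 NW le3; move: (#|_ :&: X|) (#|_ :\: X|) => p q; lia.
case: W3 => [W3|no _]; last first.
  have : #|[set y | a v y] :&: X| = 0.
    by apply: eq_card0 => z; rewrite inE (negPf (no z)) andbF.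
  by move: cardN v5 NW le3 => + + + + E; rewrite E; lia.
move=> /card_gt2P[x1 [x2 [x3 [[]]]]]; rewrite !inE => /andP[_ X1] /andP[_ X2] /andP[_ X3] [n12 n23 n31].
have : 1 < #|(U :\: X) :\ v| by have := cardsD1 v (U :\: X); rewrite vW W3 add1n => -[<-].
case/card_gt1P=> p [q []]; rewrite !in_setD1 => /andP[pv pW] /andP[qv qW] npq.
have h x y : x \in X -> y \in U :\: X -> [&& a x y, a y x, x != y & y != x].
  by move=> xX yW; have xy := full _ _ xX yW; rewrite xy (rev xy) (adj_ne xy) (adj_ne (rev xy)).
have := h _ _ X1 vW; have := h _ _ X1 pW; have := h _ _ X2 pW; have := h _ _ X2 qW.
have := h _ _ X3 qW; have := h _ _ X3 vW; have := h _ _ X1 qW; have := h _ _ X2 vW.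
have := h _ _ X3 pW; move=> *; timeout 5 dand.
apply: (noC6 (s := [:: v; x1; p; x2; q; x3])) => //.
rewrite /ucycle /=; apply/andP; split; last timeout 20 by uq.
by repeat match goal with H : is_true ?b |- context [?b] => rewrite H /= end.
Qed.

(** A corner of a triangle is not all there is at [y], even when [y] is a root. *)
Lemma tri_side y z : a v y -> a v z -> a y z -> 2 < deg a y.
Proof.
move=> vy vz yz; case: (boolP (y \in X)) => [/(fm_hub fm)[-> _] //|yX].
case: (boolP (z \in X)) => [zX|zX]; last first.
  by apply: (deg3_tri fm yX vX zX (rev vy) yz vz core_gt3).
have [d3 cl] := fm_hub fm zX.
have [w [zw wv wy]] : exists w, [/\ a z w, w != v & w != y].
  have : 0 < #|[set w | a z w] :\ v :\ y|.
    have := cardsD1 v [set w | a z w]; have := cardsD1 y ([set w | a z w] :\ v).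
    rewrite nbh_card d3; move: (_ \in _) (_ \in _) => [] [] /=; lia.
  by case/card_gt0P=> w; rewrite !inE => /and3P[wy wv zw]; exists w.
have yw : a y w by apply: cl; rewrite // 1?(rev yz) // eq_sym.
have : #|[set v; z; w]| = 3.
  by rewrite -setUA cardsU1 cards2 !inE negb_or (adj_ne vz) (adj_ne zw) eq_sym wv.
move <-; apply: subset_leq_card; apply/subsetP => p; rewrite !inE -orbA.
by move=> /or3P[]/eqP->; [exact: rev|exact: yz|].
Qed.

Variable x0 : V.
Hypothesis vx0 : a v x0.
Let d := (v, x0).
Let dd : dart a d. Proof. exact: vx0. Qed.
Local Notation x := (nb n d).
Local Notation T i := (flen (v, x i) = 3).

Let av i : a v (x i). Proof. exact: (nb_adj fm i dd). Qed.

Let xinj i j : i < deg a v -> j < deg a v -> x i = x j -> i = j.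
Proof. exact: (nb_inj fm dd). Qed.

Let hub_next z k : z \in X -> a v z -> a v (x k) -> a z (x k) ->
  z = x k.+1 /\ T k.+1 \/ n (v, z) = (v, x k) /\ T k.
Proof.
move=> zX vz vk zk; have [[z' z'X E]|[[E1 E2]|[E1 E2]]] := fm_tri fm vz zk vk.
- have := fm_indep fm z'X; have := E z; rewrite !inE eqxx orbT /= => e /(_ z e).
  by rewrite zX.
- by right.
by left; move: E1 E2; rewrite (nbS fm _ dd) => -[->].
Qed.

(** The triangle formed by [v] and two adjacent neighbours is a face, or it
    surrounds a hub; in the second case the hub is the neighbour of [v] in
    between, and the two triangles at the hub are faces. *)
Lemma chord6 k : 0 < k < deg a v -> a (x 0) (x k) ->
  [\/ k = 1 /\ T 1, k.+1 = deg a v, k = 2 /\ (T 1 /\ T 2) |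
      k.+2 = deg a v /\ (T k.+1 /\ T k.+2)].
Proof.
move=> /andP[k0 kd] ak; have d0 : 0 < deg a v by apply: ltn_trans kd.
have per : x (deg a v) = x 0 := nb_deg fm dd.
have [[z zX E]|[[E T1]|[E T1]]] := fm_tri fm (av 0) ak (av k); last 2 first.
- constructor 1; move: E T1; rewrite (nbS fm _ dd) => -[E] T1; rewrite E; split=> //.
  by symmetry; apply: xinj => //; apply: ltn_trans v5.
- constructor 2; move: E; rewrite (nbS fm _ dd) => -[E].
  have [ltk|] := ltnP k.+1 (deg a v); last by move=> ?; apply/eqP; rewrite eqn_leq kd.
  by have := xinj ltk d0 E.
have zv : a v z by apply: rev; rewrite E !inE eqxx.
have z0 : a z (x 0) by rewrite E !inE eqxx orbT.
have zk : a z (x k) by rewrite E !inE eqxx orbT.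
have [[Ez T1]|[Ez T0]] := hub_next zX zv (av 0) z0;
  have [[Ez' T1']|[Ez' T1']] := hub_next zX zv (av k) zk.
- have [ltk|] := ltnP k.+1 (deg a v); last first.
    by move=> ?; constructor 2; apply/eqP; rewrite eqn_leq kd.
  by have := xinj (ltn_trans (isT : 1 < 4) v5) ltk; rewrite -Ez -Ez' => /(_ erefl) [] E0; rewrite -E0 in k0.
- have E2 : x 2 = x k by move: Ez'; rewrite Ez (nbS fm _ dd) => -[].
  have k2 : 2 = k by apply: xinj => //; apply: ltn_trans v5.
  by constructor 3; rewrite -k2 in T1' *.
- constructor 4; move: Ez; rewrite Ez' (nbS fm _ dd) => -[E2].
  have kd2 : k.+2 = deg a v.
    have [lt2|] := ltnP k.+2 (deg a v); first by have := xinj lt2 d0 E2.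
    rewrite leq_eqVlt => /orP[/eqP->//|]; rewrite ltnS => le1.
    have k1 : k.+1 = deg a v by apply/eqP; rewrite eqn_leq kd.
    have : x 0 = z by rewrite -per -k1 Ez'.
    by move=> E0; have := adj_ne z0; rewrite E0 eqxx.
  by rewrite kd2 per; split.
have : x 0 = x k by move: Ez; rewrite Ez' => -[].
by move/(xinj d0 kd) => E0; rewrite -E0 in k0.
Qed.

Lemma quad i : flen (v, x i.+1) = 4 -> exists y,
  [/\ [&& a (x i.+1) y, a y (x i) & uniq [:: v; x i.+1; y; x i]],
      n (x i.+1, v) = (x i.+1, y) & n (x i, y) = (x i, v)].
Proof.
move=> f4; have de : dart a (v, x i.+1) := av i.+1.
have [d1 a1 e1 _] := face_walk fm 1 de; have [d2 a2 e2 _] := face_walk fm 2 de.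
have [d3' a3 e3 _] := face_walk fm 3 de; have := face_uniq fm de; rewrite f4 => FU.
have E3 : iter 3 face (v, x i.+1) = (x i, v).
  apply: (face_inj mapn); rewrite -iterS [RHS](nb_face fm i dd) -[4]f4.
  exact: iter_order (face_inj mapn) _.
rewrite /= in E3; rewrite /= E3 in e2 a2 FU; rewrite /= in e1 a1.
set y := (face (face (v, x i.+1))).1 in a1 a2 e1 e2 FU.
have E1 : face (v, x i.+1) = (x i.+1, y).
  by rewrite [LHS]surjective_pairing e1 (face_src mapn).
have E2 : face (x i.+1, y) = (y, x i) by rewrite -E1 [LHS]surjective_pairing e2.
exists y; rewrite !faceE in E1 E2 E3; split; last 2 first.
- exact: E1.
- by move: E3; rewrite E1 E2.
by rewrite (face_src mapn) in a1 FU; rewrite a1 a2.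
Qed.

Lemma pent i : flen (v, x i.+1) = 5 -> exists y z,
  [/\ [&& a (x i.+1) y, a y z, a z (x i) & uniq [:: v; x i.+1; y; z; x i]],
      n (x i.+1, v) = (x i.+1, y) & n (x i, z) = (x i, v)].
Proof.
move=> f5; have de : dart a (v, x i.+1) := av i.+1.
have [_ a1 e1 _] := face_walk fm 1 de; have [_ a2 e2 _] := face_walk fm 2 de.
have [_ a3 e3 _] := face_walk fm 3 de; have := face_uniq fm de; rewrite f5 => FU.
have E4 : iter 4 face (v, x i.+1) = (x i, v).
  apply: (face_inj mapn); rewrite -iterS [RHS](nb_face fm i dd) -[5]f5.
  exact: iter_order (face_inj mapn) _.
rewrite /= in E4; rewrite /= E4 in e3 a3 FU; rewrite /= in e1 e2 a1 a2.
set y := (face (face (v, x i.+1))).1 in a1 a2 e1 e2 FU.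
set z := (face (face (face (v, x i.+1)))).1 in a2 a3 e2 e3 FU.
have E1 : face (v, x i.+1) = (x i.+1, y).
  by rewrite [LHS]surjective_pairing e1 (face_src mapn).
have E2 : face (x i.+1, y) = (y, z) by rewrite -E1 [LHS]surjective_pairing e2.
have E3 : face (y, z) = (z, x i) by rewrite -E2 -E1 [LHS]surjective_pairing e3.
exists y, z; rewrite !faceE in E1 E2 E3 E4; split; last 2 first.
- exact: E1.
- by move: E4; rewrite E1 E2 E3.
by rewrite (face_src mapn) in a1 FU; rewrite a1 a2 a3.
Qed.

Let chord1 : a (x 0) (x 1) -> T 1.
Proof.
have kd : 0 < 1 < deg a v by rewrite (leq_trans _ v5).
by move/(chord6 kd) => [[]|E|[]|[E _]] //; move: v5; rewrite -E.
Qed.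

Let skip_chord : a (x 0) (x 2) -> T 1 /\ T 2.
Proof.
have kd : 0 < 2 < deg a v by rewrite (leq_trans _ v5).
by move/(chord6 kd) => [[]|E|[]|[E _]] //; move: v5; rewrite -E.
Qed.

Let far_chord : a (x 0) (x 3) -> [/\ deg a v = 5, T 4 & T 5].
Proof.
have kd : 0 < 3 < deg a v by rewrite (leq_trans _ v5).
by move/(chord6 kd) => [[]|E|[]|[E [T4 T5]]] //; move: v5; rewrite -E.
Qed.

Let xne i j : i < j < 5 -> x i != x j.
Proof.
move=> /andP[ij j5]; have jd : j < deg a v by apply: leq_trans v5.
apply/eqP => /(xinj (ltn_trans ij jd) jd) E; by rewrite E ltnn in ij.
Qed.

Let tri i : T i.+1 -> [/\ a (x i) (x i.+1), n (x i.+1, v) = (x i.+1, x i),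
  n (x i, x i.+1) = (x i, v), 2 < deg a (x i) & 2 < deg a (x i.+1)].
Proof.
move=> f3; have [ai E1 E2 _] := nb_tri fm dd f3; split=> //.
  exact: tri_side (av i) (av i.+1) ai.
exact: tri_side (av i.+1) (av i) (rev ai).
Qed.

Lemma four_fan : T 1 -> T 2 -> T 3 -> T 4 -> False.
Proof.
move=> /tri[a01 _ _ _ _] /tri[a12 _ _ _ _] /tri[a23 _ _ _ _] /tri[a34 _ _ _ _].
have nbu := nb_uniq fm dd v5.
apply: (noC6 (s := v :: [seq x i | i <- iota 0 5])) => //.
by rewrite /ucycle nbu andbT /= av a01 a12 a23 a34 /= rev.
Qed.

Ltac ring6 := apply/andP; split; last by uq.
Ltac edges := repeat match goal with
  | H : is_true (a ?x ?y) |- context [a ?x ?y] => rewrite H /=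
  | H : is_true (a ?x ?y) |- context [a ?y ?x] => rewrite (rev H) /= end; done.

Let around := (xne (i := 0) (j := 1) isT, xne (i := 0) (j := 2) isT,
  xne (i := 0) (j := 3) isT, xne (i := 1) (j := 2) isT,
  xne (i := 1) (j := 3) isT, xne (i := 2) (j := 3) isT).

(** This lemma and the following ones exclude patterns of corners by explicit
    6-cycles through [v]. The vertices of such a cycle could only coincide in two
    ways: at a side shared with a triangle, excluded as its end has degree at
    least 3, or through a chord of the star of [v]. *)
Lemma tri_pent : T 1 -> flen (v, x 2) = 5 -> False.
Proof.
move=> T1 f2; have [a01 n1v n01 d0 d1] := tri T1.
have [y [z [/and4P[a2y ayz az1 u] p1 p2]]] := pent f2.
have z0 : x 0 != z by apply: (rot3 fm _ p2 n1v); first exact: rev.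
have y0 : x 0 != y.
  apply/eqP => E; rewrite -E in a2y.
  by have [_] := skip_chord (rev a2y); rewrite f2.
have := av 0; have := av 1; have := av 2; have := around.
move=> [[[[[? ?] ?] ?] ?] ?] v2 v1 v0; have := adj_ne v0; have := adj_ne v2; have := adj_ne v1.
move: u; rewrite /= !inE !negb_or => u *; dand.
apply: (noC6 (s := [:: v; x 0; x 1; z; y; x 2])) => //; rewrite /ucycle /=.
ring6; edges.
Qed.

Lemma pent_tri : flen (v, x 1) = 5 -> T 2 -> False.
Proof.
move=> f1 T2; have [a12 n2v n12 d1 d2] := tri T2.
have [y [z [/and4P[a1y ayz az0 u] p1 p2]]] := pent f1.
have y2 : y != x 2 by apply: (rot3 fm _ n12 p1).
have z2 : x 2 != z.
  apply/eqP => E; rewrite -E in az0.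
  by have [] := skip_chord (rev az0); rewrite f1.
have := av 0; have := av 1; have := av 2; have := around.
move=> [[[[[? ?] ?] ?] ?] ?] v2 v1 v0; have := adj_ne v0; have := adj_ne v2; have := adj_ne v1.
move: u; rewrite /= !inE !negb_or => u *; dand.
apply: (noC6 (s := [:: v; x 2; x 1; y; z; x 0])) => //; rewrite /ucycle /=.
ring6; edges.
Qed.

Lemma tri_quad_tri : T 1 -> flen (v, x 2) = 4 -> T 3 -> False.
Proof.
move=> T1 f2 T3; have [a01 n1v n01 d0 d1] := tri T1.
have [a23 n3v n23 d2 d3'] := tri T3.
have [y [/and3P[a2y ay1 u] p1 p2]] := quad f2.
have y0 : x 0 != y by apply: (rot3 fm _ p2 n1v); first exact: rev.
have y3 : y != x 3 by apply: (rot3 fm _ n23 p1).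
have := av 0; have := av 1; have := av 2; have := av 3; have := around.
move=> [[[[[? ?] ?] ?] ?] ?] v3 v2 v1 v0.
have := adj_ne v0; have := adj_ne v2; have := adj_ne v1; have := adj_ne v3.
move: u; rewrite /= !inE !negb_or => u *; dand.
apply: (noC6 (s := [:: v; x 0; x 1; y; x 2; x 3])) => //; rewrite /ucycle /=.
ring6; edges.
Qed.

(** The chord that could spoil the cycle requires degree 5 and two further
    triangles on the other side; that is a fan of four. *)
Lemma two_tri_quad : T 1 -> T 2 -> flen (v, x 3) = 4 -> [/\ deg a v = 5, T 4 & T 5].
Proof.
move=> T1 T2 f3; have [a01 n1v n01 d0 d1] := tri T1.
have [a12 n2v n12 _ d2] := tri T2.
have [y [/and3P[a3y ay2 u] p1 p2]] := quad f3.
have y1 : x 1 != y by apply: (rot3 fm _ p2 n2v); first exact: rev.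
have [E|y0] := eqVneq y (x 0).
  by apply: far_chord; rewrite -E rev.
case: notF; have := av 0; have := av 1; have := av 2; have := av 3; have := around.
move=> [[[[[? ?] ?] ?] ?] ?] v3 v2 v1 v0.
have := adj_ne v0; have := adj_ne v2; have := adj_ne v1; have := adj_ne v3.
move: u; rewrite /= !inE !negb_or => u *; dand.
case: (noC6 (s := [:: v; x 0; x 1; x 2; y; x 3])) => //; rewrite /ucycle /=.
ring6; edges.
Qed.

Lemma quad_two_tri : flen (v, x 1) = 4 -> T 2 -> T 3 -> [/\ deg a v = 5, T 4 & T 5].
Proof.
move=> f1 T2 T3; have [a12 n2v n12 d1 d2] := tri T2.
have [a23 _ _ _ _] := tri T3.
have [y [/and3P[a1y ay0 u] p1 p2]] := quad f1.
have y2 : y != x 2 by apply: (rot3 fm _ n12 p1).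
have [E|y3] := eqVneq y (x 3).
  by apply: far_chord; rewrite -E rev.
case: notF; have := av 0; have := av 1; have := av 2; have := av 3; have := around.
move=> [[[[[? ?] ?] ?] ?] ?] v3 v2 v1 v0.
have := adj_ne v0; have := adj_ne v2; have := adj_ne v1; have := adj_ne v3.
move: u; rewrite /= !inE !negb_or => u *; dand.
case: (noC6 (s := [:: v; x 0; y; x 1; x 2; x 3])) => //; rewrite /ucycle /=.
ring6; edges.
Qed.

Lemma two_quads : flen (v, x 1) = 4 -> flen (v, x 2) = 4 -> 2 < deg a (x 1) ->
  a (x 1) (x 2).
Proof.
move=> f1 f2 d1; have [y [/and3P[a1y ay0 u] p1 p2]] := quad f1.
have [z [/and3P[a2z az1 u'] q1 q2]] := quad f2.
have yz : y != z by exact: (rot3 fm (rev az1) q2 p1 d1).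
have [E|y2] := eqVneq y (x 2); first by rewrite -E.
have z0 : x 0 != z.
  by apply/eqP => E; have := chord1; rewrite E f1 => /(_ az1).
have := av 0; have := av 1; have := av 2; have := around.
move=> [[[[[? ?] ?] ?] ?] ?] v2 v1 v0.
have := adj_ne v0; have := adj_ne v2; have := adj_ne v1.
move: u u'; rewrite /= !inE !negb_or => u u' *; dand.
case: (noC6 (s := [:: v; x 0; y; x 1; z; x 2])) => //; rewrite /ucycle /=.
ring6; edges.
Qed.

Lemma chord_face : a (x 0) (x 1) -> T 1. Proof. exact: chord1. Qed.

Lemma nb_shift i j : nb n (v, x i) j = x (i + j).
Proof. by rewrite /nb -[(v, x i)](nbE fm i dd) addnC iterD. Qed.

Lemma nb_per i : x (i + deg a v) = x i.
Proof.
rewrite /nb iterD -[deg a v]/(deg a d.1) -(fm_order fm dd).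
by rewrite (iter_order (map_inj mapn)).
Qed.

End Center.

Lemma rebase v x0 i : a v x0 -> exists2 y, a v y &
  forall j, nb n (v, y) j.+1 = nb n (v, x0) (i + j).
Proof.
move=> vx0; have dv : 0 < deg a v by apply/card_gt0P; exists x0.
exists (nb n (v, x0) (i + (deg a v).-1)) => [|j].
  exact: (nb_adj fm _ (vx0 : dart a (v, x0))).
rewrite nb_shift // -(nb_per vx0 (i + j)) -!addnA.
by rewrite addnS -addSn prednK // [deg a v + j]addnC.
Qed.

Section Rim.
Variable v : V.
Hypothesis v5 : 4 < deg a v.

Lemma two_tri_quad_face x0 : a v x0 -> let x := nb n (v, x0) in
  flen (v, x 1) = 3 -> flen (v, x 2) = 3 -> flen (v, x 3) <> 4.
Proof.
move=> vx0 x T1 T2 f3; have [d5 T4 T5] := two_tri_quad v5 vx0 T1 T2 f3.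
have v3 : a v (x 3) := nb_adj fm 3 (vx0 : dart a (v, x0)).
have per i := nb_per vx0 i.
apply: (four_fan v5 v3); rewrite nb_shift //=.
- by rewrite /x -(per 1) d5 in T1.
- by rewrite /x -(per 2) d5 in T2.
Qed.

Lemma quad_two_tri_face x0 : a v x0 -> let x := nb n (v, x0) in
  flen (v, x 1) = 4 -> flen (v, x 2) = 3 -> flen (v, x 3) <> 3.
Proof.
move=> vx0 x f1 T2 T3; have [d5 T4 T5] := quad_two_tri v5 vx0 f1 T2 T3.
have v1 : a v (x 1) := nb_adj fm 1 (vx0 : dart a (v, x0)).
by apply: (four_fan v5 v1); rewrite nb_shift.
Qed.

Lemma two_quads_face x0 : a v x0 -> let x := nb n (v, x0) in
  flen (v, x 1) = 4 -> flen (v, x 2) = 4 -> deg a (x 1) <= 2.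
Proof.
move=> vx0 x f1 f2; rewrite leqNgt; apply/negP => d1.
have v1 : a v (x 1) := nb_adj fm 1 (vx0 : dart a (v, x0)).
have := two_quads v5 vx0 f1 f2 d1; rewrite -/x => a12.
have := chord_face v5 v1; rewrite !nb_shift // => /(_ a12) f3.
by rewrite -/x f2 in f3.
Qed.

End Rim.
End NoSixCycle.

(** * Words of corners *)

(** The faces around a vertex, by length: 3, 4, 5 and at least 7. *)
Variant corner := Tri | Quad | Pent | Long.

Definition is_tri c := if c is Tri then true else false.
Definition is_long c := if c is Long then true else false.

(** The cyclic words allowed around a vertex: [t i] and [t i.+1] are the faces
    on the two sides of the neighbour [i], and [s i] tells whether this neighbour
    is a 3-vertex. *)
Record wheel (t : nat -> corner) (s : nat -> bool) : Prop := Wheel {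
  wheel_fan : forall i, t i = Tri -> t i.+1 = Tri -> t i.+2 = Tri -> t i.+3 <> Tri;
  wheel_ttq : forall i, t i = Tri -> t i.+1 = Tri -> t i.+2 <> Quad;
  wheel_qtt : forall i, t i = Quad -> t i.+1 = Tri -> t i.+2 <> Tri;
  wheel_tp : forall i, t i = Tri -> t i.+1 <> Pent;
  wheel_pt : forall i, t i = Pent -> t i.+1 <> Tri;
  wheel_tqt : forall i, t i = Tri -> t i.+1 = Quad -> t i.+2 <> Tri;
  wheel_qq : forall i, t i = Quad -> t i.+1 = Quad -> s i = false;
  wheel_ss : forall i, t i.+1 = Tri -> s i -> s i.+1 = false }.

Lemma sum_shift (R : nmodType) (F : nat -> R) d m : (forall i, F (i + d)%N = F i) ->
  (\sum_(i < d) F (m + i)%N = \sum_(i < d) F i)%R.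
Proof.
move=> per; elim: m => // m <-.
case: d per => [|d] per; first by rewrite !big_ord0.
rewrite big_ord_recr [RHS]big_ord_recl /= addn0 addrC -(per m) addnS addSn.
by congr (_ + _)%R; apply: eq_bigr => i _; rewrite /bump /= addSnnS.
Qed.

Section Words.
Variable R : realFieldType.
Local Open Scope ring_scope.

(** A triangle costs 1/2; the other faces give their surplus, 1 - 4/5 at a
    corner of a pentagon and 1 - 4/7 at a corner of a longer face. *)
Definition cost (c : corner) : R :=
  match c with Tri => 1 / 2 | Quad => 0 | Pent => - 1 / 5 | Long => - 3 / 7 end.
(** A neighbouring 3-vertex costs 1/3, less 1/7 for each long face next to it,
    because that face gives 3/7 to it as well. *)
Definition fee (c : corner) : R := if is_long c then 1 / 7 else 0.
(** The cost between two consecutive corners, each corner being shared equally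
    between its two sides. *)
Definition gap (c c' : corner) (s : bool) : R :=
  (cost c + cost c') / 2 + if s then 1 / 3 - (fee c + fee c') else 0.

(** A word between two positions satisfying [p] is cut into segments at the
    positions satisfying [p]. *)
Lemma sum_runs (p : pred nat) (F : nat -> R) (c : R) :
    (forall i, p i -> exists k, [/\ (0 < k)%N, p (i + k)%N,
       forall j, (0 < j < k)%N -> ~~ p (i + j)%N &
       \sum_(j < k) F (i + j)%N <= c * k%:R]) ->
  forall m i, p i -> p (i + m)%N -> \sum_(j < m) F (i + j)%N <= c * m%:R.
Proof.
move=> run m; elim/ltn_ind: m => m IH i pi pm.
have [->|m0] := posnP m; first by rewrite big_ord0 mulr0.
have [k [k0 pk nk le_k]] := run i pi.
have km : (k <= m)%N.
  by rewrite leqNgt; apply/negP => lt; have := nk m; rewrite m0 lt pm => /(_ isT).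
have [l El] : exists l, m = (k + l)%N by exists (m - k)%N; rewrite subnKC.
subst m; rewrite big_split_ord natrD mulrDr; apply: lerD => //=.
under eq_bigr do rewrite addnA.
by apply: IH; rewrite // -?addnA // -[l in (l < _)%N]add0n ltn_add2r.
Qed.

Variables (t : nat -> corner) (s : nat -> bool).
Hypothesis W : wheel t s.
Local Notation g i := (gap (t i) (t i.+1) (s i)).

(** The segments of a word are its runs of triangles with half a face at each
    end; there are at most three triangles in a run. Around a run of at least
    two triangles the faces are long. *)
Lemma gap0 i : t i <> Tri -> t i.+1 <> Tri -> g i <= 7 / 30.
Proof.
have := wheel_qq W (i := i); rewrite /gap /fee.
by case: (t i); case: (t i.+1) => //= h _ _; (try rewrite (h erefl erefl)); case: (s i); lra.
Qed.

Lemma gap0_tri i : t i <> Tri -> t i.+1 <> Tri ->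
  t i = Long \/ t i.+1 = Long \/ t i = Quad /\ t i.+1 = Quad -> g i <= 0.
Proof.
have := wheel_qq W (i := i); rewrite /gap /fee.
case: (t i); case: (t i.+1) => //= h _ _; (try rewrite (h erefl erefl)); case: (s i);
 try lra; by move=> [|[|[]]].
Qed.

Lemma beside i : t i.+1 = Tri -> t i <> Tri -> t i = Quad \/ t i = Long.
Proof.
by move=> T; have := wheel_pt W (i := i); case: (t i) => // h; first [by left|by right|by case: (h erefl T)].
Qed.

Lemma beside_r i : t i = Tri -> t i.+1 <> Tri -> t i.+1 = Quad \/ t i.+1 = Long.
Proof.
by move=> T; have := wheel_tp W T; case: (t i.+1) => // h; first [by left|by right|by case: h].
Qed.

Lemma beside2 i : t i.+1 = Tri -> t i.+2 = Tri -> t i <> Tri -> t i = Long.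
Proof.
move=> T1 T2 nT; have [E|//] := beside T1 nT.
by have := wheel_qtt W E T1.
Qed.

Lemma beside2_r i : t i = Tri -> t i.+1 = Tri -> t i.+2 <> Tri -> t i.+2 = Long.
Proof.
move=> T1 T2 nT; have [E|//] := beside_r T2 nT.
by have := wheel_ttq W T1 T2.
Qed.

Lemma gap1 i : t i <> Tri -> t i.+1 = Tri -> t i.+2 <> Tri -> g i + g i.+1 <= 5 / 6.
Proof.
move=> n0 T1 n2; have := wheel_ss W T1; rewrite /gap /fee T1.
have [->|->] := beside T1 n0; have [->|->] := beside_r T1 n2 => /=;
  by case: (s i); case: (s i.+1) => //= h; try (by have := h isT); lra.
Qed.

Lemma gap1_long i : t i <> Tri -> t i.+1 = Tri -> t i.+2 <> Tri ->
  t i = Long \/ t i.+2 = Long -> g i + g i.+1 <= 13 / 21.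
Proof.
move=> n0 T1 n2; have := wheel_ss W T1; rewrite /gap /fee T1.
have [->|->] := beside T1 n0; have [->|->] := beside_r T1 n2 => /= h [//|//] _;
  by move: h; case: (s i); case: (s i.+1) => //= h; try (by have := h isT); lra.
Qed.

Lemma gap1_long2 i : t i = Long -> t i.+1 = Tri -> t i.+2 = Long ->
  g i + g i.+1 <= 11 / 42.
Proof.
move=> E0 T1 E2; have := wheel_ss W T1; rewrite /gap /fee T1 E0 E2 /=.
by case: (s i); case: (s i.+1) => //= h; try (by have := h isT); lra.
Qed.

Lemma gap2 i : t i <> Tri -> t i.+1 = Tri -> t i.+2 = Tri -> t i.+3 <> Tri ->
  g i + (g i.+1 + g i.+2) <= 20 / 21.
Proof.
move=> n0 T1 T2 n3; have := wheel_ss W T1; have := wheel_ss W T2.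
rewrite /gap /fee T1 T2 (beside2 T1 T2 n0) (beside2_r T1 T2 n3) /=.
by case: (s i); case: (s i.+1); case: (s i.+2) => //= h1 h2;
  try (by have := h1 isT); try (by have := h2 isT); lra.
Qed.

Lemma gap3 i : t i <> Tri -> t i.+1 = Tri -> t i.+2 = Tri -> t i.+3 = Tri ->
  t i.+4 <> Tri /\ g i + (g i.+1 + (g i.+2 + g i.+3)) <= 67 / 42.
Proof.
move=> n0 T1 T2 T3; have n4 := wheel_fan W T1 T2 T3; split=> //.
have := wheel_ss W T1; have := wheel_ss W T2; have := wheel_ss W T3.
rewrite /gap /fee T1 T2 T3 (beside2 T1 T2 n0) (beside2_r T2 T3 n4) /=.
by case: (s i); case: (s i.+1); case: (s i.+2); case: (s i.+3) => //= h1 h2 h3;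
  try (by have := h1 isT); try (by have := h2 isT); try (by have := h3 isT); lra.
Qed.

Let triP c : reflect (c = Tri) (is_tri c).
Proof. by case: c; constructor. Qed.

Lemma runs_le (c : R) :
    (forall i, t i <> Tri -> t i.+1 <> Tri -> g i <= c) ->
    (forall i, t i <> Tri -> t i.+1 = Tri -> t i.+2 <> Tri -> g i + g i.+1 <= c * 2) ->
    (forall i, t i <> Tri -> t i.+1 = Tri -> t i.+2 = Tri -> t i.+3 <> Tri ->
       g i + (g i.+1 + g i.+2) <= c * 3) ->
    (forall i, t i <> Tri -> t i.+1 = Tri -> t i.+2 = Tri -> t i.+3 = Tri ->
       g i + (g i.+1 + (g i.+2 + g i.+3)) <= c * 4) ->
  forall m i, t i <> Tri -> t (i + m)%N <> Tri -> \sum_(j < m) g (i + j)%N <= c * m%:R.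
Proof.
move=> h1 h2 h3 h4 m i /triP ni /triP nm.
apply: (sum_runs (p := fun i => ~~ is_tri (t i)) (F := fun i => g i)) => // {i ni nm m} i /triP n0.
case: (triP (t i.+1)) => [T1|n1]; last first.
  exists 1%N; rewrite addn1; split=> //; first exact/triP.
    by case=> [|[|?]] //; rewrite ?andbF.
  by rewrite big_ord_recl big_ord0 /= addn0 addr0 mulr1; apply: h1.
case: (triP (t i.+2)) => [T2|n2]; last first.
  exists 2%N; rewrite addn2; split=> //; first exact/triP.
    by case=> [|[|?]] //; rewrite addn1 T1.
  by rewrite !big_ord_recl big_ord0 /= addn0 addn1 addr0; apply: h2.
case: (triP (t i.+3)) => [T3|n3]; last first.
  exists 3%N; rewrite addn3; split=> //; first exact/triP.
    by case=> [|[|[|?]]] //; rewrite ?addn1 ?addn2 ?T1 ?T2.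
  by rewrite !big_ord_recl big_ord0 /= addn0 addn1 addn2 addr0; apply: h3.
have [n4 _] := gap3 n0 T1 T2 T3.
exists 4%N; rewrite addn4; split=> //; first exact/triP.
  by case=> [|[|[|[|?]]]] //; rewrite ?addn1 ?addn2 ?addn3 ?T1 ?T2 ?T3.
by rewrite !big_ord_recl big_ord0 /= addn0 addn1 addn2 addn3 addr0; apply: h4.
Qed.

Lemma wheel_general m i : t i <> Tri -> t (i + m)%N <> Tri ->
  \sum_(j < m) g (i + j)%N <= 3 / 7 * m%:R.
Proof.
apply: runs_le => {m} i.
- by move=> h0 h1; have := gap0 h0 h1; lra.
- by move=> h0 h1 h2; have := gap1 h0 h1 h2; lra.
- by move=> h0 h1 h2 h3; have := gap2 h0 h1 h2 h3; lra.
by move=> h0 h1 h2 h3; have [_] := gap3 h0 h1 h2 h3; lra.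
Qed.

Section Closed.
Variable d : nat.
Hypothesis per_t : forall i, t (i + d)%N = t i.
Hypothesis per_s : forall i, s (i + d)%N = s i.

Lemma exists_nontri : exists i, t i <> Tri.
Proof.
case: (triP (t 0)) => [T0|?]; last by exists 0%N.
case: (triP (t 1)) => [T1|?]; last by exists 1%N.
case: (triP (t 2)) => [T2|?]; last by exists 2%N.
by exists 3%N; apply: (wheel_fan W T0 T1 T2).
Qed.

Lemma gap_per i : g (i + d)%N = g i.
Proof. by rewrite -addSn !per_t per_s. Qed.

(** Each segment costs at most 3/7 for each corner, and 3/7 d <= d - 4 when
    d >= 7. *)
Lemma big_wheel : (7 <= d)%N -> \sum_(j < d) g j <= d%:R - 4.
Proof.
move=> d7; have [i ni] := exists_nontri.
rewrite -(sum_shift i gap_per); apply: le_trans (wheel_general ni _) _.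
  by rewrite per_t.
by have : 7 <= d%:R :> R; [rewrite (ler_nat _ 7) | lra].
Qed.

(** Six corners must cost at most 1/3 each on average. This holds for each
    segment, except for three triangles in a row and for a triangle between two
    quadrangles; in these two cases the rest of the word is so short that it can
    be enumerated. *)
Lemma wheel_six : d = 6%N -> \sum_(j < d) g j <= 2.
Proof.
move=> d6; have six i : \sum_(j < d) g j =
    g i + (g i.+1 + (g i.+2 + (g i.+3 + (g i.+4 + g i.+4.+1)))).
  rewrite -(sum_shift i gap_per) d6 !big_ord_recl big_ord0 /= addr0 /bump /=.
  by rewrite !addnS !addn0.
have per6 i : t i.+4.+2 = t i by rewrite -[RHS]per_t d6 !addnS addn0.
have [[i [n0 T1 T2 T3]]|no3] := pselect (exists i,
   [/\ t i <> Tri, t i.+1 = Tri, t i.+2 = Tri & t i.+3 = Tri]).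
  have [n4 le3] := gap3 n0 T1 T2 T3; rewrite (six i).
  have E4 := beside2_r T2 T3 n4; have E0 := beside2 T1 T2 n0.
  case: (triP (t i.+4.+1)) => [T5|n5].
    have := gap1_long2 E4 T5; rewrite per6 => /(_ E0); lra.
  have n6 : t i.+4.+2 <> Tri by rewrite per6.
  have := gap0_tri n4 n5 (or_introl E4).
  have : g i.+4.+1 <= 0 by apply: gap0_tri => //; right; left; rewrite per6.
  lra.
have [[i [Q0 T1 Q2]]|noq] := pselect (exists i, [/\ t i = Quad, t i.+1 = Tri & t i.+2 = Quad]).
  rewrite (six i); have n0 : t i <> Tri by rewrite Q0.
  have n2 : t i.+2 <> Tri by rewrite Q2.
  have n3 := wheel_tqt W T1 Q2; have le1 := gap1 n0 T1 n2.
  have n6 : t i.+4.+2 <> Tri by rewrite per6.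
  have n5 : t i.+4.+1 <> Tri.
    by move/(wheel_tqt W); rewrite per6 Q0 => /(_ erefl); rewrite -(per6 i.+1) in T1.
  case: (triP (t i.+4)) => [T4|n4]; last first.
    have := gap0 n2 n3; have := gap0 n3 n4; have := gap0 n4 n5; have := gap0 n5 n6; lra.
  have le4 := gap1 n3 T4 n5.
  have le2 : g i.+2 <= 0 by apply: gap0_tri => //; case: (beside T4 n3); tauto.
  have le5 : g i.+4.+1 <= 0.
    apply: gap0_tri => //; rewrite per6; case: (beside_r T4 n5); tauto.
  lra.
have [i ni] := exists_nontri; rewrite -(sum_shift i gap_per).
have -> : 2 = 1 / 3 * d%:R :> R by rewrite d6; lra.
apply: runs_le; rewrite ?per_t // {i ni} => i.
- by move=> h0 h1; have := gap0 h0 h1; lra.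
- move=> h0 h1 h2; suff : g i + g i.+1 <= 13 / 21 by lra.
  apply: gap1_long => //; case: (beside h1 h0); case: (beside_r h1 h2); try tauto.
  by move=> E2 E0; case: noq; exists i.
- by move=> h0 h1 h2 h3; have := gap2 h0 h1 h2 h3; lra.
by move=> h0 h1 h2 h3; case: no3; exists i.
Qed.

(** Neighbours of 5-vertices are not 3-vertices. If three of the corners are
    triangles, then the other two are next to two consecutive triangles, and so
    they are long. *)
Lemma wheel_five : d = 5%N -> (forall i, s i = false) -> \sum_(j < d) g j <= 1.
Proof.
move=> d5 s0; have gE i : g i = (cost (t i) + cost (t i.+1)) / 2.
  by rewrite /gap s0 addr0.
have per5 i : t i.+4.+1 = t i by rewrite -[RHS]per_t d5 !addnS addn0.
have [i n0] := exists_nontri; rewrite -(sum_shift i gap_per) d5.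
rewrite !big_ord_recl big_ord0 /= /bump /= !addnS !addn0 !gE per5.
have h c : cost c <= 1 / 2 by case: c => /=; lra.
have h' c : c <> Tri -> cost c <= 0 by case: c => //=; lra.
have l0 := h' _ n0.
have F1 := @wheel_fan _ _ W i.+1; have B1 := @beside2 i; have B2 := @beside2_r i.+1.
have B3 := @beside2_r i.+2; have B0 := @beside2_r i.+3.
have B5 := @beside2 i.+2; have B6 := @beside2 i.+1.
rewrite per5 in B0.
have h1 := h (t i.+1); have h2 := h (t i.+2); have h3 := h (t i.+3); have h4 := h (t i.+4).
case: (triP (t i.+1)) => [T1|/[dup] N1 /h' n1]; case: (triP (t i.+2)) => [T2|/[dup] N2 /h' n2];
 case: (triP (t i.+3)) => [T3|/[dup] N3 /h' n3]; case: (triP (t i.+4)) => [T4|/[dup] N4 /h' n4]; try lra.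
- by case: (F1 T1 T2 T3).
- rewrite (B1 T1 T2 n0) (B3 T2 T3 N4) T1 T2 T3 /=; lra.
- rewrite (B1 T1 T2 n0) (B2 T1 T2 N3) T1 T2 T4 /=; lra.
- rewrite (B5 T3 T4 N2) (B0 T3 T4 n0) T1 T3 T4 /=; lra.
- rewrite (B6 T2 T3 N1) (B0 T3 T4 n0) T2 T3 T4 /=; lra.
Qed.
End Closed.
End Words.

(** * Graphs without 6-cycles: discharging *)

(** Lengths below 3 and the length 6 do not occur: a face is bounded by a cycle,
    and there are no 6-cycles. *)
Definition kind (m : nat) : corner :=
  match m with 3 => Tri | 4 => Quad | 5 => Pent | _ => Long end.

Lemma kind3 m : kind m = Tri -> m = 3.
Proof. by case: m => [|[|[|[|[|[|?]]]]]].
Qed.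
Lemma kind4 m : kind m = Quad -> m = 4.
Proof. by case: m => [|[|[|[|[|[|?]]]]]]. Qed.
Lemma kind5 m : kind m = Pent -> m = 5.
Proof. by case: m => [|[|[|[|[|[|?]]]]]]. Qed.

Lemma face_share (R : realFieldType) m : 3 < m -> m <> 6 ->
  (0 <= 1 - 4 / m%:R + cost R (kind m))%R.
Proof.
move=> m3 m6; have [m7|] := leqP 7 m; last by case: m m3 m6 => [|[|[|[|[|[|[|k]]]]]]] //= _ _ _; lra.
have -> : kind m = Long by case: m m7 {m3 m6} => [|[|[|[|[|[|[|k]]]]]]].
have m0 : (0 < m%:R :> R)%R by rewrite ltr0n; apply: leq_trans m7.
suff : (4 / m%:R <= 4 / 7 :> R)%R by rewrite /=; lra.
by rewrite ler_pdivrMr //; have : (7 <= m%:R :> R)%R; [rewrite (ler_nat _ 7)|lra].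
Qed.

Section NoSixCycle.
Variable R : realFieldType.
Variables (V : finType) (a : rel V) (n : V * V -> V * V) (U Q X : {set V}).
Hypothesis fm : frag_map a n U Q X.
Hypothesis noC6 : forall s : seq V, size s = 6 -> ucycle a s -> False.
Hypothesis deg3 : forall x, x \in U -> x \notin Q -> 3 <= deg a x.
Hypothesis light : forall x y, x \notin Q -> y \notin Q -> a x y ->
  9 <= deg a x + deg a y.
Hypothesis hubX : forall x, x \in U -> x \notin Q -> deg a x = 3 ->
  (forall y z, a x y -> a x z -> y != z -> a y z) -> x \in X.

Local Notation face := (face n).
Local Notation flen := (flen n).
Local Notation asym := (fm_sym fm).
Local Notation airr := (fm_irr fm).
Local Notation mapn := (fm_map fm).

Definition small x := (x \notin Q) && (deg a x == 3).

Lemma small_light x y : small x -> a x y -> y \notin Q -> 5 < deg a y.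
Proof. by move=> /andP[xQ /eqP x3] xy yQ; have := light xQ yQ xy; rewrite x3; lia. Qed.

Lemma star_wheel v x0 : a v x0 -> v \notin Q -> 4 < deg a v ->
  wheel (fun i => kind (flen (v, nb n (v, x0) i))) (fun i => small (nb n (v, x0) i)).
Proof.
move=> vx0 vQ v5; split=> i; have [y vy Ry] := rebase fm i vx0;
  have R0 := Ry 0; have R1 := Ry 1; have R2 := Ry 2; have R3 := Ry 3;
  rewrite addn0 in R0; rewrite addn1 in R1; rewrite addn2 in R2; rewrite addn3 in R3.
- rewrite -?R3 -?R2 -?R1 -?R0 => /kind3 T1 /kind3 T2 /kind3 T3 /kind3 T4.
  exact: (four_fan fm noC6 v5 vy T1 T2 T3 T4).
- rewrite -?R3 -?R2 -?R1 -?R0 => /kind3 T1 /kind3 T2 /kind4.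
  exact: (two_tri_quad_face fm noC6 v5 vy).
- rewrite -?R3 -?R2 -?R1 -?R0 => /kind4 T1 /kind3 T2 /kind3.
  exact: (quad_two_tri_face fm noC6 v5 vy).
- rewrite -?R3 -?R2 -?R1 -?R0 => /kind3 T1 /kind5.
  exact: (tri_pent fm noC6 v5 vy).
- rewrite -?R3 -?R2 -?R1 -?R0 => /kind5 T1 /kind3.
  exact: (pent_tri fm noC6 v5 vy).
- rewrite -?R3 -?R2 -?R1 -?R0 => /kind3 T1 /kind4 T2 /kind3.
  exact: (tri_quad_tri fm noC6 v5 vy).
- rewrite -?R3 -?R2 -?R1 -?R0 => /kind4 T1 /kind4 T2.
  have := two_quads_face fm noC6 v5 vy T1 T2.
  by rewrite /small; case: eqP => [->|]; rewrite ?andbF.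
rewrite -?R3 -?R2 -?R1 -?R0 => /kind3 T2 s1; apply/negbTE/negP => s2.
have [a12 _ _ _] := nb_tri fm (vy : dart a (v, y)) T2.
case/andP: (s2) => s2Q /eqP s23.
by have := small_light s1 a12 s2Q; rewrite s23.
Qed.

Local Open Scope ring_scope.

(** What [d.1] pays to [d.2] if that is a 3-vertex; the two faces are those on
    the sides of the edge. *)
Definition levy (d : V * V) : R :=
  if small d.2 then 1 / 3 - (fee R (kind (flen d)) + fee R (kind (flen (swapd d)))) else 0.

Lemma fee_ge0 c : 0 <= fee R c. Proof. by rewrite /fee; case: c => /=; lra. Qed.
Lemma fee_le c : fee R c <= 1 / 7. Proof. by rewrite /fee; case: c => /=; lra. Qed.

Lemma levy_ge0 d : 0 <= levy d.
Proof.
rewrite /levy; case: ifP => _; last by lra.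
have := fee_le (kind (flen d)); have := fee_le (kind (flen (swapd d))); lra.
Qed.

Lemma levy_le d : levy d <= (small d.2)%:R / 3.
Proof.
rewrite /levy; case: ifP => _ /=; last by lra.
have := fee_ge0 (kind (flen d)); have := fee_ge0 (kind (flen (swapd d))); lra.
Qed.

Lemma star_cost v : v \in U -> v \notin Q -> (4 < deg a v)%N ->
  node_sum a (fun d => cost R (kind (flen d)) + levy d) v <= (deg a v)%:R - 4.
Proof.
move=> vU vQ v5; have [x0 vx0] : exists y, a v y.
  by apply/card_gt0P; apply: ltn_trans v5.
have dd : dart a (v, x0) by [].
have W := star_wheel vx0 vQ v5.
set t := (fun i => kind _) in W; set s := (fun i => small _) in W.
have tper i : t (i + deg a v)%N = t i by rewrite /t (nb_per fm).
have sper i : s (i + deg a v)%N = s i by rewrite /s (nb_per fm).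
have -> : node_sum a (fun d => cost R (kind (flen d)) + levy d) v =
    \sum_(j < deg a v) gap R (t j) (t j.+1) (s j).
  rewrite (node_sumE fm _ dd) /=.
  have -> : \sum_(j < deg a v) gap R (t j) (t j.+1) (s j) =
     \sum_(j < deg a v) (cost R (t j) +
        if s j then 1 / 3 - (fee R (t j) + fee R (t j.+1)) else 0).
    rewrite /gap !big_split /= -mulr_suml big_split /=; congr (_ + _).
    have -> : \sum_(i < deg a v) cost R (t i.+1) = \sum_(i < deg a v) cost R (t i).
      rewrite -(@sum_shift _ (fun i => cost R (t i)) _ 1) //.
      by move=> i; rewrite tper.
    lra.
  apply: eq_bigr => j _; rewrite (nbE fm _ dd) /levy /=; congr (_ + _).
  rewrite -/(s j) -/(t j); case: (s j) => //; congr (_ - (_ + _)); congr (fee _ (kind _)).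
  by rewrite /swapd /= -(fm_flen_face fm) (nb_face fm _ dd).
have [d7|] := leqP 7 (deg a v); first exact: (big_wheel R W tper sper).
rewrite ltnS leq_eqVlt => /orP[/eqP d6|].
  by apply: le_trans (wheel_six R W tper sper d6) _; rewrite d6; lra.
rewrite ltnS => d5'; have d5 : deg a v = 5%N by apply/eqP; rewrite eqn_leq d5'.
have s0 i : s i = false.
  apply/negbTE/negP => si; have vi := nb_adj fm i dd; rewrite asym in vi.
  by have := small_light si vi vQ; rewrite d5.
by apply: le_trans (wheel_five R W tper sper d5 s0) _; rewrite d5; lra.
Qed.

Definition rich x := (x \in Q) || (4 < deg a x)%N.
Definition income (d : V * V) : R :=
  if kind (flen d) is Tri then - (rich d.1)%:R / 2 else - cost R (kind (flen d)).

Lemma income_rich d : rich d.1 -> income d = - cost R (kind (flen d)).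
Proof. by rewrite /income => ->; case: (kind _) => /=; lra. Qed.

Lemma income_fee d : rich d.1 = false -> 3 * fee R (kind (flen d)) <= income d.
Proof. by rewrite /income /fee => ->; case: (kind _) => /=; lra. Qed.

Lemma income_ge d : - (flen d == 3%N)%:R / 2 <= income d.
Proof.
rewrite /income; case E: (kind (flen d)) => /=; first last.
- by case: (_ == _) => /=; lra.
- by case: (_ == _) => /=; lra.
- by case: (_ == _) => /=; lra.
by rewrite (kind3 E) /=; case: (rich _) => /=; lra.
Qed.

Definition weight (d : V * V) : R :=
  (1 - 4 / (deg a d.1)%:R) + (income d + (levy (swapd d) - levy d)).

Lemma weightE v : (0 < deg a v)%N -> node_sum a weight v =
  (deg a v)%:R - 4 + (node_sum a income v +
    (node_sum a (levy \o @swapd V) v - node_sum a levy v)).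
Proof.
move=> dv; rewrite -(node_vertex R dv) /weight !node_sumD; congr (_ + (_ + (_ + _))).
by rewrite /node_sum sumrN.
Qed.

Lemma node_sum_ge0 (F : V * V -> R) v : (forall d, dart a d -> d.1 = v -> 0 <= F d) ->
  0 <= node_sum a F v.
Proof. by move=> h; apply: sumr_ge0 => d /andP[dd /eqP]; apply: h. Qed.

Lemma face_sum_weight : \sum_(d | dart a d) weight d <=
  \sum_(d | dart a d) (2 - 4 / (deg a d.1)%:R - 4 / (flen d)%:R).
Proof.
rewrite -subr_ge0 -sumrB.
rewrite (_ : \sum_(d | dart a d) _ =
    \sum_(d | dart a d) (1 - 4 / (flen d)%:R - income d + (levy d - levy (swapd d)))); last first.
  by apply: eq_bigr => d _; rewrite /weight; lra.
rewrite big_split /= [X in _ + X]sumrB (sum_swapd fm) subrr addr0.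
have big2 x y : a x y -> rich x || rich y.
  move=> xy; rewrite /rich; case: (boolP (x \in Q)) => //= xQ.
  case: (boolP (y \in Q)) => [|yQ]; rewrite /= ?orbT //.
  by have := light xQ yQ xy; lia.
apply: (sum_faces_ge0 fm) => [[x y] xy f3|d dd nf3].
  have [z [yz zx E1 E2 E3]] := flen3P fm xy f3.
  have f1 : flen (y, z) = 3%N by rewrite -E1 (fm_flen_face fm).
  have f2 : flen (z, x) = 3%N by rewrite -E2 (fm_flen_face fm).
  rewrite E1 E2 /income f3 f1 f2 /=.
  have := big2 _ _ xy; have := big2 _ _ yz; have := big2 _ _ zx.
  by case: (rich x); case: (rich y); case: (rich z) => //= _ _ _; lra.
have ge3 := fm_flen_ge3 fm dd.
have n6 : flen d <> 6%N.
  by move=> f6; apply: (noC6 _ (face_ucycle fm dd)); rewrite size_map size_iota.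
have h : (3 < flen d)%N by rewrite ltn_neqAle ge3 andbT eq_sym; apply/eqP.
have := face_share R h n6; rewrite /income; case E: (kind _) => //=; try lra.
by case: nf3; apply: kind3.
Qed.

(** A 3-vertex with b long faces receives 3b/7 from them and 1 - 2b/7 from its
    neighbours. *)
Lemma core_weight v : v \in U -> v \notin Q -> 0 <= node_sum a weight v.
Proof.
move=> vU vQ; have d3 := deg3 vU vQ; have d0 : (0 < deg a v)%N by apply: leq_trans d3.
rewrite weightE //; have paid : 0 <= node_sum a (levy \o @swapd V) v.
  by apply: node_sum_ge0 => d _ _; apply: levy_ge0.
have [gt4|le4] := ltnP 4 (deg a v).
  have := star_cost vU vQ gt4; rewrite node_sumD.
  have -> : node_sum a income v = - node_sum a (fun d => cost R (kind (flen d))) v.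
    rewrite /node_sum -sumrN; apply: eq_bigr => d /andP[_ /eqP dv].
    by apply: income_rich; rewrite dv /rich gt4 orbT.
  lra.
have nobig : rich v = false by rewrite /rich (negPf vQ) ltnNge le4.
have nolevy : node_sum a levy v = 0.
  apply: big1 => d /andP[dd /eqP dv]; rewrite /levy; case: ifP => // sm.
  have vd : a d.2 v by rewrite -dv asym.
  by have := small_light sm vd vQ; lia.
have inc : 3 * node_sum a (fun d => fee R (kind (flen d))) v <= node_sum a income v.
  rewrite -node_sumZ; apply: le_node_sum => d _ dv.
  by apply: income_fee; rewrite dv.
have fee0 : 0 <= node_sum a (fun d => fee R (kind (flen d))) v.
  by apply: node_sum_ge0 => d _ _; apply: fee_ge0.
have [E3|ne3] := eqVneq (deg a v) 3%N; last first.
  have : 4 <= (deg a v)%:R :> R by rewrite (ler_nat _ 4) ltn_neqAle eq_sym ne3.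
  lra.
have -> : node_sum a (levy \o @swapd V) v =
    1 - 2 * node_sum a (fun d => fee R (kind (flen d))) v.
  transitivity (node_sum a (fun d => 1 / 3 + - 1 * (fee R (kind (flen d)) +
     fee R (kind (flen (n d))))) v).
    apply: eq_bigr => d /andP[dd /eqP dv]; rewrite /levy /= /small dv vQ E3 /= swapdK.
    have <- : flen (face (swapd d)) = flen (n d) by rewrite faceE swapdK.
    by rewrite (fm_flen_face fm); lra.
  rewrite node_sumD node_const E3 node_sumZ node_sumD.
  rewrite (node_sum_next fm (fun d => fee R (kind (flen d)))); lra.
rewrite E3; lra.
Qed.

(** Otherwise the neighbour [c] of [q] given by [fm_attach] is a 3-vertex, and
    the neighbours of [q] before and after it are adjacent to [c], hence not
    3-vertices, hence roots. So [c] would be a hub. *)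
Lemma root_not_tight q : q \in Q -> #|Q| = 3%N -> exists2 d, dart a d /\ d.1 = q &
  flen d <> 3%N \/ ~~ small d.2 && (d.2 \notin Q).
Proof.
move=> qQ Q3; have [c [qc cQ cX]] := fm_attach fm qQ.
have dq : (2 < deg a q)%N by have := deg_Q3 fm qQ; rewrite Q3.
case: (boolP [exists d, [&& dart a d, d.1 == q &
    (flen d != 3%N) || ~~ small d.2 && (d.2 \notin Q)]]).
  case/existsP=> d /and3P[dd /eqP d1 /orP dP]; exists d => //.
  by case: dP => [/eqP|]; [left|right].
move/existsPn => no; case/negP: cX.
have tight y : a q y -> flen (q, y) = 3%N /\ (small y || (y \in Q)).
  move=> qy; have := no (q, y); rewrite eqxx /dart /= qy /= negb_or negb_and !negbK.
  by case/andP=> /eqP.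
have tightQ y : a q y -> a c y -> y \in Q.
  move=> qy cy; have [_ /orP[|//]] := tight y qy; move=> sy.
  have [_ sc] := tight c qc; rewrite (negPf cQ) orbF in sc.
  case/andP: (sy) => yQ /eqP y3.
  by have := small_light sc cy yQ; rewrite y3.
have [f3 sc] := tight c qc; rewrite (negPf cQ) orbF in sc.
have [z [cz zq _ _ Ez]] := flen3P fm qc f3.
have dn : dart a (n (q, c)) by rewrite (map_dart mapn).
have En : n (q, c) = (q, (n (q, c)).2) by rewrite [LHS]surjective_pairing (map_src mapn).
set y := (n (q, c)).2 in En; rewrite En in dn.
have [fy _] := tight y dn; have [c' [yc' c'q _ _ Ec]] := flen3P fm dn fy.
have Ec' : c' = c by move: Ec; rewrite -En => /(map_inj mapn) [].
subst c'; have cy : a c y by rewrite asym.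
have qz : a q z by rewrite asym.
have yz : y != z := rot3 fm qz Ez En dq.
have [yQ zQ] := (tightQ y dn cy, tightQ z qz cz).
have ne p r : a p r -> p != r by apply: contraTneq => ->; rewrite airr.
case/andP: sc => _ /eqP c3; have nbQ p : a c p -> p \in Q.
  have s3 : #|[set q; y; z]| = 3%N.
    by rewrite -setUA cardsU1 cards2 !inE negb_or yz (ne q y dn) (ne q z qz).
  have sub : [set q; y; z] \subset a c.
    apply/subsetP => r; rewrite !inE -orbA => /or3P[]/eqP->.
    - by rewrite asym in qc.
    - exact: cy.
    exact: cz.
  have /subset_cardP h : #|[set q; y; z]| = #|a c| by rewrite s3 -[#|a c|]/(deg a c).
  by move=> cp; have := h sub p; rewrite !inE [X in _ = X]cp -orbA => /or3P[]/eqP->.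
apply: hubX => // [|p r cp cr pr]; first exact: (fm_in fm cz).
by apply: (fm_clique fm) => //; apply: nbQ.
Qed.

(** A root of degree d loses at most d/2 to triangles and d/3 to 3-vertices, and
    nothing of the latter kind to the other roots. With three roots, d = 3 or 4
    would still be too small without the previous lemma. *)
Lemma root_weight q : q \in Q -> - 8 < #|Q|%:R * node_sum a weight q.
Proof.
move=> qQ; rewrite weightE ?(deg_Q fm) //.
have paid : 0 <= node_sum a (levy \o @swapd V) q.
  by apply: node_sum_ge0 => d _ _; apply: levy_ge0.
pose F d : R := (flen d == 3%N)%:R / 2 + ((small d.2)%:R / 3 + (d.2 \in Q)%:R / 3).
have F_le d : F d <= 5 / 6.
  by rewrite /F /small; case: (_ == 3%N); case: (d.2 \in Q); case: (_ == 3%N) => /=; lra.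
have le1 : node_sum a levy q - node_sum a income q <=
    node_sum a F q - 1 / 3 * (#|Q|%:R - 1).
  have -> : node_sum a F q = node_sum a (fun d => (flen d == 3%N)%:R / 2 + (small d.2)%:R / 3) q +
      1 / 3 * node_sum a (fun d => (d.2 \in Q)%:R) q.
    rewrite -node_sumZ -node_sumD; apply: eq_bigr => d _; rewrite /F; lra.
  have : #|Q|%:R - 1 <= node_sum a (fun d => (d.2 \in Q)%:R) q :> R.
    rewrite node_card (cardsD1 q) qQ add1n -natr1 addrK ler_nat.
    rewrite -(card_imset (Q :\ q) (f := pair q)); last by move=> y z [].
    apply: subset_leq_card; apply/subsetP => d /imsetP[p]; rewrite in_setD1 => /andP[pq pQ] ->.
    by rewrite !inE /dart /= eqxx pQ (fm_clique fm) // eq_sym.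
  suff : node_sum a levy q - node_sum a income q <=
      node_sum a (fun d => (flen d == 3%N)%:R / 2 + (small d.2)%:R / 3) q by lra.
  rewrite /node_sum -sumrB; apply: ler_sum => d _.
  by have := levy_le d; have := income_ge d; lra.
have le2 : node_sum a F q <= (deg a q)%:R * (5 / 6) - (#|Q| == 3%N)%:R / 3.
  case: eqP => [Q3|_]; last first.
    by rewrite mul0r subr0 -node_const; apply: le_node_sum => d _ _.
  have [d [dd dq] dP] := root_not_tight qQ Q3.
  suff : node_sum a F q + 1 / 3 <= node_sum a (fun=> 5 / 6) q by rewrite node_const /=; lra.
  have Pd : dart a d && (d.1 == q) by rewrite dd dq eqxx.
  rewrite /node_sum (bigD1 d Pd) /= [leRHS](bigD1 d Pd) /= addrAC.
  apply: lerD; last by apply: ler_sum => e _; apply: F_le.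
  rewrite /F; case: dP => [/eqP/negPf->|/andP[/negPf-> /negPf->]] /=.
    by rewrite /small; case: (d.2 \in Q); case: (_ == 3%N) => /=; lra.
  by case: (_ == 3%N) => /=; lra.
have := fm_Q3 fm; have := deg_Q3 fm qQ; have := card_Q qQ.
have : 1 <= (deg a q)%:R :> R by rewrite (ler_nat _ 1) (deg_Q fm).
move: le1 le2; move: (node_sum a F q) (node_sum a levy q) (node_sum a income q) => f l i.
case: #|Q| => [|[|[|[|]]]] //= le1 le2 h1 _; rewrite -?(ler_nat R) => h2 _; lra.
Qed.

Lemma no_six_cycle_light : False.
Proof.
apply: (discharge fm (w := weight)); first exact: face_sum_weight.
  exact: core_weight.
exact: root_weight.
Qed.

End NoSixCycle.

(** * Greedy colouring and the theorem *)
Section Greedy.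
Variables (H : sgraph) (k : nat).

Lemma edge_ends (e : edge H) x y : val e = [set x; y] -> adj x y.
Proof.
move=> eE; have := valP e; rewrite eE inE => /existsP[p /existsP[q /andP[pq /eqP E]]].
have ne p' q' : adj (s := H) p' q' -> p' != q'.
  by apply: contraTneq => ->; rewrite adj_irrefl.
have := cards2 x y; rewrite E cards2 (ne _ _ pq) => -[] /esym xy.
have : x \in [set p; q] by rewrite -E !inE eqxx.
have : y \in [set p; q] by rewrite -E !inE eqxx orbT.
rewrite !inE => /orP[]/eqP Ey /orP[]/eqP Ex; subst x y => //.
- by rewrite eqxx in xy.
- by rewrite adj_sym.
by rewrite eqxx in xy.
Qed.

Lemma greedy_choosable :
  (forall S : {set H}, S != set0 ->
     exists2 x, x \in S & #|[set y in S | adj x y]| < k) ->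
  group_choosable H k.
Proof.
move=> thin A _ L cardL tail tailP f.
suff col (S : {set H}) : exists2 c : H -> A, forall v, v \in S -> c v \in L v &
    forall e x y, x \in S -> y \in S -> val e = [set x; y] ->
      tail e = x -> (c x - c y)%R <> f e.
  have [c cL cP] := col setT; exists c; split=> [v|e x y]; first by apply: cL; rewrite inE.
  by apply: cP; rewrite inE.
have [m] := ubnP #|S|; elim: m S => // m IH S; rewrite ltnS => leS.
have [->|S0] := eqVneq S set0.
  by exists (fun=> 0%R) => [v|e x y]; rewrite inE.
have [v vS thinv] := thin S S0; pose S' := S :\ v.
have [|c cL cP] := IH S'; first by move: leS; rewrite (cardsD1 v) vS.
pose g u := if [pick e : edge H | val e == [set u; v]] is Some e
            then (if tail e == v then f e + c u else c u - f e)%R else 0%R.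
have [|a aL /mapP nas] := @fset_avoid _ (L v) (map g (enum [set y in S | adj v y])).
  by rewrite size_map -cardE cardL.
have gE u (e : edge H) : val e = [set u; v] ->
    g u = (if tail e == v then f e + c u else c u - f e)%R.
  move=> eE; rewrite /g; case: pickP => [e' /eqP e'E|/(_ e)]; last by rewrite eE eqxx.
  by have -> : e' = e by apply: val_inj; rewrite e'E.
have nb u (e : edge H) : u \in S -> val e = [set u; v] -> u \in enum [set y in S | adj v y].
  by move=> uS eE; rewrite mem_enum inE uS adj_sym (edge_ends eE).
exists (fun x => if x == v then a else c x) => [x|e x y].
  by case: eqP => [-> // | /eqP xv xS]; apply: cL; rewrite in_setD1 xv.
have [-> _|xv xS] := eqVneq x v.
  have [-> _ /edge_ends|yv yS eE tE E] := eqVneq y v; first by rewrite adj_irrefl.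
  have eE' : val e = [set y; v] by rewrite setUC.
  apply: nas; exists y; first exact: nb yS eE'.
  by rewrite (gE y e eE') tE eqxx -E GRing.subrK.
have [-> _ eE tE E|yv yS] := eqVneq y v; last by apply: cP; rewrite in_setD1 ?xv ?yv.
apply: nas; exists x; first exact: nb xS eE.
by rewrite (gE x e eE) tE (negPf xv) -E GRing.opprB GRing.addrC GRing.subrK.
Qed.
End Greedy.

Section LineSubgraph.
Variable G : sgraph.

Definition span (S : {set edge G}) : rel G :=
  [rel x y | [exists e in S, val e == [set x; y]]].

Lemma span_sym S : symmetric (span S).
Proof. by move=> x y; apply: eq_existsb => e; rewrite setUC. Qed.

Lemma span_adj S : subrel (span S) (@adj G).
Proof. by move=> x y /exists_inP[e _ /eqP]; apply: edge_ends. Qed.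

Lemma span_irr S : irreflexive (span S).
Proof. by move=> x; case E: (span S x x) => //; have := span_adj E; rewrite adj_irrefl. Qed.

Lemma edge_pair (e : edge G) : exists x y, val e = [set x; y].
Proof.
have := valP e; rewrite inE => /existsP[p /existsP[q /andP[_ /eqP E]]].
by exists p, q.
Qed.

Lemma span_deg S x : deg (span S) x <= max_degree G.
Proof.
apply: leq_trans (leq_bigmax x); rewrite /deg /degree.
by apply: subset_leq_card; apply/subsetP => y xy; rewrite inE; apply: (span_adj (S := S)).
Qed.

(** An edge [f] meeting [e] is given by its other end, at [x] or at [y]. *)
Lemma span_line (S : {set edge G}) (e : edge G) x y : e \in S -> val e = [set x; y] ->
  #|[set f in S | line_adj e f]| + 2 <= deg (span S) x + deg (span S) y.
Proof.
move=> eS eE; have xy : span S x y by apply/exists_inP; exists e; rewrite ?eE.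
have yx : span S y x by rewrite span_sym.
pose N (u w : G) := [set [set u; z] | z in [set z | span S u z] :\ w].
have cN u w : span S u w -> #|N u w| + 1 <= deg (span S) u.
  move=> uw; have := cardsD1 w [set z | span S u z]; rewrite inE uw.
  have -> : #|[set z | span S u z]| = deg (span S) u.
    by apply: eq_card => z; rewrite inE.
  by move=> ->; rewrite addnC leq_add2l leq_imset_card.
have : #|[set f in S | line_adj e f]| <= #|N x y :|: N y x|.
  rewrite -(card_imset _ val_inj); apply: subset_leq_card.
  apply/subsetP => F /imsetP[f]; rewrite inE => /andP[fS /andP[ef]] + ->{F}.
  rewrite eE => /set0Pn[u]; rewrite inE => /andP[]; rewrite inE => ue uf.
  have [z fE] : exists z, val f = [set u; z].
    have [p [q fE]] := edge_pair f; move: uf; rewrite fE inE.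
    by case/orP=> /set1P->; [exists q|exists p; rewrite setUC].
  have uz : span S u z by apply/exists_inP; exists f; rewrite ?fE.
  have ne w : [set u; w] = val e -> z != w.
    move=> E; apply: contraNneq ef => zw; apply/eqP; apply: val_inj.
    by rewrite fE zw E.
  rewrite fE; apply/setUP; case/orP: ue => /set1P Eu; subst u.
    by left; apply: imset_f; rewrite in_setD1 inE uz ne.
  by right; apply: imset_f; rewrite in_setD1 inE uz ne // eE setUC.
have [le _] := leq_card_setU (N x y) (N y x).
move: (cN _ _ xy) (cN _ _ yx) le; lia.
Qed.

Lemma heavy_subgraph k : k < chi'_gl G -> exists b : rel G,
  [/\ [/\ symmetric b, irreflexive b & subrel b (@adj G)], exists x y, b x y,
      forall x y, b x y -> k + 2 <= deg b x + deg b y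
    & forall x, deg b x <= max_degree G].
Proof.
rewrite /chi'_gl /chi_gl; case: ex_minnP => c _ minc ltk.
have [S [S0 thick]] : exists S : {set edge G}, S != set0 /\
    forall e, e \in S -> k <= #|[set f in S | line_adj e f]|.
  apply: contrapT => no; have : c <= k; last by rewrite leqNgt ltk.
  apply: minc; apply/asboolP; apply: greedy_choosable => S S0.
  apply: contrapT => no'; apply: no; exists S; split=> // e eS.
  by rewrite leqNgt; apply/negP => lt; apply: no'; exists e.
exists (span S); split; first by split; [exact: span_sym|exact: span_irr|exact: span_adj].
- have [e eS] := set0Pn _ S0; have [x [y eE]] := edge_pair e.
  by exists x, y; apply/exists_inP; exists e; rewrite ?eE.
- move=> x y /exists_inP[e eS /eqP eE].
  by apply: leq_trans (span_line eS eE); rewrite leq_add2r thick.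
exact: span_deg.
Qed.

(** The bound on the maximum degree makes all degrees at least 3, and then two
    3-vertices are not adjacent, since 3 + 3 < k + 2. In particular hubs are
    independent. *)
Lemma heavy_fragment (R : realType) k : planar R G -> k < chi'_gl G ->
    6 < k -> max_degree G < k ->
  exists (a : rel G) n U Q X, [/\ frag_map a n U Q X, subrel a (@adj G),
    forall x, x \in U -> x \notin Q -> k + 2 <= deg a x + max_degree G,
    forall x y, x \notin Q -> y \notin Q -> a x y -> k + 2 <= deg a x + deg a y &
    forall x, x \in U -> x \notin Q -> deg a x = 3 ->
      (forall y z, a x y -> a x z -> y != z -> a y z) -> x \in X].
Proof.
move=> planarG ltk k7 kD.
have [b [[bs bi badj] bne bsum bdeg]] := heavy_subgraph ltk.
have deg_lo x y : b x y -> k + 2 <= deg b x + max_degree G.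
  by move=> xy; apply: leq_trans (bsum _ _ xy) _; rewrite leq_add2l.
have hub x y : x \in hubs b -> b x y -> y \notin hubs b.
  move=> xX xy; apply/negP => yX; have := bsum _ _ xy.
  have E z : z \in hubs b -> deg b z = 3.
    by move/hub_deg <-; apply: eq_card => w; rewrite inE.
  by rewrite !E // leqNgt ltn_addr.
have [||U [Q [X [n [fm dE Xh hX]]]]] := frag_map_exists bs bi _ _ hub bne.
- exact: grid_model_sub badj (planar_grid_model planarG).
- by move=> x y /deg_lo; lia.
have nbE x y : x \in U -> x \notin Q -> b x y = restr b U x y.
  move=> xU xQ; apply/idP/idP => [|/and3P[] //].
  have sub : restr b U x \subset b x by apply/subsetP => z /and3P[].
  have /subset_cardP/(_ sub y) E := dE _ xU xQ.
  by move=> xy; have : y \in b x by []; rewrite -E.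
exists (restr b U), n, U, Q, X; split=> //.
- by move=> x y /and3P[/badj].
- move=> x xU xQ; have [y /and3P[xy _ _]] : exists y, restr b U x y.
    by apply/card_gt0P; apply: (fm_deg_gt0 fm).
  by rewrite dE //; apply: deg_lo xy.
- move=> x y xQ yQ xy; have xU := fm_in fm xy.
  have yU : y \in U by apply: (fm_in fm (y := x)); rewrite (fm_sym fm).
  by rewrite !dE //; apply: bsum; case/and3P: xy.
move=> x xU xQ x3 cl; apply: hX => //; rewrite in_hubs -x3 dE //; apply/andP; split.
  by apply/eqP; apply: eq_card => w; rewrite inE.
apply/cliqueP => y z; rewrite !inE !(nbE x) // => xy xz yz.
by have /and3P[] := cl _ _ xy xz yz.
Qed.

End LineSubgraph.

Lemma cycle3 (G : sgraph) x y z : adj (s := G) x y -> adj y z -> adj x z -> has_cycle G 3.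
Proof.
move=> xy yz xz; have ne p q : adj (s := G) p q -> p != q.
  by apply: contraTneq => ->; rewrite adj_irrefl.
exists [:: x; y; z] => //; rewrite /ucycle /= xy yz adj_sym xz !inE negb_or.
by rewrite (ne _ _ xy) (ne _ _ xz) (ne _ _ yz).
Qed.

Lemma diamond (G : sgraph) v x y z : adj (s := G) v x -> adj v y -> adj v z ->
  adj x y -> adj y z -> x != z -> has_adjacent_triangles G.
Proof.
move=> vx vy vz xy yz xz; have ne p q : adj (s := G) p q -> p != q.
  by apply: contraTneq => ->; rewrite adj_irrefl.
have tri u w r : adj (s := G) u w -> adj u r -> adj w r -> triangle [set u; w; r].
  move=> uw ur wr; split.
    by rewrite -setUA cardsU1 cards2 !inE negb_or !ne.
  move=> p q; rewrite !inE -!orbA => /or3P[]/eqP-> /or3P[]/eqP-> //; rewrite ?eqxx //;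
    by rewrite adj_sym.
exists [set v; y; x], [set v; y; z]; split.
- by apply: tri => //; rewrite adj_sym.
- exact: tri.
- move/setP/(_ x); rewrite !inE eqxx orbT (negPf xz).
  by rewrite eq_sym (negPf (ne _ _ vx)) (negPf (ne _ _ xy)).
exists [set v; y].
  by rewrite inE; apply/existsP; exists v; apply/existsP; exists y; rewrite vy eqxx.
by apply/subsetP => p; rewrite !inE => /orP[]->; rewrite ?orbT.
Qed.

Theorem theorem3p22 (R : realType) (G : sgraph) (planarG : planar R G) :
  [/\ ~ has_cycle G 3 -> 6 <= max_degree G -> chi'_gl G <= max_degree G + 1,
      ~ has_cycle G 3 -> max_degree G = 5 -> chi'_gl G <= 7,
      ~ has_adjacent_triangles G -> chi'_gl G <= maxn 7 (max_degree G + 2),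
      ~ has_cycle G 6 -> chi'_gl G <= maxn 7 (max_degree G + 1)
    & ~ has_cycle G 7 -> chi'_gl G <= maxn 8 (max_degree G + 2)].
Proof.
have cyc k (a : rel G) s : subrel a (@adj G) -> size s = k -> ucycle a s -> has_cycle G k.
  by move=> sub sk /andP[ca us]; exists s => //; rewrite /ucycle (sub_cycle sub).
split=> [no3 D6|no3 D5|nodiam|no6|no7]; rewrite leqNgt; apply/negP.
- case/(heavy_fragment planarG)=> [||a [n [U [Q [X [fm sub lo sums _]]]]]]; try lia.
  apply: (triangle_free_light rat fm) => [x y z /sub xy /sub yz /sub xz|x xU xQ|x y xQ yQ xy x3].
  + by apply: no3; apply: cycle3 xy yz xz.
  + by have := lo x xU xQ; lia.
  by have := sums x y xQ yQ xy; rewrite x3; lia.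
- case/(heavy_fragment planarG)=> [||a [n [U [Q [X [fm sub lo sums _]]]]]]; try lia.
  apply: (triangle_free_light rat fm) => [x y z /sub xy /sub yz /sub xz|x xU xQ|x y xQ yQ xy x3].
  + by apply: no3; apply: cycle3 xy yz xz.
  + by have := lo x xU xQ; lia.
  by have := lo x (fm_in fm xy) xQ; rewrite x3 D5.
- case/(heavy_fragment planarG)=> [||a [n [U [Q [X [fm sub lo sums _]]]]]]; try lia.
  apply: (no_diamond_light rat fm) => [v x y z|x xU xQ|x y xQ yQ xy].
  + move=> /sub vx /sub vy /sub vz /sub xy /sub yz xz.
    by apply: nodiam; apply: diamond vx vy vz xy yz xz.
  + by have := lo x xU xQ; lia.
  by have := sums x y xQ yQ xy; lia.
- case/(heavy_fragment planarG)=> [||a [n [U [Q [X [fm sub lo sums hubX]]]]]]; try lia.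
  apply: (no_six_cycle_light rat fm) => // [s s6 /(cyc 6 a s sub s6) //|x xU xQ|x y xQ yQ xy].
  + by have := lo x xU xQ; lia.
  by have := sums x y xQ yQ xy; lia.
case/(heavy_fragment planarG)=> [||a [n [U [Q [X [fm sub lo sums hubX]]]]]]; try lia.
have X0 : X = set0.
  apply/setP => x; rewrite inE; apply/negP => xX; have [x3 _] := fm_hub fm xX.
  have [y xy] : exists y, a x y by apply/card_gt0P; rewrite [#|_|]x3.
  by have := lo x (fm_in fm xy) (fm_hubQ fm xX); rewrite x3; lia.
subst X; apply: (no_seven_cycle_light rat fm) => [s s7 /(cyc 7 a s sub s7) //|x xU xQ|x y xQ yQ xy].
- by have := lo x xU xQ; lia.
by have := sums x y xQ yQ xy; lia.
Qed.
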